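(* Let $m\ge 1$ and let $\mathbf{L}^N=(L_1^N,\ldots,L_m^N)\in\mathbb{Z}_+^m$, $N=1,2,\ldots$, be a sequence with $\frac1N\mathbf{L}^N\to\mathbf{a}=(a_1,\ldots,a_m)\neq\mathbf{0}$ as $N\to\infty$. Consider the sequence of fusion modules $(\mathbf{C}^2)^{\ast L_1^N}\ast\cdots\ast(\mathbf{C}^{m+1})^{\ast L_m^N}$ of the current algebra $\mathfrak{sl}_2\otimes\mathbf{C}[t]$, and their basic specializations $\sum_{a\in\mathbf{Z}}\tilde T(\mathbf{L}^N,a)(q)$. Let $X_N$ be a random variable whose probability generating function $\mathbb{E}(q^{X_N})$ is this polynomial divided by its value at $q=1$. Then $X_N$ is asymptotically normal, i.e. $$\frac{X_N-\mathbb{E}(X_N)}{\sqrt{\mathrm{Var}(X_N)}}\longrightarrow\mathcal{N}(0,1)\quad\text{in distribution as } N\to\infty,$$ with mean, for each $N$, $$\mathbb{E}(X_N)=\sum_{i=1}^m\Bigg[\Big(\frac i2+i^2\Big)\Big(\sum_{k=i}^m\frac{L_k^N}{k+1}\Big)^2+i\Big(\sum_{k=i}^m\frac{L_k^N}{k+1}\Big)\Big(\sum_{k=1}^{i-1}L_k^N\Big)+\Big(\frac{4i(i+2)-6i}{24(i+1)}\Big)L_i^N\Bigg],$$ and variance satisfying, as $N\to\infty$, $$\frac{1}{N^3}\mathrm{Var}(X_N)\to\tfrac14\,\mathbf{f}\,\Sigma\,\mathbf{f}^t+v(\mathbf{a},\mathbf{b}).$$ Here $b_0=b_{m+1}=0$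 and, for $1\le i,j\le m$, $$b_i=i\sum_{\ell=i}^m\frac{a_\ell}{\ell+1},\qquad f_i=a_i+b_{i+1}+b_{i-1}+2b_i+2\sum_{\ell=1}^{i-1}a_\ell,$$ $$v(\mathbf{a},\mathbf{b})=\frac1{12}\sum_{i=1}^m(a_i+b_{i+1}-b_i)\,b_i\,(a_i+b_{i+1}),$$ $$\Sigma_{i,j}=\min(i,j)\sum_{k=\max(i,j)}^m\frac{a_k}{k+1}-ij\sum_{k=\max(i,j)}^m\frac{a_k}{(k+1)^2},$$ and $\mathbf{f}=(f_1,\ldots,f_m)$ is a row vector.
   Context: $\mathbb{Z}_+$ denotes the nonnegative integers. For $\mathbf{L}=(L_1,\ldots,L_m)\in\mathbb{Z}_+^m$ and an integer $a$, the $q$-supernomial is $$\tilde T(\mathbf{L},a)(q)=\sum_{j_1+\cdots+j_m=a}q^{\sum_{i=1}^m j_i\left(j_i+\sum_{\ell=1}^{i-1}L_\ell\right)}\prod_{\ell=1}^m\genfrac{[}{]}{0pt}{}{L_\ell+j_{\ell+1}}{j_\ell}_q,$$ where the sum is over $(j_1,\ldots,j_m)\in\mathbb{Z}_+^m$, $j_{m+1}=0$, and $\genfrac{[}{]}{0pt}{}{n}{k}_q$ is the Gaussian binomial coefficient (zero unless $0\le k\le n$). It is zero unless $0\le a\le\sum_i iL_i$. The fusion module $\mathcal{F}(\mathbf{L})=(\mathbf{C}^2)^{\ast L_1}\ast\cdots\ast(\mathbf{C}^{m+1})^{\ast L_m}$ is the Feigin--Loktev fusion product of $L_i$ copies of the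 $(i+1)$-dimensional irreducible $\mathfrak{sl}_2$-module, $i=1,\ldots,m$. In the normalization of the grading used here, its graded character is $\chi(\mathcal{F}(\mathbf{L}))(z,q)=\sum_{a\in\mathbf{Z}}z^a\,\tilde T(\mathbf{L},a)(q)$ (a theorem of Feigin and Feigin). The basic specialization is its value at $z=1$, namely $\sum_{a}\tilde T(\mathbf{L},a)(q)$; the claim concerns the probability distribution defined by the coefficients of this polynomial. *)

(* Defs.v *)
From HB Require Import structures.
From mathcomp Require Import all_boot all_order all_algebra.
From mathcomp Require Import all_classical all_reals all_analysis.

Set Implicit Arguments.
Unset Strict Implicit.
Unset Printing Implicit Defensive.

Import Order.TTheory GRing.Theory Num.Theory.
Import numFieldNormedType.Exports.

Local Open Scope classical_set_scope.
Local Open Scope ring_scope.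

(* The source numbers the entries of a vector v of length m as v_1, ..., v_m;
   they are stored here as v 0, ..., v (m-1).  [at1 v k] is the k-th entry in
   the numbering of the source, and is 0 when k is not one of 1, ..., m. *)
Definition at1 (V : nmodType) (m : nat) (v : 'I_m -> V) (k : nat) : V :=
  if k is k'.+1 then oapp v 0 (insub k') else 0.

Section QSupernomial.
Variable F : fieldType.

Definition qfact (n : nat) : {poly F} :=
  \prod_(1 <= i < n.+1) \sum_(0 <= k < i) 'X^k.

(* The division is exact, and the divisor is monic. *)
Definition qbinom (n k : nat) : {poly F} :=
  if (k <= n)%N then qfact n %/ (qfact k * qfact (n - k)) else 0.

(* Nonnegative integers j_1, ..., j_m with sum a are all at most `|a|, so that
   they form a function 'I_m -> 'I_(`|a|.+1); there are none when a < 0. *)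
Definition qsupernomial (m : nat) (L : 'I_m -> nat) (a : int) : {poly F} :=
  \sum_(j : {ffun 'I_m -> 'I_(`|a|%N.+1)} | ((\sum_i j i)%N : int) == a)
    let j1 (i : nat) : nat := at1 (fun k => j k : nat) i in
    'X^(\sum_(1 <= i < m.+1) j1 i * (j1 i + \sum_(1 <= l < i) at1 L l))%N *
    \prod_(1 <= l < m.+1) qbinom (at1 L l + j1 l.+1)%N (j1 l).

(* This is the basic specialization (z = 1) of the graded character of
   (C^2)^{* L_1} * ... * (C^(m+1))^{* L_m}; the sum has finite support. *)
Definition basic_specialization (m : nat) (L : 'I_m -> nat) : {poly F} :=
  \sum_(a \in [set: int]) qsupernomial L a.

End QSupernomial.

(* Since X takes values in nat, E(q^X) makes sense for every q in [0, 1], and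
   its values there determine the law of X. *)
Definition has_pgf (R : realType) (d : measure_display) (T : measurableType d)
    (P : probability T R) (X : {RV P >-> nat}) (g : R -> R) : Prop :=
  forall q : R, 0 <= q <= 1 -> ('E_P[fun w => (q ^+ X w)%R] = (g q)%:E)%E.

Definition realRV (R : realType) (d : measure_display) (T : measurableType d)
    (P : probability T R) (X : {RV P >-> nat}) : T -> R :=
  fun w => (X w)%:R.

(* E(X) and Var(X) are extended reals in the library, hence the [fine]. *)
Definition standardize (R : realType) (d : measure_display)
    (T : measurableType d) (P : probability T R) (Y : T -> R) : T -> R :=
  fun w => (Y w - fine 'E_P[Y]) / Num.sqrt (fine 'V_P[Y]).

(* The random variables Y n may live on different probability spaces. *)
Definition cvg_in_distribution (R : realType) (d : nat -> measure_display)
    (T : forall n, measurableType (d n)) (P : forall n, probability (T n) R)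
    (Y : forall n, T n -> R) (mu : probability (measurableTypeR R) R) : Prop :=
  forall x : R, {for x, continuous (fun y : R => fine (mu [set` `]-oo, y]]))} ->
    P n [set w | Y n w <= x] @[n --> \oo] --> mu [set` `]-oo, x]].

Section Asymptotics.
Variables (R : realType) (m : nat).

Definition mean_formula (L : 'I_m -> nat) : R :=
  \sum_(1 <= i < m.+1)
    let S := \sum_(i <= k < m.+1) (at1 L k)%:R / k.+1%:R in
    ((i%:R / 2 + i%:R ^+ 2) * S ^+ 2
     + i%:R * S * (\sum_(1 <= k < i) (at1 L k)%:R)
     + (4 * i%:R * (i%:R + 2) - 6 * i%:R) / (24 * (i%:R + 1)) * (at1 L i)%:R).

Variable a : 'rV[R]_m.

Local Notation "a_[ i ]" := (at1 (a 0) i) (at level 0, format "a_[ i ]").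

(* For i = 0 and i = m + 1 this is 0. *)
Definition bcoef (i : nat) : R :=
  i%:R * \sum_(i <= l < m.+1) a_[l] / l.+1%:R.

Definition fvec : 'rV[R]_m :=
  \row_(i0 < m) let i := i0.+1 in
    (a_[i] + bcoef i.+1 + bcoef i.-1 + 2 * bcoef i
     + 2 * \sum_(1 <= l < i) a_[l]).

Definition vconst : R :=
  12^-1 * \sum_(1 <= i < m.+1)
    (a_[i] + bcoef i.+1 - bcoef i) * bcoef i * (a_[i] + bcoef i.+1).

Definition Sigma : 'M[R]_m :=
  \matrix_(i0 < m, j0 < m) let i := i0.+1 in let j := j0.+1 in
    ((minn i j)%:R * (\sum_(maxn i j <= k < m.+1) a_[k] / k.+1%:R)
     - i%:R * j%:R * (\sum_(maxn i j <= k < m.+1) a_[k] / k.+1%:R ^+ 2)).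

Definition variance_limit : R :=
  4^-1 * (fvec *m Sigma *m fvec^T) 0 0 + vconst.

End Asymptotics.

(* Main.v *)
Require Import Defs.
From mathcomp Require Import all_boot all_order all_algebra.
From mathcomp Require Import complex ring lra zify.
From mathcomp Require Import all_classical all_reals all_analysis.
From mathcomp Require Import measurable_realfun.

(** The variable X_N is a mixture.  In the sum over the levels
    J = (j_1, ..., j_m) that defines the basic specialization, the term of J is a
    power of q times a product of Gaussian binomials, and its value at q = 1 is
    the weight of J, the product of the binomials of L_l + j_(l+1) over j_l.  So
    X_N can be drawn in two stages: levels J with probability proportional to
    their weight, then an exponent of q in the term of J.

    The weights count the configurations of independent sites
    ([box_sum_sites]): there are L_k sites of label k, each carries a number r
    uniform on 0, ..., k, and j_l is the number of sites with r < l <= k.  Hence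
    a linear combination of the levels is a sum of independent bounded variables
    ([site_average_lin]), its mean and variance are explicit, and the central
    limit theorem applies to it with an explicit error.

    Given J, the Gaussian binomials contribute independent variables whose means
    and variances are classical ([poly_moments_qbinom]).  A Gaussian binomial is
    a quotient of q-factorials, and a q-factorial is the generating function of a
    sum of independent uniform variables; this makes the characteristic function
    of the Gaussian binomial close to Gaussian ([qbinom_char_gaussian]).

    The mean of the exponent given J is a quadratic polynomial in J.  Expanded at
    the mean levels ([cond_mean_expand]), it is the sum of a constant, of a linear
    part whose coefficients are close to N f / 2 and whose fluctuations have order
    N^(3/2), and of a quadratic part of order N.  The quadratic part is
    too small to be seen in the fluctuations, but its expectation is the last term
    of the formula for the mean ([average_cond_meanE]).  The variance of the
    exponent given J has order N^3 and concentrates at its value at the mean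
    levels; divided by N^3, it tends to v(a, b).  The variance of the linear part,
    divided by N^3, tends to the quadratic form f Sigma f^t / 4.  Therefore
    Var(X_N) / N^3 tends to the sum of these two limits ([cvg_total_var]), and for
    t of order N^(-3/2) the characteristic function of X_N - E(X_N) at t is
    exp(- t^2 Var(X_N) / 2) up to an error of order N^(-1/2)
    ([char_estimate_scaled]).  The limit of the variance is positive because
    v(a, b) is a combination, with positive coefficients, of cubes of
    nonnegative numbers that are not all zero ([vconstE]).

    Two general facts complete the proof.  The values of a generating function
    near 0 determine the law ([mass_of_pgf]), so that expectations under X_N are
    sums over the coefficients of the polynomial.  Tightness and convergence of
    characteristic functions imply convergence in distribution
    ([cvg_in_distribution_of_char]): the indicator of a half-line is squeezed
    between functions of sin (eta y) with eta small, which are uniform limits of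
    trigonometric polynomials. *)

Set Implicit Arguments.
Unset Strict Implicit.
Unset Printing Implicit Defensive.

Import Order.TTheory GRing.Theory Num.Theory.
Import numFieldNormedType.Exports.
Import Normc.

Local Open Scope classical_set_scope.
Local Open Scope ring_scope.

(** * Taylor bounds for real functions *)

Section Taylor.
Variable R : realType.
Implicit Types (x y : R) (f : R -> R).

(** Applied repeatedly, this gives the bounds below by successive integration. *)
Lemma nonneg_of_derive f (df : R -> R) :
  (forall x, is_derive x 1 f (df x)) -> (forall x, 0 <= x -> 0 <= df x) ->
  0 <= f 0 -> forall x, 0 <= x -> 0 <= f x.
Proof.
move=> fdf df0 f0 x x0.
have [|c /itvP cI E] := @MVT_segment R f df 0 x x0 (fun y _ => fdf y).
  apply: continuous_subspaceT => y; apply: differentiable_continuous.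
  by apply/derivable1_diffP; have [] := fdf y.
have -> : f x = f 0 + df c * (x - 0) by rewrite -E addrC subrK.
by rewrite addr_ge0 // mulr_ge0 ?subr0 // df0 // cI.
Qed.

Lemma sin_le_id x : 0 <= x -> sin x <= x.
Proof.
move=> x0; rewrite -subr_ge0.
apply: (@nonneg_of_derive (fun x => x - sin x) (fun x => 1 - cos x)) x0.
- by move=> y _; rewrite subr_ge0 cos_le1.
- by rewrite sin0 subr0.
Qed.

Lemma cos_ge_quadratic x : 1 - x ^+ 2 / 2 <= cos x.
Proof.
wlog x0 : x / 0 <= x => [H|].
  by case: (leP 0 x) => [/H//|x0]; rewrite -cosN -sqrrN H // oppr_ge0 ltW.
rewrite -subr_ge0.
apply: (@nonneg_of_derive (fun x => cos x - (1 - x ^+ 2 / 2))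
  (fun x => x - sin x)) x0.
- by move=> y; apply: is_derive_eq; rewrite /GRing.scale /=; field.
- by move=> y /sin_le_id; rewrite subr_ge0.
- by rewrite cos0; lra.
Qed.

Lemma sin_ge_cubic x : 0 <= x -> x - x ^+ 3 / 6 <= sin x.
Proof.
move=> x0; rewrite -subr_ge0.
apply: (@nonneg_of_derive (fun x => sin x - (x - x ^+ 3 / 6))
  (fun x => cos x - (1 - x ^+ 2 / 2))) x0.
- by move=> y; apply: is_derive_eq; rewrite /GRing.scale /=; field.
- by move=> y _; rewrite subr_ge0 cos_ge_quadratic.
- by rewrite sin0; lra.
Qed.

Lemma cos_le_quartic x : cos x <= 1 - x ^+ 2 / 2 + x ^+ 4 / 24.
Proof.
wlog x0 : x / 0 <= x => [H|].
  case: (leP 0 x) => [/H//|x0]; rewrite -cosN -sqrrN.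
  by rewrite -(_ : (- x) ^+ 4 = x ^+ 4) ?H ?oppr_ge0 ?ltW //; ring.
rewrite -subr_ge0.
apply: (@nonneg_of_derive (fun x => 1 - x ^+ 2 / 2 + x ^+ 4 / 24 - cos x)
  (fun x => sin x - (x - x ^+ 3 / 6))) x0.
- by move=> y; apply: is_derive_eq; rewrite /GRing.scale /=; field.
- by move=> y /sin_ge_cubic; rewrite subr_ge0.
- by rewrite cos0; lra.
Qed.

Lemma norm_sin_le x : `|sin x| <= `|x|.
Proof.
wlog x0 : x / 0 <= x => [H|].
  by case: (leP 0 x) => [/H//|x0]; rewrite -normrN -sinN -(normrN x) H // oppr_ge0 ltW.
rewrite (ger0_norm x0) ler_norml sin_le_id // andbT.
have := sin_ge_cubic x0; have := sin_geN1 x.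
by case: (leP x 1) => x1; [nra|lra].
Qed.

Lemma norm_sin_sub_id_le x : `|sin x - x| <= `|x| ^+ 3.
Proof.
wlog x0 : x / 0 <= x => [H|].
  case: (leP 0 x) => [/H//|x0].
  have -> : sin x - x = - (sin (- x) - - x) by rewrite sinN; ring.
  by rewrite normrN -(normrN x) H // oppr_ge0 ltW.
rewrite (ger0_norm x0) ler_norml.
have := sin_ge_cubic x0; have := sin_le_id x0; have : 0 <= x ^+ 3 by rewrite exprn_ge0.
lra.
Qed.

Lemma expr4_norm x : x ^+ 4 = `|x| ^+ 4.
Proof. by rewrite (exprM x 2 2) -(real_normK (num_real x)) -exprM. Qed.

Lemma norm_cos_sub_quadratic_le x : `|cos x - (1 - x ^+ 2 / 2)| <= x ^+ 4.
Proof.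
rewrite ler_norml; have := cos_ge_quadratic x; have := cos_le_quartic x.
have : 0 <= x ^+ 4 by rewrite (_ : x ^+ 4 = (x ^+ 2) ^+ 2) ?sqr_ge0 //; ring.
lra.
Qed.

Lemma norm_expRN_sub_linear_le x : 0 <= x -> `|expR (- x) - (1 - x)| <= x ^+ 2.
Proof.
move=> x0; have L := expR_ge1Dx (- x).
have E : expR (- x) <= 1 - x + x ^+ 2 / 2.
  rewrite -subr_ge0.
  apply: (@nonneg_of_derive (fun x => 1 - x + x ^+ 2 / 2 - expR (- x))
    (fun x => expR (- x) - (1 - x))) x0.
  - by move=> y; apply: is_derive_eq; rewrite /GRing.scale /=; field.
  - by move=> y _; have := expR_ge1Dx (- y); lra.
  - by rewrite oppr0 expR0; lra.
by rewrite ler_norml; have := sqr_ge0 x; lra.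
Qed.

Lemma expRN_lipschitz x y : 0 <= x -> 0 <= y ->
  `|expR (- x) - expR (- y)| <= `|x - y|.
Proof.
wlog xy : x y / x <= y => [H x0 y0|].
  by case: (leP x y) => [/H->//|/ltW /H]; rewrite distrC (distrC x); exact.
move=> x0 y0.
rewrite ger0_norm; last by rewrite subr_ge0 ler_expR lerN2.
rewrite ler0_norm ?subr_le0 // opprB.
have -> : expR (- x) - expR (- y) = expR (- x) * (1 - expR (- (y - x))).
  by rewrite mulrBr mulr1 -expRD; congr (_ - expR _); ring.
have := expR_ge1Dx (- (y - x)); have : expR (- x) <= 1 by rewrite expR_le1 oppr_le0.
have := expR_gt0 (- x); have : expR (- (y - x)) <= 1 by rewrite expR_le1; lra.
nra.
Qed.

End Taylor.

(** * Complex exponentials on the unit circle *)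

Section Cis.
Variable R : realType.
Implicit Types (x y : R) (z w : R[i]).
Local Open Scope complex_scope.

Definition cis x : R[i] := cos x +i* sin x.

Lemma cis0 : cis 0 = 1. Proof. by rewrite /cis cos0 sin0. Qed.

Lemma cisD x y : cis (x + y) = cis x * cis y.
Proof. by rewrite /cis cosD sinD /GRing.mul /= [sin x * _ + _]addrC. Qed.

Lemma cis_sum (I : Type) (r : seq I) (P : pred I) (f : I -> R) :
  cis (\sum_(i <- r | P i) f i) = \prod_(i <- r | P i) cis (f i).
Proof. exact: (big_morph cis cisD cis0). Qed.

Lemma cisMn x n : cis (x *+ n) = cis x ^+ n.
Proof. by elim: n => [|n IH]; rewrite ?cis0 // mulrS cisD IH exprS. Qed.

Lemma normc_cis x : normc (cis x) = 1.
Proof. by rewrite /normc /cis cos2Dsin2 sqrtr1. Qed.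

Lemma normc_ge0 z : 0 <= normc z.
Proof. by case: z => a b; rewrite sqrtr_ge0. Qed.

Lemma normc_le_sum z : normc z <= `|complex.Re z| + `|complex.Im z|.
Proof.
case: z => a b /=; rewrite -[leRHS]ger0_norm ?addr_ge0 // -sqrtr_sqr.
apply: ler_wsqrtr; rewrite sqrrD !real_normK ?num_real //.
have := mulr_ge0 (normr_ge0 a) (normr_ge0 b); rewrite -mulr_natr; lra.
Qed.

Lemma norm_Re_le z : `|complex.Re z| <= normc z.
Proof.
by case: z => a b /=; rewrite -sqrtr_sqr ler_wsqrtr // lerDl sqr_ge0.
Qed.

Lemma normc_real x : normc x%:C = `|x|.
Proof. by rewrite /normc /= expr0n /= addr0 sqrtr_sqr. Qed.

Lemma normc_sum (I : Type) (r : seq I) (P : pred I) (F : I -> R[i]) :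
  normc (\sum_(i <- r | P i) F i) <= \sum_(i <- r | P i) normc (F i).
Proof.
elim/big_ind2 : _ => [|z x w y zx wy|//]; first by rewrite normc0.
by apply: (le_trans (le_normcD _ _)); apply: lerD.
Qed.

Lemma sum_complex (I : Type) (r : seq I) (P : pred I) (f g : I -> R) :
  \sum_(i <- r | P i) (f i +i* g i)
  = (\sum_(i <- r | P i) f i) +i* (\sum_(i <- r | P i) g i).
Proof. by elim/big_rec3 : _ => // i x y z _ ->. Qed.

Lemma natC_inv n : (n%:R : R[i])^-1 = (n%:R^-1)%:C.
Proof. by rewrite fmorphV rmorph_nat. Qed.

Lemma normc_distD z w u : normc (z - u) <= normc (z - w) + normc (w - u).
Proof. by rewrite -(subrKA w z); exact: le_normcD. Qed.

(** The products telescope: only one factor is replaced at a time, and the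
    others have modulus at most 1. *)
Lemma normc_prod_dist (I : Type) (r : seq I) (P : pred I) (F G : I -> R[i]) :
  (forall i, P i -> normc (F i) <= 1) -> (forall i, P i -> normc (G i) <= 1) ->
  normc (\prod_(i <- r | P i) F i - \prod_(i <- r | P i) G i)
    <= \sum_(i <- r | P i) normc (F i - G i).
Proof.
move=> F1 G1.
have le1 (H : I -> R[i]) : (forall i, P i -> normc (H i) <= 1) ->
    forall s, normc (\prod_(i <- s | P i) H i) <= 1.
  move=> H1 s; elim/big_ind : _ => [|z w z1 w1|//]; first by rewrite normc1.
  by rewrite normcM; apply: mulr_ile1; rewrite ?normc_ge0.
elim: r => [|i r IH]; first by rewrite !big_nil subrr normc0.
rewrite !big_cons; case: ifP => // Pi.
have -> : F i * \prod_(j <- r | P j) F j - G i * \prod_(j <- r | P j) G j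
  = (F i - G i) * \prod_(j <- r | P j) F j
    + G i * (\prod_(j <- r | P j) F j - \prod_(j <- r | P j) G j) by ring.
apply: le_trans (le_normcD _ _) _; rewrite !normcM lerD //.
  by rewrite ler_piMr ?normc_ge0 ?le1.
by apply: le_trans IH; rewrite ler_piMl ?normc_ge0 ?G1.
Qed.

Lemma cis_lipschitz x y : normc (cis x - cis y) <= 2 * `|x - y|.
Proof.
have -> : cis x - cis y = cis y * (cis (x - y) - 1).
  by rewrite mulrBr mulr1 -cisD (_ : y + (x - y) = x) //; ring.
rewrite normcM normc_cis mul1r; move: (x - y) => u.
apply: le_trans (normc_le_sum _) _; rewrite /= subr0.
have := norm_sin_le u; suff : `|cos u - 1| <= `|u| by lra.
have -> : `|cos u - 1| = 1 - cos u by rewrite distrC ger0_norm // subr_ge0 cos_le1.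
have := cos_ge_quadratic u; rewrite -(real_normK (num_real u)).
have := cos_geN1 u; have := normr_ge0 u.
by case: (leP `|u| 2) => *; [nra|lra].
Qed.

(** Third-order control of one factor of a characteristic function. *)
Lemma cis_taylor x :
  normc (cis x - ((1 - x ^+ 2 / 2) +i* x)) <= `|x| ^+ 3 + x ^+ 4.
Proof.
apply: le_trans (normc_le_sum _) _; rewrite addrC /=.
by rewrite lerD ?norm_sin_sub_id_le ?norm_cos_sub_quadratic_le.
Qed.

End Cis.

(** * Sums of independent uniform steps *)

Section Walk.
Variable V : nmodType.
Variable c : nat -> nat -> V.

(** All values, with multiplicity, of a sum of steps c k r, where k runs over s and
    each r ranges independently over 0, ..., k. *)
Fixpoint outcomes (s : seq nat) : seq V :=
  if s is k :: s' then [seq y + c k r | r <- iota 0 k.+1, y <- outcomes s']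
  else [:: 0].

Definition walk_average (K : fieldType) (s : seq nat) (h : V -> K) : K :=
  (\prod_(k <- s) k.+1)%N%:R^-1 * \sum_(y <- outcomes s) h y.

Lemma walk_average_nil (K : fieldType) (h : V -> K) : walk_average [::] h = h 0.
Proof. by rewrite /walk_average big_nil big_seq1 invr1 mul1r. Qed.

Lemma walk_average_cons (K : fieldType) k s (h : V -> K) :
  walk_average (k :: s) h
  = k.+1%:R^-1 * \sum_(r < k.+1) walk_average s (fun y => h (y + c k r)).
Proof.
rewrite /walk_average big_cons natrM invfM -mulrA; congr (_ * _).
rewrite -mulr_sumr; congr (_ * _).
rewrite -[outcomes (k :: s)]/[seq y + c k r | r <- iota 0 k.+1, y <- outcomes s].
by rewrite big_allpairs_dep -(big_mkord xpredT
  (fun r => \sum_(y <- outcomes s) h (y + c k r))) /index_iota subn0.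
Qed.

Lemma eq_walk_average (K : fieldType) s (h h' : V -> K) :
  h =1 h' -> walk_average s h = walk_average s h'.
Proof. by move=> E; congr (_ * _); apply: eq_bigr => y _; rewrite E. Qed.

Lemma walk_averageD (K : fieldType) s (f g : V -> K) :
  walk_average s (fun y => f y + g y) = walk_average s f + walk_average s g.
Proof. by rewrite /walk_average big_split mulrDr. Qed.

Lemma walk_averageZ (K : fieldType) s a (f : V -> K) :
  walk_average s (fun y => a * f y) = a * walk_average s f.
Proof. by rewrite /walk_average -mulr_sumr mulrCA. Qed.

Lemma walk_average_cst (K : numFieldType) s (a : K) :
  walk_average s (fun=> a) = a.
Proof.
elim: s => [|k s IH]; first by rewrite walk_average_nil.
rewrite walk_average_cons; under eq_bigr do rewrite IH.
by rewrite sumr_const card_ord -[a in LHS]mul1r -mulrnAl mulKf ?pnatr_eq0.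
Qed.

End Walk.

(** Real displacements: a walk is a sum of independent variables, the one
    contributed by a site of label k being uniform on c k 0, ..., c k k. *)
Section WalkMoments.
Variable R : realType.
Variable c : nat -> nat -> R.

Definition step_mean k : R := k.+1%:R^-1 * \sum_(r < k.+1) c k r.
Definition step_dev k r : R := c k r - step_mean k.
Definition step_var k : R := k.+1%:R^-1 * \sum_(r < k.+1) step_dev k r ^+ 2.
Definition walk_mean (s : seq nat) : R := \sum_(k <- s) step_mean k.

Lemma sum_step_dev k : \sum_(r < k.+1) step_dev k r = 0.
Proof.
by rewrite sumrB sumr_const card_ord /step_mean -[X in _ - X]mulr_natl mulVKf ?subrr.
Qed.

Lemma step_var_ge0 k : 0 <= step_var k.
Proof. by rewrite mulr_ge0 ?invr_ge0 ?sumr_ge0 // => r _; rewrite sqr_ge0. Qed.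

(** Adding one site convolves the law of the centered walk with the law of one
    centered step; all moment computations are inductions on this. *)
Lemma walk_average_centered_cons (K : fieldType) k s (h : R -> K) :
  walk_average c (k :: s) (fun y => h (y - walk_mean (k :: s)))
  = k.+1%:R^-1 * \sum_(r < k.+1)
      walk_average c s (fun y => h (y - walk_mean s + step_dev k r)).
Proof.
rewrite walk_average_cons; congr (_ * _); apply: eq_bigr => r _.
apply: eq_walk_average => y; congr h.
by rewrite /walk_mean big_cons /step_dev; ring.
Qed.

Lemma walk_centered_mean s : walk_average c s (fun y => y - walk_mean s) = 0.
Proof.
elim: s => [|k s IH].
  by rewrite walk_average_nil /walk_mean big_nil subrr.
rewrite (walk_average_centered_cons k s id).
under eq_bigr do rewrite walk_averageD IH add0r walk_average_cst.
by rewrite sum_step_dev mulr0.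
Qed.

Lemma walk_variance s :
  walk_average c s (fun y => (y - walk_mean s) ^+ 2) = \sum_(k <- s) step_var k.
Proof.
elim: s => [|k s IH].
  by rewrite walk_average_nil /walk_mean !big_nil subrr expr0n.
rewrite (walk_average_centered_cons k s (fun y => y ^+ 2)) big_cons.
have E r : walk_average c s (fun y => (y - walk_mean s + step_dev k r) ^+ 2)
    = \sum_(j <- s) step_var j + step_dev k r ^+ 2.
  rewrite (@eq_walk_average _ c _ s _ (fun y =>
    (2 * step_dev k r) * (y - walk_mean s)
    + ((y - walk_mean s) ^+ 2 + step_dev k r ^+ 2))); last by move=> y; ring.
  by rewrite !walk_averageD walk_averageZ walk_centered_mean IH walk_average_cst; ring.
rewrite (eq_bigr _ (fun (r : 'I_k.+1) _ => E r)).
rewrite big_split /= mulrDr addrC; congr (_ + _).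
by rewrite sumr_const card_ord -[X in _ * X]mulr_natl mulKf ?pnatr_eq0.
Qed.

Variables (A : R) (s : seq nat).
Hypothesis dev_le : forall k r, k \in s -> (r <= k)%N -> `|step_dev k r| <= A.

Let step_var_le k : k \in s -> step_var k <= A ^+ 2.
Proof.
move=> ks; rewrite /step_var mulrC ler_pdivrMr ?ltr0n //.
rewrite mulr_natr -[k.+1 in leRHS]card_ord -sumr_const ler_sum // => r _.
have := dev_le ks (ltn_ord r : (r <= k)%N); rewrite -(real_normK (num_real _)).
by have := normr_ge0 (step_dev k r); nra.
Qed.

(** Expanding the fourth power, the terms with a single factor of a centered step
    vanish, so that the fourth moment grows like the square of the number of
    steps. *)
Lemma walk_fourth_moment :
  walk_average c s (fun y => (y - walk_mean s) ^+ 4)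
    <= 3 * (size s)%:R ^+ 2 * A ^+ 4.
Proof.
have [->|] := eqVneq s [::].
  rewrite walk_average_nil /walk_mean big_nil subrr !expr0n /=.
  by rewrite mulr0 mul0r.
case: s dev_le step_var_le => // k0 s0 dl sl _.
have A0 : 0 <= A by apply: le_trans (dl k0 0%N _ _); rewrite ?inE ?eqxx.
move: dl sl; elim: (k0 :: s0) => {k0 s0} [|k s' IH] dl sl.
  by rewrite walk_average_nil /walk_mean big_nil subrr !expr0n /= mulr0 mul0r.
have {}IH : walk_average c s' (fun y => (y - walk_mean s') ^+ 4)
    <= 3 * (size s')%:R ^+ 2 * A ^+ 4.
  by apply: IH => [j r js|j js]; [apply: dl|apply: sl]; rewrite inE js orbT.
rewrite (walk_average_centered_cons k s' (fun y => y ^+ 4)).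
set m4 := walk_average c s' (fun y => (y - walk_mean s') ^+ 4).
set m3 := walk_average c s' (fun y => (y - walk_mean s') ^+ 3).
set m2 := \sum_(j <- s') step_var j.
have E r : walk_average c s' (fun y => (y - walk_mean s' + step_dev k r) ^+ 4)
    = 4 * m3 * step_dev k r
      + (m4 + (6 * m2 * step_dev k r ^+ 2 + step_dev k r ^+ 4)).
  rewrite (@eq_walk_average _ c _ s' _ (fun y =>
    (4 * step_dev k r) * (y - walk_mean s') ^+ 3
    + ((y - walk_mean s') ^+ 4 + ((6 * step_dev k r ^+ 2) * (y - walk_mean s') ^+ 2
    + ((4 * step_dev k r ^+ 3) * (y - walk_mean s') + step_dev k r ^+ 4)))));
    last by move=> y; ring.
  rewrite !walk_averageD !walk_averageZ walk_centered_mean walk_variance.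
  by rewrite walk_average_cst -/m2 -/m3 -/m4; ring.
have m2_le : m2 <= (size s')%:R * A ^+ 2.
  rewrite /m2 mulr_natl -sum1_size -sumrMnr big_seq [leRHS]big_seq.
  by apply: ler_sum => j js; rewrite mulr1n sl // inE js orbT.
have m2_ge0 : 0 <= m2 by apply: sumr_ge0 => j _; exact: step_var_ge0.
rewrite (eq_bigr _ (fun (r : 'I_k.+1) _ => E r)).
rewrite -/m4 in IH.
clearbody m2 m3 m4 => {E}.
rewrite 3!big_split /= -!mulr_sumr sum_step_dev mulr0 add0r.
have cstK (x : R) : k.+1%:R^-1 * (x *+ k.+1) = x.
  by rewrite -[x *+ _]mulr_natl mulKf ?pnatr_eq0.
rewrite sumr_const card_ord 2!mulrDr cstK [_^-1 * (_ * _)]mulrCA -/(step_var k).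
have vk_le : step_var k <= A ^+ 2 by rewrite sl // inE eqxx.
have d4_le : k.+1%:R^-1 * (\sum_(r < k.+1) step_dev k r ^+ 4) <= A ^+ 4.
  rewrite mulrC ler_pdivrMr ?ltr0n // mulr_natr -[k.+1 in leRHS]card_ord.
  rewrite -sumr_const ler_sum // => r _.
  have : `|step_dev k r| <= A by apply: dl; rewrite ?inE ?eqxx // -ltnS.
  by rewrite (expr4_norm (step_dev k r)) => d_le; rewrite lerXn2r ?nnegrE.
have mv : m2 * step_var k <= (size s')%:R * A ^+ 2 * A ^+ 2.
  by rewrite ler_pM // step_var_ge0.
rewrite [size _]/= -[(size s').+1%:R]natr1.
have -> : 3 * ((size s')%:R + 1) ^+ 2 * A ^+ 4
  = 3 * (size s')%:R ^+ 2 * A ^+ 4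
    + (6 * ((size s')%:R * A ^+ 2 * A ^+ 2) + 3 * A ^+ 4) by ring.
have A4 : 0 <= A ^+ 4 by rewrite exprn_ge0.
apply: lerD IH (lerD _ _); first by rewrite -mulrA; move: mv; clear; lra.
by apply: le_trans d4_le _; lra.
Qed.

Local Open Scope complex_scope.

Definition step_char (u : R) k : R[i] :=
  k.+1%:R^-1 * \sum_(r < k.+1) cis (u * step_dev k r).

Lemma walk_char (s' : seq nat) u :
  walk_average c s' (fun y => cis (u * (y - walk_mean s')))
  = \prod_(k <- s') step_char u k.
Proof.
elim: s' => [|k s' IH].
  by rewrite walk_average_nil /walk_mean !big_nil subrr mulr0 cis0.
rewrite (walk_average_centered_cons k s' (fun y => cis (u * y))) big_cons -IH.
rewrite /step_char -mulrA; congr (_ * _); rewrite mulr_suml.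
apply: eq_bigr => r _; rewrite -walk_averageZ; apply: eq_walk_average => y.
by rewrite -cisD; congr cis; ring.
Qed.

Lemma normc_average_le (n : nat) (F : 'I_n.+1 -> R[i]) (e : R) :
  (forall r, normc (F r) <= e) -> normc (n.+1%:R^-1 * \sum_r F r) <= e.
Proof.
move=> Fe; rewrite natC_inv normcM normc_real ger0_norm ?invr_ge0 //.
rewrite mulrC ler_pdivrMr ?ltr0n //; apply: le_trans (normc_sum _ _ _) _.
by rewrite mulr_natr -[n.+1 in leRHS]card_ord -sumr_const ler_sum.
Qed.

(** Lindeberg's estimate for one step: the first two moments of a centered step
    agree with those of the centered Gaussian of the same variance. *)
Lemma step_char_gaussian u k : k \in s ->
  normc (step_char u k - (expR (- (u ^+ 2 * step_var k / 2)))%:C)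
    <= (`|u| * A) ^+ 3 + 2 * (`|u| * A) ^+ 4.
Proof.
move=> ks.
pose Q : R[i] := (1 - u ^+ 2 * step_var k / 2)%:C.
have A0 : 0 <= A by apply: le_trans (dev_le ks (leq0n k)).
have x_le (r : 'I_k.+1) : `|u * step_dev k r| <= `|u| * A.
  by rewrite normrM ler_wpM2l // dev_le // -ltnS.
apply: le_trans (normc_distD _ Q _) _.
rewrite (_ : _ + 2 * _ = ((`|u| * A) ^+ 3 + (`|u| * A) ^+ 4) + (`|u| * A) ^+ 4);
  last by ring.
apply: lerD.
  have -> : step_char u k - Q = k.+1%:R^-1 * \sum_(r < k.+1)
      (cis (u * step_dev k r)
       - ((1 - (u * step_dev k r) ^+ 2 / 2) +i* (u * step_dev k r))).
    rewrite sumrB mulrBr; congr (_ - _); rewrite /Q.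
    have -> : \sum_(r < k.+1) ((1 - (u * step_dev k r) ^+ 2 / 2) +i* (u * step_dev k r))
      = (k.+1%:R - u ^+ 2 / 2 * \sum_(r < k.+1) step_dev k r ^+ 2)
        +i* (u * \sum_(r < k.+1) step_dev k r).
      rewrite sum_complex sumrB sumr_const card_ord !mulr_sumr.
      by congr ((_ - _) +i* _); apply: eq_bigr => r _; ring.
    rewrite sum_step_dev mulr0 natC_inv -[_ +i* 0]/(_%:C) -rmorphM.
    congr (_ %:C); rewrite mulrBr mulVf ?pnatr_eq0 // /step_var; ring.
  apply: normc_average_le => r; apply: le_trans (cis_taylor _) _.
  by rewrite expr4_norm lerD // lerXn2r ?nnegrE // mulr_ge0.
rewrite /Q -rmorphB normc_real distrC.
apply: le_trans (norm_expRN_sub_linear_le _) _.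
  by apply: divr_ge0 => //; apply: mulr_ge0; [exact: sqr_ge0|exact: step_var_ge0].
have := step_var_le ks; have := step_var_ge0 k.
rewrite (_ : (`|u| * A) ^+ 4 = (u ^+ 2 * A ^+ 2) ^+ 2); last first.
  by rewrite -(real_normK (num_real u)); ring.
move=> v0 vA; apply: lerXn2r; rewrite ?nnegrE.
- by apply: divr_ge0 => //; apply: mulr_ge0 => //; exact: sqr_ge0.
- by apply: mulr_ge0; exact: sqr_ge0.
rewrite -mulrA; apply: ler_wpM2l; first exact: sqr_ge0.
by have := sqr_ge0 A; lra.
Qed.

(** By independence the characteristic function is a product, and so is the
    Gaussian one; the factors are compared one by one. *)
Lemma walk_char_gaussian u :
  normc (walk_average c s (fun y => cis (u * (y - walk_mean s)))
         - (expR (- (u ^+ 2 * (\sum_(k <- s) step_var k) / 2)))%:C)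
    <= (size s)%:R * ((`|u| * A) ^+ 3 + 2 * (`|u| * A) ^+ 4).
Proof.
rewrite walk_char.
have -> : (expR (- (u ^+ 2 * (\sum_(k <- s) step_var k) / 2)))%:C
    = \prod_(k <- s) (expR (- (u ^+ 2 * step_var k / 2)))%:C.
  rewrite mulr_sumr mulr_suml -sumrN expR_sum.
  exact: (rmorph_prod (real_complex R)).
apply: (le_trans (@normc_prod_dist R _ s xpredT (step_char u) _ _ _)).
- move=> k _; apply: normc_average_le => r; by rewrite normc_cis.
- move=> k _; rewrite normc_real ger0_norm ?expR_ge0 // expR_le1 oppr_le0.
  by apply: divr_ge0 => //; apply: mulr_ge0; [exact: sqr_ge0|exact: step_var_ge0].
rewrite mulr_natl -sum1_size -sumrMnr big_seq [leRHS]big_seq.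
by apply: ler_sum => k ks; rewrite mulr1n step_char_gaussian.
Qed.

End WalkMoments.

(** * Gaussian binomial coefficients *)

Section QBinomial.
Variable F : fieldType.

Definition qint (n : nat) : {poly F} := \sum_(0 <= k < n) 'X^k.

Lemma qfact0 : qfact F 0 = 1. Proof. by rewrite /qfact big_geq. Qed.

Lemma qfactS n : qfact F n.+1 = qfact F n * qint n.+1.
Proof. by rewrite /qfact big_nat_recr. Qed.

Lemma qintD m n : qint (m + n) = qint m + 'X^m * qint n.
Proof.
rewrite /qint !big_mkord big_split_ord /= mulr_sumr; congr (_ + _).
by apply: eq_bigr => i _; rewrite exprD.
Qed.

Lemma qint_monic n : qint n.+1 \is monic.
Proof.
have -> : qint n.+1 = \poly_(i < n.+1) 1.
  by rewrite poly_def /qint big_mkord; apply: eq_bigr => i _; rewrite scale1r.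
by rewrite monicE lead_coef_poly ?oner_eq0.
Qed.

Lemma qfact_neq0 n : qfact F n != 0.
Proof.
elim: n => [|n IH]; first by rewrite qfact0 oner_eq0.
by rewrite qfactS mulf_neq0 // monic_neq0 // qint_monic.
Qed.

(** Division is exact in the definition of the Gaussian binomial, so that any
    polynomial that solves the multiplication is the quotient. *)
Lemma qbinom_unique n k (g : {poly F}) : (k <= n)%N ->
  qfact F n = g * (qfact F k * qfact F (n - k)) -> qbinom F n k = g.
Proof.
by move=> kn E; rewrite /qbinom kn E mulpK // mulf_neq0 // qfact_neq0.
Qed.

Lemma qbinom0 n : qbinom F n 0 = 1.
Proof. by apply: qbinom_unique => //; rewrite qfact0 subn0 !mul1r. Qed.

Lemma qbinomn n : qbinom F n n = 1.
Proof. by apply: qbinom_unique => //; rewrite subnn qfact0 mulr1 mul1r. Qed.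

(** Exactness of the division and the Pascal recurrence are proved together: the
    recurrence at n produces the quotient at n + 1, which gives the recurrence at
    n + 1. *)
Lemma qfact_qbinom_pascal n : forall k, (k <= n)%N ->
  qfact F n = qbinom F n k * (qfact F k * qfact F (n - k)) /\
  ((k < n)%N -> qbinom F n.+1 k.+1 = qbinom F n k + 'X^(k.+1) * qbinom F n k.+1).
Proof.
elim: n => [|n IH] k.
  by rewrite leqn0 => /eqP->; rewrite qbinom0 qfact0 !mul1r.
have pascal j : (j < n)%N ->
    qfact F n.+1 = (qbinom F n j + 'X^(j.+1) * qbinom F n j.+1)
                   * (qfact F j.+1 * qfact F (n.+1 - j.+1)).
  move=> jn; have [E1 _] := IH j (ltnW jn); have [E2 _] := IH j.+1 jn.
  rewrite qfactS -[X in qint X](subnKC (ltnW jn : (j.+1 <= n.+1)%N)) qintD subSS.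
  rewrite mulrDr {1}E1 {1}E2.
  have -> : (n - j)%N = (n - j.+1).+1 by lia.
  rewrite !qfactS; ring.
have full j : (j <= n.+1)%N ->
    qfact F n.+1 = qbinom F n.+1 j * (qfact F j * qfact F (n.+1 - j)).
  case: j => [|j] jn; first by rewrite qbinom0 qfact0 subn0 !mul1r.
  move: jn; rewrite ltnS leq_eqVlt => /orP[/eqP->|jn].
    by rewrite qbinomn subnn qfact0 mulr1 mul1r.
  by rewrite (qbinom_unique _ (pascal j jn)); [exact: pascal|exact: ltnW].
move=> kn; split; first exact: full.
move=> {}kn; apply: qbinom_unique; first exact: ltnW.
have E1 := full k (ltnW kn); have E2 := full k.+1 kn.
rewrite qfactS -[X in qint X](subnKC (ltnW kn : (k.+1 <= n.+2)%N)) qintD subSS.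
rewrite mulrDr {1}E1 {1}E2.
have -> : (n.+1 - k)%N = (n.+1 - k.+1).+1 by lia.
rewrite [qfact F k.+1]qfactS [qfact F _.+1 in RHS]qfactS.
rewrite [qfact F (n.+1 - k.+1).+1]qfactS; ring.
Qed.

Lemma qfact_qbinom n k : (k <= n)%N ->
  qfact F n = qbinom F n k * (qfact F k * qfact F (n - k)).
Proof. by case/qfact_qbinom_pascal. Qed.

Lemma qbinom_pascal n k : (k < n)%N ->
  qbinom F n.+1 k.+1 = qbinom F n k + 'X^(k.+1) * qbinom F n k.+1.
Proof. by move=> kn; apply: (qfact_qbinom_pascal (ltnW kn)).2. Qed.

Lemma qbinom_small n k : (n < k)%N -> qbinom F n k = 0.
Proof. by rewrite ltnNge /qbinom => /negbTE ->. Qed.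

End QBinomial.

(** * Mean and variance read from a generating polynomial *)

Section PolyMoments.
Variable R : realType.
Implicit Types (P Q : {poly R}) (w mu v : R).

(** P, read as a generating function, has total mass w, and the normalized
    distribution has mean mu and variance v. *)
Definition poly_moments P w mu v : Prop :=
  [/\ P.[1] = w, P^`().[1] = w * mu &
      P^`().[1] + P^`()^`().[1] = w * (v + mu ^+ 2)].

(** A product of generating functions is the generating function of a sum of
    independent variables. *)
Lemma poly_momentsM P Q w mu v w' mu' v' :
  poly_moments P w mu v -> poly_moments Q w' mu' v' ->
  poly_moments (P * Q) (w * w') (mu + mu') (v + v').
Proof.
move=> [P0 P1 P2] [Q0 Q1 Q2].
have P2' : P^`()^`().[1] = w * (v + mu ^+ 2) - w * mu by rewrite -P2 P1; ring.
have Q2' : Q^`()^`().[1] = w' * (v' + mu' ^+ 2) - w' * mu' by rewrite -Q2 Q1; ring.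
by split; rewrite !(derivM, derivD, hornerD, hornerM) ?P2' ?Q2' ?P1 ?Q1 ?P0 ?Q0; ring.
Qed.

(** The distribution of an independent summand has the difference of the moments;
    this reads the moments of the Gaussian binomial off those of q-factorials. *)
Lemma poly_moments_div P Q w mu v w' mu' v' : w' != 0 ->
  poly_moments (P * Q) (w * w') (mu + mu') (v + v') ->
  poly_moments Q w' mu' v' -> poly_moments P w mu v.
Proof.
move=> w'0 [E0 E1 E2] [Q0 Q1 Q2].
have Q2' : Q^`()^`().[1] = w' * (v' + mu' ^+ 2) - w' * mu' by rewrite -Q2 Q1; ring.
move: E0 E1 E2; rewrite !(derivM, derivD, hornerD, hornerM) Q2' Q1 Q0 => E0 E1 E2.
have P0 : P.[1] = w by apply: (mulIf w'0).
have P1 : P^`().[1] = w * mu.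
  by apply: (mulIf w'0); move: E1; rewrite P0; lra.
split => //; apply: (mulIf w'0).
by move: E2; rewrite P0 P1 => E2; lra.
Qed.

Lemma poly_moments_Xn n : poly_moments 'X^n 1 n%:R 0.
Proof.
have D1 : ('X^n : {poly R})^`().[1] = n%:R by rewrite derivXn hornerMn hornerXn expr1n.
have D2 : ('X^n : {poly R})^`()^`().[1] = (n.-1 * n)%:R.
  by rewrite derivXn derivMn derivXn !hornerMn hornerXn expr1n -mulrnA.
split; first by rewrite hornerXn expr1n.
  by rewrite D1 mul1r.
rewrite D1 D2 mul1r add0r -natrD -natrX; congr _%:R.
by case: n {D1 D2} => // n; rewrite /=; nia.
Qed.

Lemma poly_moments_qint n : poly_moments (qint R n.+1) n.+1%:R (n%:R / 2)
  ((n.+1%:R ^+ 2 - 1) / 12).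
Proof.
elim: n => [|n [E0 E1 E2]].
  rewrite /qint big_nat1 expr0; split; rewrite ?hornerC ?derivC ?hornerC ?deriv0 ?horner0; lra.
have [X0 X1 X2] := poly_moments_Xn n.+1.
have -> : qint R n.+2 = qint R n.+1 + 'X^(n.+1) by rewrite /qint big_nat_recr.
split; rewrite ?derivD ?hornerD.
- by rewrite E0 X0 natr1.
- by rewrite E1 X1 -!natr1; field.
- by rewrite addrACA E2 X2 -!natr1; field.
Qed.

Definition qfact_mean (n : nat) : R := n%:R * (n%:R - 1) / 4.
Definition qfact_var (n : nat) : R :=
  (2 * n%:R ^+ 3 + 3 * n%:R ^+ 2 - 5 * n%:R) / 72.

Lemma poly_moments_qfact n :
  poly_moments (qfact R n) n`!%:R (qfact_mean n) (qfact_var n).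
Proof.
elim: n => [|n IH].
  rewrite qfact0 /qfact_mean /qfact_var.
  by split; rewrite ?hornerC ?derivC ?hornerC ?deriv0 ?horner0 ?fact0; lra.
rewrite qfactS factS mulnC natrM.
have -> : qfact_mean n.+1 = qfact_mean n + n%:R / 2.
  by rewrite /qfact_mean -natr1; field.
have -> : qfact_var n.+1 = qfact_var n + (n.+1%:R ^+ 2 - 1) / 12.
  by rewrite /qfact_var -natr1; field.
exact: poly_momentsM IH (poly_moments_qint n).
Qed.

Definition qbinom_mean (n k : nat) : R := k%:R * (n%:R - k%:R) / 2.
Definition qbinom_var (n k : nat) : R :=
  k%:R * (n%:R - k%:R) * (n%:R + 1) / 12.

Lemma poly_moments_qbinom n k : (k <= n)%N ->
  poly_moments (qbinom R n k) 'C(n, k)%:R (qbinom_mean n k) (qbinom_var n k).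
Proof.
move=> kn.
have M := poly_momentsM (poly_moments_qfact k) (poly_moments_qfact (n - k)).
apply: (poly_moments_div _ _ M); first by rewrite mulf_neq0 // pnatr_eq0 -lt0n fact_gt0.
rewrite -(qfact_qbinom _ kn) -!natrM bin_fact //.
have -> : qbinom_mean n k + (qfact_mean k + qfact_mean (n - k)) = qfact_mean n.
  by rewrite /qbinom_mean /qfact_mean natrB //; field.
have -> : qbinom_var n k + (qfact_var k + qfact_var (n - k)) = qfact_var n.
  by rewrite /qbinom_var /qfact_var natrB //; field.
exact: poly_moments_qfact.
Qed.

(** Nonnegativity is what bounds the characteristic function of the Gaussian
    binomial by 1; it comes from the Pascal recurrence. *)
Lemma qbinom_coef_ge0 n k i : 0 <= (qbinom R n k)`_i.
Proof.
elim: n k i => [|n IH] [|k] i; rewrite ?qbinom0 ?coef1 ?ler0n //.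
  by rewrite qbinom_small // coef0.
have [kn|kn] := leqP k.+1 n.
  by rewrite qbinom_pascal // coefD coefXnM addr_ge0 //; case: ifP.
move: kn; rewrite ltnS leq_eqVlt => /orP[/eqP->|kn].
  by rewrite qbinomn coef1 ler0n.
by rewrite qbinom_small // coef0.
Qed.

End PolyMoments.

(** * Characteristic functions of Gaussian binomials *)

Section QBinomialChar.
Variable R : realType.
Implicit Types (P Q : {poly R}) (t : R).
Local Open Scope complex_scope.

Definition char_eval t P : R[i] := (map_poly (real_complex R) P).[cis t].

Lemma char_evalM t P Q : char_eval t (P * Q) = char_eval t P * char_eval t Q.
Proof. by rewrite /char_eval rmorphM hornerM. Qed.

Lemma char_eval_sum t (I : Type) (r : seq I) (A : pred I) (F : I -> {poly R}) :
  char_eval t (\sum_(i <- r | A i) F i) = \sum_(i <- r | A i) char_eval t (F i).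
Proof. by rewrite /char_eval rmorph_sum horner_sum. Qed.

Lemma char_eval_prod t (I : Type) (r : seq I) (A : pred I) (F : I -> {poly R}) :
  char_eval t (\prod_(i <- r | A i) F i) = \prod_(i <- r | A i) char_eval t (F i).
Proof. by rewrite /char_eval rmorph_prod horner_prod. Qed.

Lemma char_evalXn t n : char_eval t 'X^n = cis (t * n%:R).
Proof. by rewrite /char_eval map_polyXn hornerXn -cisMn mulr_natr. Qed.

Lemma char_eval1 t : char_eval t 1 = 1.
Proof. by rewrite -(expr0 'X) char_evalXn mulr0 cis0. Qed.

Lemma char_evalE t P :
  char_eval t P = \sum_(i < size P) (P`_i)%:C * cis (t * i%:R).
Proof.
rewrite /char_eval horner_coef size_map_poly; apply: eq_bigr => i _.
by rewrite coef_map -cisMn mulr_natr.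
Qed.

Lemma normc_char_eval_le t P : (forall i, 0 <= P`_i) ->
  normc (char_eval t P) <= P.[1].
Proof.
move=> P0; rewrite char_evalE; apply: le_trans (normc_sum _ _ _) _.
rewrite horner_coef ler_sum // => i _.
by rewrite normcM normc_cis normc_real ger0_norm // expr1n mulr1.
Qed.

(** Up to centering and normalization, [n]! is the generating function of a
    walk with one step uniform on 0, ..., k for each k < n. *)
Definition qfact_char t n : R[i] :=
  cis (- (t * qfact_mean R n)) * char_eval t (qfact R n) / n`!%:R.

Let c (k r : nat) : R := r%:R.

Let step_mean_c k : step_mean c k = k%:R / 2.
Proof.
have [_ E _] := poly_moments_qint R k.
rewrite /step_mean mulrC -(mulKf (_ : k.+1%:R != 0) (k%:R / 2)) ?pnatr_eq0 //.
rewrite -E mulrC; congr (_ * _).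
rewrite /qint big_mkord raddf_sum horner_sum; apply: eq_bigr => i _ /=.
by rewrite derivXn hornerMn hornerXn expr1n.
Qed.

Let step_var_c k : step_var c k = (k.+1%:R ^+ 2 - 1) / 12.
Proof.
have [_ E1 E2] := poly_moments_qint R k.
have S1 : \sum_(r < k.+1) r%:R = k.+1%:R * (k%:R / 2) :> R.
  rewrite -E1 /qint big_mkord raddf_sum horner_sum; apply: eq_bigr => i _ /=.
  by rewrite derivXn hornerMn hornerXn expr1n.
have S2 : \sum_(r < k.+1) r%:R ^+ 2
    = k.+1%:R * ((k.+1%:R ^+ 2 - 1) / 12 + (k%:R / 2) ^+ 2) :> R.
  rewrite -E2 /qint big_mkord !raddf_sum !horner_sum -big_split.
  apply: eq_bigr => i _ /=; have [_ X1 X2] := poly_moments_Xn R i.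
  by rewrite X2 mul1r add0r.
rewrite /step_var /step_dev step_mean_c.
rewrite (eq_bigr (fun r : 'I_k.+1 =>
  r%:R ^+ 2 - k%:R * r%:R + (k%:R / 2) ^+ 2)) => [|r _]; last by rewrite /c; field.
rewrite big_split sumrB -mulr_sumr S1 S2 sumr_const card_ord /= -mulr_natr.
by rewrite -natr1; field; rewrite natr1 pnatr_eq0.
Qed.

Let sum_step_var_c n : \sum_(k <- iota 0 n) step_var c k = qfact_var R n.
Proof.
elim: n => [|n IH]; first by rewrite big_nil /qfact_var !expr0n /= !mulr0 !addr0 subr0 mul0r.
rewrite -addn1 iotaD big_cat /= big_seq1 IH.
by rewrite step_var_c /qfact_var natrD -natr1; field.
Qed.

Let walk_c t n : walk_average c (iota 0 n) (fun y => cis (t * (y - walk_mean c (iota 0 n))))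
  = qfact_char t n.
Proof.
rewrite walk_char /qfact_char; elim: n => [|n IH].
  by rewrite big_nil qfact0 char_eval1 /qfact_mean !mul0r mulr0 oppr0 cis0 !mul1r invr1.
rewrite -addn1 iotaD big_cat /= big_seq1 IH addn1 qfactS char_evalM factS natrM invfM.
rewrite /step_char /step_dev step_mean_c.
have -> : qfact_mean R n.+1 = qfact_mean R n + n%:R / 2.
  by rewrite /qfact_mean -natr1; field.
rewrite mulrDr opprD cisD.
have -> : \sum_(r < n.+1) cis (t * (c n r - n%:R / 2))
    = cis (- (t * (n%:R / 2))) * char_eval t (qint R n.+1).
  rewrite /qint big_mkord char_eval_sum mulr_sumr; apply: eq_bigr => r _.
  by rewrite char_evalXn -cisD; congr cis; rewrite /c; ring.
by ring.
Qed.

Lemma normc_qfact_char_le t n : normc (qfact_char t n) <= 1.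
Proof.
rewrite -walk_c walk_char.
elim: (iota 0 n) => [|k s IH]; first by rewrite big_nil normc1.
rewrite big_cons normcM mulr_ile1 ?normc_ge0 //.
by apply: normc_average_le => r; rewrite normc_cis.
Qed.

Lemma qfact_char_gaussian t n :
  normc (qfact_char t n - (expR (- (t ^+ 2 * qfact_var R n / 2)))%:C)
    <= n%:R * ((`|t| * n%:R) ^+ 3 + 2 * (`|t| * n%:R) ^+ 4).
Proof.
rewrite -walk_c -sum_step_var_c.
have := @walk_char_gaussian R c n%:R (iota 0 n) _ t; rewrite size_iota; apply.
move=> k r; rewrite mem_iota add0n => /andP[_ kn] rk.
rewrite /step_dev step_mean_c /c ler_norml.
have : (r%:R <= k%:R :> R) by rewrite ler_nat.
have : (k%:R <= n%:R :> R) by rewrite ler_nat ltnW.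
have : (0 <= r%:R :> R) by [].
lra.
Qed.

Lemma qfact_var_le n : 0 <= qfact_var R n <= n%:R ^+ 3.
Proof.
rewrite /qfact_var; case: n => [|n]; first by rewrite !expr0n /=; lra.
rewrite -[n.+1%:R]natr1; have : 0 <= n%:R :> R by []; move: n%:R => x x0.
have := mulr_ge0 x0 x0; have := mulr_ge0 x0 (mulr_ge0 x0 x0).
by rewrite !exprS expr0 => *; apply/andP; split; lra.
Qed.

Definition qbinom_char t n k : R[i] :=
  cis (- (t * qbinom_mean R n k)) * char_eval t (qbinom R n k) / 'C(n, k)%:R.

Lemma normc_qbinom_char_le t n k : (k <= n)%N -> normc (qbinom_char t n k) <= 1.
Proof.
move=> kn; rewrite /qbinom_char natC_inv !normcM normc_cis mul1r normc_real.
have C0 : 0 < 'C(n, k)%:R :> R by rewrite ltr0n bin_gt0.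
rewrite ger0_norm ?invr_ge0 // ler_pdivrMr // mul1r.
have [<- _ _] := poly_moments_qbinom R kn.
by apply: normc_char_eval_le => i; exact: qbinom_coef_ge0.
Qed.

(** The Gaussian binomial is a quotient of q-factorials, each of which is close
    to its Gaussian approximation; as long as t^2 n^3 is bounded the Gaussian
    denominators are bounded below and the quotient inherits the estimate. *)
Lemma qbinom_char_gaussian t n k (A : R) : (k <= n)%N -> n%:R <= A ->
  normc (qbinom_char t n k - (expR (- (t ^+ 2 * qbinom_var R n k / 2)))%:C)
    <= 3 * A * ((`|t| * A) ^+ 3 + 2 * (`|t| * A) ^+ 4) * expR (t ^+ 2 * A ^+ 3).
Proof.
move=> kn nA.
pose G l : R := expR (- (t ^+ 2 * qfact_var R l / 2)).
pose e := A * ((`|t| * A) ^+ 3 + 2 * (`|t| * A) ^+ 4).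
have A0 : 0 <= A by apply: le_trans nA.
have near l : (l <= n)%N -> normc (qfact_char t l - (G l)%:C) <= e.
  move=> ln; apply: le_trans (qfact_char_gaussian t l) _.
  have lA : l%:R <= A by apply: le_trans nA; rewrite ler_nat.
  have tl : `|t| * l%:R <= `|t| * A by rewrite ler_wpM2l.
  have tl0 : 0 <= `|t| * l%:R by rewrite mulr_ge0.
  rewrite /e; apply: ler_pM; [exact: ler0n| |exact: lA|].
    by apply: addr_ge0; rewrite ?mulr_ge0 ?exprn_ge0.
  have tA0 := le_trans tl0 tl.
  by apply: lerD; [|apply: ler_wpM2l => //]; rewrite lerXn2r ?nnegrE.
have G1 l : normc (G l)%:C <= 1.
  rewrite normc_real ger0_norm ?expR_ge0 // expR_le1 oppr_le0.
  by rewrite divr_ge0 // mulr_ge0 ?sqr_ge0 // (andP (qfact_var_le l)).1.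
have Edef : qbinom_char t n k * (qfact_char t k * qfact_char t (n - k)) = qfact_char t n.
  rewrite /qbinom_char /qfact_char (qfact_qbinom _ kn) !char_evalM.
  rewrite -(bin_fact kn) !natrM !invfM.
  have -> : qfact_mean R n = qbinom_mean R n k + (qfact_mean R k + qfact_mean R (n - k)).
    by rewrite /qbinom_mean /qfact_mean natrB //; field.
  by rewrite !mulrDr !opprD !cisD; ring.
have Gdef : expR (- (t ^+ 2 * qbinom_var R n k / 2)) * (G k * G (n - k)%N) = G n.
  rewrite /G -!expRD; congr expR.
  by rewrite /qbinom_var /qfact_var natrB //; field.
set d := normc _.
have dG : d * (G k * G (n - k)%N) <= 3 * e.
  have Gpos : 0 <= G k * G (n - k)%N by rewrite mulr_ge0 ?expR_ge0.
  rewrite /d -[X in _ * X <= _](ger0_norm Gpos) -normc_real -normcM mulrBl -rmorphM Gdef.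
  have -> : qbinom_char t n k * (G k * G (n - k)%N)%:C - (G n)%:C
    = qbinom_char t n k * ((G k)%:C * (G (n - k)%N)%:C - qfact_char t k * qfact_char t (n - k))
      + (qfact_char t n - (G n)%:C) by rewrite -Edef rmorphM; ring.
  apply: le_trans (le_normcD _ _) _.
  rewrite (_ : 3 * e = (e + e) + e); last by ring.
  apply: lerD; last exact: near.
  rewrite normcM; apply: le_trans (_ : 1 * (e + e) <= _); last by rewrite mul1r.
  apply: ler_pM; rewrite ?normc_ge0 ?normc_qbinom_char_le //.
  have -> : (G k)%:C * (G (n - k)%N)%:C - qfact_char t k * qfact_char t (n - k)
    = - ((qfact_char t k - (G k)%:C) * (G (n - k)%N)%:C
         + qfact_char t k * (qfact_char t (n - k) - (G (n - k)%N)%:C)) by ring.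
  rewrite normcN; apply: le_trans (le_normcD _ _) _.
  rewrite [normc (_ * (G _)%:C)]normcM [normc (qfact_char _ _ * _)]normcM.
  apply: lerD.
    apply: le_trans (ler_pM _ _ (near k kn) (G1 _)) _; rewrite ?normc_ge0 ?mulr1 //.
  rewrite -[leRHS]mul1r; apply: ler_pM; rewrite ?normc_ge0 ?normc_qfact_char_le //.
  by apply: near; exact: leq_subr.
have GA : 1 <= G k * G (n - k)%N * expR (t ^+ 2 * A ^+ 3).
  rewrite /G -!expRD -[leLHS]expR0 ler_expR.
  have /andP[_ vk] := qfact_var_le k; have /andP[_ vl] := qfact_var_le (n - k).
  have cub (l : nat) : (l <= n)%N -> l%:R ^+ 3 <= A ^+ 3.
    move=> ln; rewrite lerXn2r ?nnegrE //; apply: le_trans nA; by rewrite ler_nat.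
  have := cub k kn; have := cub (n - k)%N (leq_subr _ _).
  move=> c1 c2; have t2 := sqr_ge0 t.
  have := ler_wpM2l t2 (le_trans vk c2); have := ler_wpM2l t2 (le_trans vl c1).
  lra.
have d0 : 0 <= d by exact: normc_ge0.
have := ler_wpM2l d0 GA; rewrite mulr1 mulrA => /le_trans; apply.
by rewrite ler_wpM2r ?expR_ge0 // -mulrA.
Qed.

End QBinomialChar.

(** * The basic specialization as a sum over bounded levels *)

Section At1.
Variables (V : nmodType) (m : nat) (v : 'I_m -> V).

Lemma at1_lt k (km : (k < m)%N) : at1 v k.+1 = v (Ordinal km).
Proof. by rewrite /at1 (insubT (fun x => x < m)%N km). Qed.

Lemma at1_ord (i : 'I_m) : at1 v i.+1 = v i.
Proof. by rewrite (at1_lt (ltn_ord i)); congr v; apply: val_inj. Qed.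

Lemma at1_0 : at1 v 0 = 0. Proof. by []. Qed.

Lemma at1_big k : (m < k)%N -> at1 v k = 0.
Proof. by case: k => // k; rewrite ltnS => mk; rewrite /at1 insubF // ltnNge mk. Qed.

End At1.

Lemma bigD1_nat (R : Type) (idx : R) (op : Monoid.com_law idx) a b l (F : nat -> R) :
  (a <= l < b)%N ->
  \big[op/idx]_(a <= i < b) F i
  = op (F l) (\big[op/idx]_(a <= i < b | i != l) F i).
Proof. by move=> lab; rewrite (bigD1_seq l) ?mem_index_iota ?iota_uniq. Qed.

Section BoxSum.
Variable K : nmodType.
Implicit Types (F G : (nat -> nat) -> K) (J : nat -> nat).

(** The levels are functions on nat that vanish outside 1, ..., m, so that level
    m + 1 has its conventional value 0 and levels can be added or removed
    without changing types. *)
Definition box_sum m B F : K :=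
  \sum_(j : {ffun 'I_m -> 'I_B.+1}) F (at1 (fun k => j k : nat)).

Definition set_top m (x : nat) J : nat -> nat :=
  fun k => if k == m.+1 then x else J k.

Lemma box_sum0 B F : box_sum 0 B F = F (fun=> 0%N).
Proof.
rewrite /box_sum (big_pred1 [ffun i : 'I_0 => ord0]) => [|j /=]; last first.
  by apply/esym/eqP/ffunP; case.
by congr F; apply: funext => -[|k]; rewrite ?at1_0 ?at1_big.
Qed.

(** The sum is organized by the value of the top level, which is the one that the
    induction of [box_sum_sites] removes. *)
Lemma box_sumS m B F :
  box_sum m.+1 B F = \sum_(x < B.+1) box_sum m B (fun J => F (set_top m x J)).
Proof.
pose ext (p : 'I_B.+1 * {ffun 'I_m -> 'I_B.+1}) : {ffun 'I_m.+1 -> 'I_B.+1} :=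
  [ffun i => oapp p.2 p.1 (unlift ord_max i)].
pose res (j : {ffun 'I_m.+1 -> 'I_B.+1}) :=
  (j ord_max, [ffun i => j (lift ord_max i)] : {ffun 'I_m -> 'I_B.+1}).
rewrite /box_sum (reindex ext) /=; last first.
  exists res => [[x j] _|j _].
    by congr (_, _); [rewrite ffunE unlift_none|apply/ffunP => i; rewrite !ffunE liftK].
  by apply/ffunP => i; rewrite ffunE; case: unliftP => [i'|] -> /=; rewrite ?ffunE.
rewrite -(pair_bigA _ (fun x j => F (at1 (fun k => ext (x, j) k : nat)))) /=.
apply: eq_bigr => x _; apply: eq_bigr => j _; congr F; apply: funext => k.
rewrite /set_top; case: k => // k; rewrite eqSS.
have [km|mk|->] := ltngtP k m.
- rewrite (at1_lt _ (ltnW km : (k < m.+1)%N)) (at1_lt _ km) ffunE.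
  rewrite (_ : Ordinal _ = lift ord_max (Ordinal km)) ?liftK //.
  by apply: val_inj; rewrite /= /bump leqNgt km.
- by rewrite !at1_big // ltnS // ltnW.
- rewrite (at1_lt _ (ltnSn m)) ffunE.
  by rewrite (_ : Ordinal _ = ord_max) ?unlift_none //; apply: val_inj.
Qed.

Definition supported m J : Prop := forall l, (l == 0%N) || (m < l)%N -> J l = 0%N.

Lemma supported_set_top m x J : supported m J -> supported m.+1 (set_top m x J).
Proof.
move=> sJ l; rewrite /set_top; case: (l =P m.+1) => [->|_]; first by rewrite ltnn.
by move=> lm; apply: sJ; case/orP: lm => [->//|lm]; rewrite (ltnW lm) orbT.
Qed.

Lemma eq_box_sum m B F G :
  (forall J, supported m J -> (forall l, (J l <= B)%N) -> F J = G J) ->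
  box_sum m B F = box_sum m B G.
Proof.
move=> FG; apply: eq_bigr => j _; apply: FG => [l|l].
  by case/orP => [/eqP->//|ml]; rewrite at1_big.
case: l => // l; have [lm|ml] := ltnP l m; last by rewrite at1_big.
by rewrite (at1_lt _ lm) -ltnS.
Qed.

Lemma box_sum_eq0 m B F :
  (forall J, supported m J -> F J = 0) -> box_sum m B F = 0.
Proof.
move=> F0; rewrite (@eq_box_sum _ _ _ (fun=> 0)) => [|J sJ _]; last exact: F0.
by rewrite /box_sum big1.
Qed.

Lemma box_sum_widen m B B' F : (B <= B')%N ->
  (forall J, supported m J -> (exists2 l, l <= m & B < J l)%N -> F J = 0) ->
  box_sum m B F = box_sum m B' F.
Proof.
move=> BB'; elim: m F => [|m IH] F F0; first by rewrite !box_sum0.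
rewrite !box_sumS -!(big_mkord xpredT (fun x => box_sum m _ (fun J => F (set_top m x J)))).
rewrite [RHS](big_cat_nat (n := B.+1)) //=.
rewrite [X in _ = _ + X](_ : _ = 0) ?addr0; last first.
  rewrite big_nat big1 // => x /andP[Bx _].
  apply: box_sum_eq0 => J sJ; apply: F0; first exact: supported_set_top.
  by exists m.+1; rewrite // /set_top eqxx.
apply: eq_bigr => x _; apply: IH => J sJ [l lm Bl].
apply: F0; first exact: supported_set_top.
by exists l; rewrite ?(leq_trans lm) // /set_top ltn_eqF.
Qed.

Lemma exchange_box_sum m B (I : Type) (r : seq I) (P : pred I)
    (F : I -> (nat -> nat) -> K) :
  \sum_(i <- r | P i) box_sum m B (F i)
  = box_sum m B (fun J => \sum_(i <- r | P i) F i J).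
Proof. by rewrite /box_sum exchange_big. Qed.

End BoxSum.

Section SupernomialSum.
Variables (F : fieldType) (m : nat).
Implicit Types (J : nat -> nat).

Definition weight (L : nat -> nat) J : nat :=
  (\prod_(1 <= l < m.+1) 'C(L l + J l.+1, J l))%N.

Definition energy (L : nat -> nat) J : nat :=
  (\sum_(1 <= i < m.+1) J i * (J i + \sum_(1 <= l < i) L l))%N.

Definition supernomial_term (L : nat -> nat) J : {poly F} :=
  'X^(energy L J) * \prod_(1 <= l < m.+1) qbinom F (L l + J l.+1) (J l).

Definition admissible (L : nat -> nat) J : Prop :=
  supported m J /\ forall l, (1 <= l <= m)%N -> (J l <= L l + J l.+1)%N.

(** When all binomials are nonzero, j_l <= L_l + j_(l+1) for all l, and these
    inequalities add up from l to m. *)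
Lemma admissible_le L J l : admissible L J ->
  (J l <= \sum_(1 <= k < m.+1) L k)%N.
Proof.
move=> [sJ aJ].
have H k : (k <= m)%N -> (J (m.+1 - k) <= \sum_(m.+1 - k <= i < m.+1) L i)%N.
  elim: k => [|k IH] km; first by rewrite subn0 sJ // leqnn orbT.
  have E : (m.+1 - k)%N = (m.+1 - k.+1).+1 by lia.
  rewrite big_ltn; last by lia.
  rewrite -E; apply: leq_trans (aJ _ _) _; first by lia.
  by rewrite -E leq_add2l IH // ltnW.
have [/andP[l1 lm]|] := boolP (1 <= l <= m)%N; last first.
  by rewrite negb_and -!ltnNge ltnS leqn0 => lm; rewrite sJ.
have := H (m.+1 - l)%N; rewrite subKn; last by lia.
move=> H'; apply: leq_trans (H' _) _; first by lia.
by rewrite [X in (_ <= X)%N](big_cat_nat (n := l)) //= ?leq_addl //; lia.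
Qed.

Lemma weight_eq0 L J : supported m J -> ~ admissible L J -> weight L J = 0%N.
Proof.
move=> sJ nJ; apply/eqP; rewrite /weight; apply/negPn/negP => P0.
apply: nJ; split=> // l lm; rewrite leqNgt; apply/negP => JL.
by move: P0; rewrite (@bigD1_nat _ _ _ 1 m.+1 l _ lm) /= bin_small.
Qed.

Lemma supernomial_term_eq0 L J :
  supported m J -> ~ admissible L J -> supernomial_term L J = 0.
Proof.
move=> sJ nJ; rewrite /supernomial_term.
apply/eqP; apply/negPn/negP; rewrite mulf_eq0 negb_or => /andP[_ P0].
apply: nJ; split=> // l lm; rewrite leqNgt; apply/negP => JL.
by move: P0; rewrite (@bigD1_nat _ _ _ 1 m.+1 l _ lm) /= qbinom_small // mul0r eqxx.
Qed.

(** Summing the supernomials over a removes the constraint on the sum of the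
    levels.  The remaining sum is over all levels, and the bound B only has to be
    large enough for the terms with a level above B to vanish. *)
Lemma basic_specialization_box (L : 'I_m -> nat) B :
  (\sum_(1 <= k < m.+1) at1 L k <= B)%N ->
  basic_specialization F L = box_sum m B (supernomial_term (at1 L)).
Proof.
move=> LB; set T := supernomial_term _.
have big J l : supported m J -> (B < J l)%N -> T J = 0.
  move=> sJ Bl; apply: supernomial_term_eq0 => // aJ.
  by have := leq_ltn_trans (leq_trans (admissible_le l aJ) LB) Bl; rewrite ltnn.
have sumE (n : nat) (j : {ffun 'I_m -> 'I_n.+1}) :
    (\sum_i j i = \sum_(1 <= l < m.+1) at1 (fun k => j k : nat) l)%N.
  rewrite big_add1 big_mkord; apply: eq_bigr => i _.
  by rewrite at1_ord.
pose S J := (\sum_(1 <= l < m.+1) J l)%N.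
have qE (n : nat) : qsupernomial F L n = box_sum m B (fun J => if S J == n then T J else 0).
  have -> : qsupernomial F L n = box_sum m n (fun J => if S J == n then T J else 0).
    rewrite /qsupernomial /box_sum absz_nat [LHS]big_mkcond.
    by apply: eq_bigr => j _; rewrite eqz_nat sumE -/(S _).
  rewrite (@box_sum_widen _ m n (maxn n B)) ?leq_maxl //; last first.
    move=> J sJ [l lm nl]; case: eqP => // SJ; move: nl; rewrite -SJ ltnNge => /negP[].
    case: l lm => [|l] lm; first by rewrite sJ.
    by rewrite /S (@bigD1_nat _ _ _ 1 m.+1 l.+1) ?leq_addr.
  rewrite -(@box_sum_widen _ m B (maxn n B)) ?leq_maxr // => J sJ [l lm Bl].
  by case: eqP => // _; exact: big Bl.
rewrite /basic_specialization.
rewrite (fsbigE [seq Posz n | n <- iota 0 (m * B).+1]); first last.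
- move=> a _; case: a => [n|n] na; last first.
    by rewrite /qsupernomial big_pred0 // => j; apply/negP => /eqP.
  rewrite qE box_sum_eq0 // => J sJ; case: eqP => // SJ.
  have [[l Bl]|aJ] := pselect (exists l, B < J l)%N; first exact: big Bl.
  case/negP: na; apply/mapP; exists n => //; rewrite mem_iota add0n ltnS -SJ /S.
  apply: leq_trans (_ : \sum_(1 <= l < m.+1) B <= _)%N.
    by apply: leq_sum => l _; rewrite leqNgt; apply/negP => Bl; apply: aJ; exists l.
  by rewrite sum_nat_const_nat subn1.
- by [].
- by rewrite map_inj_uniq ?iota_uniq // => ? ? [].
rewrite big_map (eq_bigl xpredT) => [|n]; last by rewrite in_setT.
under eq_bigr do rewrite qE.
rewrite exchange_box_sum; apply: eq_box_sum => J sJ JB.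
rewrite (bigD1_seq (S J)) ?iota_uniq //; last first.
  rewrite mem_iota add0n ltnS; apply: leq_trans (_ : \sum_(1 <= l < m.+1) B <= _)%N.
    by apply: leq_sum.
  by rewrite sum_nat_const_nat subn1.
by rewrite eqxx big1 => [|n]; [exact: addr0|rewrite eq_sym => /negbTE ->].
Qed.

End SupernomialSum.

(** * Independent sites *)

Section SiteModel.
Variables (V K : nmodType) (v : nat -> V).

(** The contribution of a site of label k that carries the number r: it is alive
    at the levels l with r < l <= k, and level l is worth v l. *)
Definition site_step (k r : nat) : V := \sum_(r.+1 <= l < k.+1) v l.

(** L k sites of label k, for each k.  The largest labels come first since the
    recursion on m removes the top level. *)
Definition site_labels (L : nat -> nat) (m : nat) : seq nat :=
  flatten [seq nseq (L k) k | k <- rev (iota 0 m.+1)].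

Local Notation tot s h := (\sum_(y <- outcomes site_step s) h y).

Lemma site_labelsS L m : site_labels L m.+1 = nseq (L m.+1) m.+1 ++ site_labels L m.
Proof. by rewrite /site_labels -(addn1 m.+1) iotaD rev_cat. Qed.

Lemma tot_cons k s (h : V -> K) :
  tot (k :: s) h = \sum_(r < k.+1) tot s (fun y => h (y + site_step k r)).
Proof.
rewrite -[outcomes _ (k :: s)]/[seq y + site_step k r | r <- iota 0 k.+1, y <- outcomes site_step s].
by rewrite big_allpairs_dep -(big_mkord xpredT
  (fun r => \sum_(y <- outcomes site_step s) h (y + site_step k r))) /index_iota subn0.
Qed.

Lemma sum_bin_pascal (n B : nat) (f : nat -> K) : (n < B)%N ->
  \sum_(x < B.+1) f x *+ 'C(n.+1, x)
  = \sum_(x < B.+1) (f x + f x.+1) *+ 'C(n, x).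
Proof.
move=> nB.
under [RHS]eq_bigr do rewrite mulrnDl.
rewrite big_split /= [X in _ = _ + X]big_ord_recr /= (bin_small nB) mulr0n addr0.
rewrite [LHS]big_ord_recl [X in _ = X + _]big_ord_recl !bin0 /= -addrA; congr (_ + _).
by rewrite -big_split /=; apply: eq_bigr => x _; rewrite /bump add1n binS mulrnDr.
Qed.

(** A site of label m + 1 either moves by 0, or by v (m + 1) plus a step of a
    site of label m; choosing which of n sites do the latter gives the
    binomial weights. *)
Lemma sum_bin_sites m n B s (h : V -> K) : (n <= B)%N ->
  \sum_(x < B.+1) tot (nseq x m ++ s) (fun y => h (y + v m.+1 *+ x)) *+ 'C(n, x)
  = tot (nseq n m.+1 ++ s) h.
Proof.
elim: n h => [|n IH] h nB.
  rewrite big_ord_recl [X in _ + X]big1 => [|x _]; last by rewrite bin0n.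
  by rewrite addr0 bin0 mulr1n /=; apply: eq_bigr => y _; rewrite addr0.
rewrite (@sum_bin_pascal _ _
  (fun x => tot (nseq x m ++ s) (fun y => h (y + v m.+1 *+ x)))) //.
rewrite [RHS]tot_cons [RHS]big_ord_recr /= [X in _ = _ + X](eq_bigr (fun y => h y)) => [|y _]; last first.
  by rewrite /site_step big_geq // addr0.
rewrite -(IH h (ltnW nB)).
under [X in _ = X + _]eq_bigr => r _ do rewrite -(IH (fun y => h (y + site_step m.+1 r)) (ltnW nB)).
rewrite [X in _ = X + _]exchange_big -big_split; apply: eq_bigr => x _.
rewrite -[LHS]/((tot (nseq x m ++ s) (fun y => h (y + v m.+1 *+ x))
  + tot (m :: (nseq x m ++ s)) (fun y => h (y + v m.+1 *+ x.+1))) *+ 'C(n, x)).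
rewrite tot_cons.
rewrite [RHS]/= sumrMnl -mulrnDl [in RHS]addrC; congr ((_ + _) *+ _).
apply: eq_bigr => r _; apply: eq_bigr => y _; congr h.
rewrite /site_step [X in _ = _ + X]big_nat_recr /=; last by rewrite ltnS -ltnS.
by rewrite mulrS -!addrA; congr (_ + _); rewrite [RHS]addrC -addrA.
Qed.

(** Fixing the top level to x turns x sites of label m + 1 into sites of label
    m. *)
Lemma weight_set_top m L x J : supported m J ->
  weight m.+1 L (set_top m x J)
  = ('C(L m.+1, x)
     * weight m (fun k => if k == m then L k + x else L k) J)%N.
Proof.
move=> sJ; rewrite /weight big_nat_recr //= mulnC.
have -> : set_top m x J m.+2 = 0%N.
  by rewrite /set_top eqn_leq ltnn sJ // ltnS leqnSn orbT.
rewrite {1}/set_top eqxx addn0; congr muln.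
rewrite big_nat [RHS]big_nat; apply: eq_bigr => l /andP[l1 lm].
rewrite /set_top eqSS (ltn_eqF lm); case: eqP => [->|] //.
by rewrite (sJ m.+1) ?addn0 // ltnSn orbT.
Qed.

(** The weights of the supernomial count the configurations of independent
    sites: level by level, every site of label k survives through a uniformly
    distributed number of levels, and j_l counts the sites alive at level l. *)
Lemma box_sum_sites m L B (h : V -> K) :
  (\sum_(1 <= l < m.+1) L l <= B)%N ->
  box_sum m B (fun J => h (\sum_(1 <= l < m.+1) v l *+ J l) *+ weight m L J)
  = tot (site_labels L m) h.
Proof.
elim: m L h => [|m IH] L h LB.
  rewrite box_sum0 /weight !big_geq // mulr1n /site_labels /= cats0.
  elim: (L 0%N) => [|n IHn]; first by rewrite big_seq1.
  rewrite -[nseq n.+1 0%N]/(0%N :: nseq n 0%N) tot_cons big_ord1 IHn.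
  by apply: eq_bigr => y _; rewrite /site_step big_geq // addr0.
rewrite box_sumS.
pose L' x k := if k == m then (L k + x)%N else L k.
have lab x : site_labels (L' x) m = nseq x m ++ site_labels L m.
  rewrite /site_labels -addn1 iotaD rev_cat !map_cat !flatten_cat /= !cats0.
  rewrite {1}/L' eqxx addnC nseqD -catA; congr (_ ++ (_ ++ flatten _)).
  by apply/eq_in_map => k; rewrite mem_rev mem_iota /L' => /andP[_ km]; rewrite ltn_eqF.
have LBm : (\sum_(1 <= l < m.+1) L l + L m.+1 <= B)%N by rewrite -big_nat_recr.
rewrite site_labelsS -(@sum_bin_sites m _ B); last by apply: leq_trans LBm; rewrite leq_addl.
apply: eq_bigr => x _; have [xL|Lx] := leqP x (L m.+1); last first.
  rewrite bin_small // mulr0n box_sum_eq0 // => J sJ.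
  by rewrite weight_set_top // bin_small.
rewrite -lab -(IH (L' x)); last first.
  apply: (@leq_trans (\sum_(1 <= l < m.+1) L l + x)); last first.
    by apply: leq_trans LBm; rewrite leq_add2l.
  have [m0|m0] := posnP m; first by rewrite m0 big_geq.
  rewrite !(@bigD1_nat _ _ _ 1 m.+1 m) ?m0 ?leqnn //= {1}/L' eqxx.
  rewrite addnAC leq_add2r leq_add2l.
  by apply: leq_sum => i /negbTE im; rewrite /L' im.
rewrite /box_sum -sumrMnl; apply: eq_bigr => j _; set J := at1 _.
have sJ : supported m J by move=> l /orP[/eqP->//|ml]; rewrite /J at1_big.
rewrite weight_set_top // mulnC mulrnA; congr (h _ *+ _ *+ _).
rewrite big_nat_recr //= {2}/set_top eqxx; congr (_ + _).
rewrite big_nat [RHS]big_nat; apply: eq_bigr => l /andP[_ lm].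
by rewrite /set_top ltn_eqF.
Qed.

End SiteModel.
Lemma supported_at1 m B (j : {ffun 'I_m -> 'I_B.+1}) :
  supported m (at1 (fun k => j k : nat)).
Proof. by move=> l /orP[/eqP->//|ml]; rewrite at1_big. Qed.

(** * Expectations over the levels *)

Section SiteAverage.
Variables (R : realType) (m : nat) (L : nat -> nat).
Implicit Types (J : nat -> nat) (c : nat -> R).

Definition site_count : nat := \sum_(1 <= l < m.+1) L l.
Definition config_count : nat := \prod_(k <- site_labels L m) k.+1.

(** Expectation over random levels J, drawn with probability proportional to the
    value at q = 1 of their term; [config_count] is the sum of these values. *)
Definition site_average (K : fieldType) (h : (nat -> nat) -> K) : K :=
  config_count%:R^-1 * box_sum m site_count (fun J => h J *+ weight m L J).

Lemma config_count_gt0 : (0 < config_count)%N.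
Proof. by apply: prodn_gt0. Qed.

Lemma eq_site_average (K : fieldType) (f g : (nat -> nat) -> K) :
  (forall J, admissible m L J -> f J = g J) -> site_average f = site_average g.
Proof.
move=> fg; congr (_ * _); apply: eq_box_sum => J sJ _.
have [aJ|aJ] := pselect (admissible m L J); first by rewrite fg.
by rewrite weight_eq0.
Qed.

Lemma site_averageD (K : fieldType) (f g : (nat -> nat) -> K) :
  site_average (fun J => f J + g J) = site_average f + site_average g.
Proof.
rewrite /site_average -mulrDr /box_sum -big_split; congr (_ * _).
by apply: eq_bigr => j _; rewrite mulrnDl.
Qed.

Lemma site_averageZ (K : fieldType) a (f : (nat -> nat) -> K) :
  site_average (fun J => a * f J) = a * site_average f.
Proof.
rewrite /site_average mulrCA; congr (_ * _); rewrite /box_sum mulr_sumr.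
by apply: eq_bigr => j _; rewrite mulrnAr.
Qed.

Lemma site_averageZr (K : fieldType) a (f : (nat -> nat) -> K) :
  site_average (fun J => f J * a) = site_average f * a.
Proof. by rewrite mulrC -site_averageZ; apply: eq_site_average => J _; rewrite mulrC. Qed.

Lemma site_averageB (K : fieldType) (f g : (nat -> nat) -> K) :
  site_average (fun J => f J - g J) = site_average f - site_average g.
Proof.
rewrite (@eq_site_average _ _ (fun J => f J + -1 * g J)) => [|J _]; last by rewrite mulN1r.
by rewrite site_averageD site_averageZ mulN1r.
Qed.

Lemma site_average_sum (K : fieldType) (I : Type) (r : seq I) (P : pred I)
    (F : I -> (nat -> nat) -> K) :
  site_average (fun J => \sum_(i <- r | P i) F i J)
  = \sum_(i <- r | P i) site_average (F i).
Proof.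
rewrite /site_average -mulr_sumr; congr (_ * _); rewrite exchange_box_sum.
by apply: eq_box_sum => J _ _; rewrite sumrMnl.
Qed.

Definition lin c J : R := \sum_(1 <= l < m.+1) c l * (J l)%:R.

(** A linear combination of the levels is a sum of independent variables, one for
    each site. *)
Lemma site_average_lin (K : fieldType) c (h : R -> K) :
  site_average (fun J => h (lin c J))
  = walk_average (site_step c) (site_labels L m) h.
Proof.
rewrite /site_average /walk_average -/config_count -(@box_sum_sites _ _ _ _ _ site_count) //.
congr (_ * _); apply: eq_box_sum => J _ _; congr (h _ *+ _).
by apply: eq_bigr => l _; rewrite mulr_natr.
Qed.

Lemma site_average_cst (K : numFieldType) (a : K) : site_average (fun=> a) = a.
Proof.
pose c (l : nat) := 0%N; rewrite -[RHS](walk_average_cst (site_step c) (site_labels L m)).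
by rewrite /walk_average -(@box_sum_sites _ _ c _ _ site_count).
Qed.

Lemma ler_site_average (f g : (nat -> nat) -> R) :
  (forall J, admissible m L J -> f J <= g J) -> site_average f <= site_average g.
Proof.
move=> fg; rewrite /site_average ler_wpM2l ?invr_ge0 // /box_sum ler_sum // => j _.
set J := at1 _; have sJ : supported m J by exact: supported_at1.
have [aJ|aJ] := pselect (admissible m L J); first by rewrite lerMn2r fg ?orbT.
by rewrite weight_eq0.
Qed.

Lemma site_average_ge0 (f : (nat -> nat) -> R) :
  (forall J, admissible m L J -> 0 <= f J) -> 0 <= site_average f.
Proof. by move=> f0; rewrite -[leLHS]site_average_cst ler_site_average. Qed.

Lemma normc_site_average (h : (nat -> nat) -> R[i]) :
  normc (site_average h) <= site_average (fun J => normc (h J)).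
Proof.
rewrite /site_average normcM natC_inv normc_real ger0_norm ?invr_ge0 //.
rewrite ler_wpM2l ?invr_ge0 //; apply: le_trans (normc_sum _ _ _) _.
by rewrite ler_sum // => j _; rewrite normcMn.
Qed.

Lemma norm_site_average (f : (nat -> nat) -> R) :
  `|site_average f| <= site_average (fun J => `|f J|).
Proof.
rewrite ler_norml -[X in X <= _ <= _]mulN1r -site_averageZ.
by rewrite !ler_site_average // => J _; rewrite ?mulN1r ?lerNnormlW ?ler_norm.
Qed.

(** The expectation of j_l: a site of label k >= l is alive at level l with
    probability l / (k + 1). *)
Definition level_mean (l : nat) : R :=
  l%:R * \sum_(l <= k < m.+1) (L k)%:R / k.+1%:R.

(** Deviation from its mean of the indicator that the site of label k which
    survives through k - r levels is alive at level l. *)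
Definition level_dev (l k r : nat) : R :=
  ((r < l <= k)%N)%:R - (l <= k)%N%:R * (l%:R / k.+1%:R).

Lemma sum_site_labels (f : nat -> R) : L 0 = 0%N ->
  \sum_(k <- site_labels L m) f k = \sum_(1 <= k < m.+1) (L k)%:R * f k.
Proof.
move=> L0; rewrite /site_labels big_flatten /= big_map.
rewrite (perm_big (iota 0 m.+1)) ?perm_rev //= big_cons L0 big_nil add0r.
rewrite /index_iota subn1 /=; apply: eq_bigr => k _.
elim: (L k) => [|n IH]; first by rewrite big_nil mul0r.
by rewrite /= big_cons IH -[n.+1%:R]natr1 mulrDl mul1r addrC.
Qed.

Lemma size_site_labels : L 0 = 0%N -> size (site_labels L m) = site_count.
Proof.
move=> L0; apply/eqP; rewrite -(eqr_nat R) -sum1_size natr_sum sum_site_labels //.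
by rewrite /site_count natr_sum; apply/eqP/eq_bigr => k _; rewrite mulr1.
Qed.

Lemma mem_site_labels k : k \in site_labels L m -> (k <= m)%N.
Proof.
rewrite /site_labels => /flatten_mapP[j]; rewrite mem_rev mem_iota add0n ltnS => jm.
by rewrite mem_nseq => /andP[_ /eqP->].
Qed.

Lemma sum_level_alive k r c : (k <= m)%N ->
  site_step c k r = \sum_(1 <= l < m.+1) c l * ((r < l <= k)%N)%:R.
Proof.
move=> km; rewrite /site_step; have [rk|kr] := leqP r.+1 k.+1; last first.
  rewrite big_geq ?(ltnW kr) // big_nat big1 // => l /andP[l1 lm].
  by rewrite (_ : (r < l <= k)%N = false) ?mulr0 //; lia.
rewrite [RHS](big_cat_nat (n := r.+1)) //=; last by lia.
rewrite [X in _ = X + _]big_nat [X in _ = X + _]big1 ?add0r => [|l /andP[l1 lr]]; last first.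
  by rewrite (_ : (r < l <= k)%N = false) ?mulr0 //; lia.
rewrite [RHS](big_cat_nat (n := k.+1)) //=.
rewrite [X in _ = _ + X]big_nat [X in _ = _ + X]big1 ?addr0 => [|l /andP[l1 lr]]; last first.
  by rewrite (_ : (r < l <= k)%N = false) ?mulr0 //; lia.
rewrite big_nat [RHS]big_nat; apply: eq_bigr => l /andP[l1 l2].
by rewrite (_ : (r < l <= k)%N = true) ?mulr1 //; lia.
Qed.

Lemma sum_alive k l : \sum_(r < k.+1) ((r < l <= k)%N)%:R = (l <= k)%N%:R * l%:R :> R.
Proof.
rewrite -natr_sum -natrM; congr _%:R.
have [lk|kl] := leqP l k; last by rewrite big1 // => r _; rewrite andbF.
rewrite -(big_mkord xpredT (fun r => ((r < l)%N && true : nat))) (big_cat_nat (n := l)) //=; last exact: ltnW.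
rewrite [X in (_ + X)%N]big_nat [X in (_ + X)%N]big1 ?addn0 => [|i /andP[li _]]; last by rewrite ltnNge li.
rewrite big_nat (eq_bigr (fun=> 1%N)) => [|i /andP[_ ->]//].
by rewrite -big_nat sum_nat_const_nat subn0 muln1 mul1n.
Qed.

Lemma step_mean_sites k c : (k <= m)%N -> step_mean (site_step c) k
  = \sum_(1 <= l < m.+1) c l * ((l <= k)%N%:R * (l%:R / k.+1%:R)).
Proof.
move=> km; rewrite /step_mean.
under eq_bigr do rewrite sum_level_alive //.
rewrite exchange_big mulr_sumr /=; apply: eq_bigr => l _.
by rewrite -mulr_sumr sum_alive; ring.
Qed.

Lemma step_dev_sites k r c : (k <= m)%N -> step_dev (site_step c) k r
  = \sum_(1 <= l < m.+1) c l * level_dev l k r.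
Proof.
move=> km; rewrite /step_dev step_mean_sites // sum_level_alive // -sumrB.
by apply: eq_bigr => l _; rewrite /level_dev mulrBr.
Qed.

(** Covariance of the indicators that a site of label k is alive at level i and at
    level l. *)
Definition level_cov (k i l : nat) : R :=
  (maxn i l <= k)%N%:R
  * ((minn i l)%:R / k.+1%:R - i%:R * l%:R / k.+1%:R ^+ 2).

Lemma sum_level_dev k i l :
  k.+1%:R^-1 * \sum_(r < k.+1) level_dev i k r * level_dev l k r
  = level_cov k i l.
Proof.
have k0 : k.+1%:R != 0 :> R by rewrite pnatr_eq0.
rewrite (eq_bigr (fun r : 'I_k.+1 => ((r < minn i l <= k)%N)%:R * (maxn i l <= k)%N%:R
   - ((r < i <= k)%N)%:R * ((l <= k)%N%:R * (l%:R / k.+1%:R))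
   - ((r < l <= k)%N)%:R * ((i <= k)%N%:R * (i%:R / k.+1%:R))
   + ((i <= k)%N%:R * (i%:R / k.+1%:R)) * ((l <= k)%N%:R * (l%:R / k.+1%:R)))); last first.
  move=> r _; rewrite /level_dev -!natrM !mulnb leq_min geq_max geq_min.
  have -> : ((r < i) && (r < l) && ((i <= k) || (l <= k)) && ((i <= k) && (l <= k)))%N
     = ((r < i <= k) && (r < l <= k))%N by do 4 case: (_ <= _)%N.
  by case: (r < i <= k)%N; case: (r < l <= k)%N => /=; ring.
rewrite big_split /= !sumrB -!mulr_suml !sum_alive sumr_const card_ord -mulr_natr.
rewrite /level_cov geq_min geq_max.
by case: (i <= k)%N; case: (l <= k)%N => /=; rewrite -?natr1; field; rewrite natr1.
Qed.

Lemma level_covC k i l : level_cov k i l = level_cov k l i.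
Proof. by rewrite /level_cov maxnC minnC [i%:R * _]mulrC. Qed.

Lemma step_var_sites k c : (k <= m)%N -> step_var (site_step c) k
  = \sum_(1 <= i < m.+1) \sum_(1 <= l < m.+1) c i * c l * level_cov k i l.
Proof.
move=> km; rewrite /step_var.
under eq_bigr do rewrite step_dev_sites // expr2 mulr_suml.
under eq_bigr do under eq_bigr do rewrite mulr_sumr.
rewrite exchange_big mulr_sumr /=; apply: eq_bigr => i _.
rewrite exchange_big mulr_sumr /=; apply: eq_bigr => l _.
rewrite -sum_level_dev mulrCA; congr (_ * _); rewrite mulr_sumr.
by apply: eq_bigr => r _; ring.
Qed.

Lemma norm_level_dev_le l k r : `|level_dev l k r| <= 1.
Proof.
rewrite /level_dev; have [lk|kl] := leqP l k; last by rewrite andbF mul0r subrr normr0.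
rewrite andbT mul1r.
have : 0 <= l%:R / k.+1%:R :> R by rewrite divr_ge0.
have : l%:R / k.+1%:R <= 1 :> R by rewrite ler_pdivrMr ?ltr0n // mul1r ler_nat ltnW.
move: (l%:R / k.+1%:R) => x x1 x0; rewrite ler_norml.
by case: (r < l)%N; rewrite ?mulr1n ?mulr0n; apply/andP; split; lra.
Qed.

End SiteAverage.

(** * Conditional mean and variance of the exponent *)

Section EnergyExpansion.
Variables (R : realType) (m : nat) (L : nat -> nat).
Implicit Types (J : nat -> nat).

Hypothesis L0 : L 0 = 0%N.

Local Notation Ex := (site_average m L).
Local Notation e := (level_mean R m L).
Local Notation a := ((site_count m L)%:R : R).

Definition below (i : nat) : R := \sum_(1 <= l < i) (L l)%:R.

(** Mean of the exponent of q in the term of J: the energy plus the means of the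
    Gaussian binomials. *)
Definition cond_mean J : R :=
  \sum_(1 <= i < m.+1) ((J i)%:R * ((J i)%:R + below i)
    + qbinom_mean R (L i + J i.+1) (J i)).

Definition cond_var J : R :=
  \sum_(1 <= i < m.+1) qbinom_var R (L i + J i.+1) (J i).

(** The differential at the mean levels of the quadratic polynomial
    [cond_mean]. *)
Definition gradient (i : nat) : R :=
  e i + (e i.+1 + e i.-1) / 2 + below i + (L i)%:R / 2.

Definition dev J (l : nat) : R := (J l)%:R - e l.

Definition mean_at_mean : R :=
  \sum_(1 <= i < m.+1) (e i * (e i + below i) + e i * ((L i)%:R + e i.+1 - e i) / 2).

Definition var_at_mean : R :=
  \sum_(1 <= i < m.+1)
    e i * ((L i)%:R + e i.+1 - e i) * ((L i)%:R + e i.+1 + 1) / 12.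

Definition linear_part J : R := \sum_(1 <= i < m.+1) gradient i * dev J i.
Definition quadratic_part J : R :=
  \sum_(1 <= i < m.+1) (dev J i ^+ 2 + dev J i * dev J i.+1) / 2.

Lemma level_mean0 : e 0 = 0. Proof. by rewrite /level_mean mul0r. Qed.

Lemma level_mean_top l : (m < l)%N -> e l = 0.
Proof. by move=> ml; rewrite /level_mean big_geq // mulr0. Qed.

Lemma dev_top J l : supported m J -> (m < l)%N -> dev J l = 0.
Proof.
by move=> sJ ml; rewrite /dev level_mean_top // sJ ?subr0 // ml orbT.
Qed.

(** Taylor expansion of a quadratic polynomial at the mean levels; an index shift
    collects the coefficients of each deviation. *)
Lemma cond_mean_expand J : supported m J ->
  cond_mean J = mean_at_mean + linear_part J + quadratic_part J.
Proof.
move=> sJ; rewrite /cond_mean /mean_at_mean /linear_part /quadratic_part -!big_split /=.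
have shift : \sum_(1 <= i < m.+1) e i * dev J i.+1 = \sum_(1 <= i < m.+1) e i.-1 * dev J i.
  rewrite [RHS]big_add1 /=.
  have -> : \sum_(1 <= i < m.+1) e i * dev J i.+1 = \sum_(0 <= i < m.+1) e i * dev J i.+1.
    by rewrite [RHS]big_ltn // level_mean0 mul0r add0r.
  by rewrite big_nat_recr //= dev_top // mulr0 addr0.
rewrite -[LHS]addr0 -[X in _ + X](subrr (\sum_(1 <= i < m.+1) e i * dev J i.+1 / 2)).
rewrite -[X in _ + (X - _)]mulr_suml shift mulr_suml -sumrB -big_split /=.
apply: eq_bigr => i _.
have -> : (J i)%:R = e i + dev J i by rewrite /dev; ring.
rewrite /qbinom_mean natrD.
have -> : (J i.+1)%:R = e i.+1 + dev J i.+1 by rewrite /dev; ring.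
have -> : (J i)%:R = e i + dev J i by rewrite /dev; ring.
by rewrite /gradient; field.
Qed.

Lemma poly_moments_sum (I : Type) (r : seq I) (P : I -> {poly R}) (w mu v : I -> R) W M V :
  (forall i, poly_moments (P i) (w i) (mu i) (v i)) ->
  \sum_(i <- r) w i = W -> \sum_(i <- r) w i * mu i = W * M ->
  \sum_(i <- r) w i * (v i + mu i ^+ 2) = W * (V + M ^+ 2) ->
  poly_moments (\sum_(i <- r) P i) W M V.
Proof.
move=> PM <- E1 E2; split.
- by rewrite horner_sum; apply: eq_bigr => i _; case: (PM i).
- rewrite raddf_sum horner_sum -E1; apply: eq_bigr => i _; by case: (PM i).
rewrite raddf_sum raddf_sum !horner_sum -E2 -big_split /=.
by apply: eq_bigr => i _; case: (PM i).
Qed.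

Lemma poly_moments_prod (r : seq nat) (P : nat -> {poly R}) (w : nat -> nat) (mu v : nat -> R) :
  {in r, forall i, poly_moments (P i) (w i)%:R (mu i) (v i)} ->
  poly_moments (\prod_(i <- r) P i) (\prod_(i <- r) w i)%N%:R
    (\sum_(i <- r) mu i) (\sum_(i <- r) v i).
Proof.
elim: r => [|i r IH] PM.
  rewrite !big_nil; split; rewrite ?hornerC ?derivC ?hornerC ?deriv0 ?horner0; lra.
rewrite !big_cons natrM; apply: poly_momentsM; first by apply: PM; rewrite inE eqxx.
by apply: IH => j jr; apply: PM; rewrite inE jr orbT.
Qed.

Lemma admissible_bin J i : admissible m L J -> i \in index_iota 1 m.+1 ->
  (J i <= L i + J i.+1)%N.
Proof. by move=> [_ aJ]; rewrite mem_index_iota => /aJ. Qed.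

Lemma poly_moments_term J : admissible m L J ->
  poly_moments (supernomial_term R m L J) (weight m L J)%:R (cond_mean J) (cond_var J).
Proof.
move=> aJ; rewrite /supernomial_term -[(weight m L J)%:R]mul1r.
have -> : cond_mean J = (energy m L J)%:R
    + \sum_(1 <= i < m.+1) qbinom_mean R (L i + J i.+1) (J i).
  rewrite /cond_mean big_split /=; congr (_ + _); rewrite natr_sum.
  by apply: eq_bigr => i _; rewrite natrM natrD natr_sum.
rewrite -[cond_var J]add0r; apply: poly_momentsM; first exact: poly_moments_Xn.
apply: poly_moments_prod => i ir; apply: poly_moments_qbinom.
exact: admissible_bin.
Qed.

Lemma config_count_average : box_sum m (site_count m L) (fun J => (weight m L J)%:R : R)
  = (config_count m L)%:R.
Proof.
have := site_average_cst m L (1 : R); rewrite /site_average => /(canRL (mulVKf _)).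
by rewrite mulr1 => <- //; rewrite pnatr_eq0 -lt0n config_count_gt0.
Qed.

(** The law of total expectation and the law of total variance for the mixture
    over J. *)
Lemma poly_moments_specialization (G : {poly R}) :
  G = box_sum m (site_count m L) (supernomial_term R m L) ->
  poly_moments G (config_count m L)%:R (Ex cond_mean)
    (Ex cond_var + Ex (fun J => (cond_mean J - Ex cond_mean) ^+ 2)).
Proof.
move=> ->.
have W0 : (config_count m L)%:R != 0 :> R by rewrite pnatr_eq0 -lt0n config_count_gt0.
have scale (f : (nat -> nat) -> R) : box_sum m (site_count m L) (fun J => (weight m L J)%:R * f J)
    = (config_count m L)%:R * Ex f.
  by rewrite /site_average mulVKf //; apply: eq_box_sum => J _ _; rewrite mulr_natl.
rewrite /box_sum; have := (@poly_moments_sum _ (index_enum _)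
  (fun j : {ffun 'I_m -> 'I_(site_count m L).+1} =>
    supernomial_term R m L (at1 (fun k => j k : nat)))
  (fun j => (weight m L (at1 (fun k => j k : nat)))%:R)
  (fun j => cond_mean (at1 (fun k => j k : nat)))
  (fun j => cond_var (at1 (fun k => j k : nat)))); apply.
- move=> j; set J := at1 _; have sJ : supported m J by exact: supported_at1.
  have [aJ|aJ] := pselect (admissible m L J); first exact: poly_moments_term.
  rewrite supernomial_term_eq0 // weight_eq0 //.
  by split; rewrite ?deriv0 ?horner0; lra.
- exact: config_count_average.
- exact: scale.
apply: etrans (scale (fun J => cond_var J + cond_mean J ^+ 2)) _; congr (_ * _).
rewrite site_averageD -addrA; congr (_ + _).
set M := Ex cond_mean.
rewrite (@eq_site_average _ _ _ (fun J => (cond_mean J - M) ^+ 2)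
  (fun J => cond_mean J ^+ 2 + ((- 2 * M) * cond_mean J + M ^+ 2))) => [|J _]; last by ring.
by rewrite !site_averageD site_averageZ site_average_cst -/M; ring.
Qed.

Lemma level_meanE l : Ex (fun J => (J l)%:R) = e l.
Proof.
have [/andP[l1 lm]|lm] := boolP (1 <= l < m.+1)%N; last first.
  have lm' : (l == 0%N) || (m < l)%N by lia.
  have -> : e l = 0.
    by case/orP: lm' => [/eqP->|/level_mean_top ->//]; rewrite level_mean0.
  rewrite -[RHS](site_average_cst m L); apply: eq_site_average => J [sJ _].
  by rewrite sJ.
pose c i : R := (i == l)%:R.
have linE J : lin m c J = (J l)%:R.
  rewrite /lin (@bigD1_nat _ _ _ _ _ l) ?l1 //= /c eqxx mul1r big1 ?addr0 //.
  by move=> i /negbTE ->; rewrite mul0r.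
rewrite (@eq_site_average _ _ _ _ (fun J => lin m c J)) => [|J _]; last by rewrite linE.
rewrite (site_average_lin _ _ _ id).
have -> : walk_average (site_step c) (site_labels L m) id
    = walk_mean (site_step c) (site_labels L m).
  rewrite -[RHS]add0r -(walk_centered_mean (site_step c) (site_labels L m)).
  rewrite -[X in _ + X](walk_average_cst (site_step c) (site_labels L m)) -walk_averageD.
  by apply: eq_walk_average => y; rewrite subrK.
rewrite /walk_mean sum_site_labels // /level_mean mulr_sumr.
rewrite (big_cat_nat (n := l)) //=; last exact: ltnW.
rewrite big_nat big1 ?add0r => [|k /andP[k1 kl]]; last first.
  rewrite (@step_mean_sites R m); last by lia.
  rewrite big1 ?mulr0 // => i _; rewrite /c; case: eqP => [->|]; last by rewrite mul0r.
  by rewrite leqNgt kl mul0r mulr0.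
rewrite big_nat [RHS]big_nat; apply: eq_bigr => k /andP[lk km].
rewrite (@step_mean_sites R m) // (@bigD1_nat _ _ _ _ _ l) ?l1 //= big1 ?addr0.
  by rewrite /c eqxx lk /=; ring.
by move=> i /negbTE il; rewrite /c il mul0r.
Qed.

Lemma level_mean_ge0 l : 0 <= e l.
Proof. by rewrite -level_meanE site_average_ge0. Qed.

Lemma level_mean_le l : e l <= a.
Proof.
rewrite -level_meanE -[leRHS](site_average_cst m L) ler_site_average // => J aJ.
by rewrite ler_nat admissible_le.
Qed.

Lemma average_dev l : Ex (fun J => dev J l) = 0.
Proof.
by rewrite site_averageB level_meanE site_average_cst; exact: subrr.
Qed.

Lemma walk_mean_sites c :
  walk_mean (site_step c) (site_labels L m) = \sum_(1 <= l < m.+1) c l * e l.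
Proof.
have -> : walk_mean (site_step c) (site_labels L m) = Ex (lin m c).
  rewrite (site_average_lin _ _ _ id).
  rewrite -[LHS]add0r -(walk_centered_mean (site_step c) (site_labels L m)).
  rewrite -[X in _ + X](walk_average_cst (site_step c) (site_labels L m)) -walk_averageD.
  by apply: eq_walk_average => y; rewrite subrK.
rewrite /lin site_average_sum; apply: eq_bigr => l _.
by rewrite site_averageZ level_meanE.
Qed.

Lemma sum_dev c J : \sum_(1 <= l < m.+1) c l * dev J l
  = lin m c J - walk_mean (site_step c) (site_labels L m).
Proof.
rewrite walk_mean_sites /lin -sumrB; apply: eq_bigr => l _.
by rewrite /dev mulrBr.
Qed.

(** Deviations of the levels are sums of independent centered contributions of the
    sites, so the variance is a sum over the sites. *)
Lemma variance_linear c :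
  Ex (fun J => (\sum_(1 <= l < m.+1) c l * dev J l) ^+ 2)
  = \sum_(1 <= k < m.+1) (L k)%:R * step_var (site_step c) k.
Proof.
rewrite -sum_site_labels // -walk_variance -site_average_lin.
by apply: eq_site_average => J _; rewrite sum_dev.
Qed.

Lemma sum_deltas (I : nat) (F : nat -> R) : (1 <= I <= m)%N ->
  \sum_(1 <= l < m.+1) (l == I)%:R * F l = F I.
Proof.
move=> lm; rewrite (@bigD1_nat _ _ _ 1 m.+1 I) //= eqxx mul1r big1 ?addr0 //.
by move=> i /negbTE ->; rewrite mul0r.
Qed.

(** Polarization of [variance_linear]. *)
Lemma average_dev2 i l : (1 <= i <= m)%N -> (1 <= l <= m)%N ->
  Ex (fun J => dev J i * dev J l) = \sum_(1 <= k < m.+1) (L k)%:R * level_cov R k i l.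
Proof.
move=> im lm.
pose c (p q : R) j : R := p * (j == i)%:R + q * (j == l)%:R.
have cE p q (F : nat -> R) : \sum_(1 <= j < m.+1) c p q j * F j = p * F i + q * F l.
  rewrite -(sum_deltas F im) -(sum_deltas F lm) !mulr_sumr -big_split /=.
  by apply: eq_bigr => j _; rewrite /c; ring.
have var p q : Ex (fun J => (p * dev J i + q * dev J l) ^+ 2)
    = \sum_(1 <= k < m.+1) (L k)%:R * (p ^+ 2 * level_cov R k i i
       + 2 * p * q * level_cov R k i l + q ^+ 2 * level_cov R k l l).
  rewrite (@eq_site_average _ _ _ _
    (fun J => (\sum_(1 <= j < m.+1) c p q j * dev J j) ^+ 2)) => [|J _]; last by rewrite cE.
  rewrite variance_linear big_nat [RHS]big_nat.
  apply: eq_bigr => k /andP[_ km]; congr (_ * _); rewrite (@step_var_sites R m k) //.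
  rewrite (eq_bigr (fun i' => c p q i' * (p * level_cov R k i' i + q * level_cov R k i' l))).
    by rewrite cE (level_covC _ k l i); ring.
  move=> i' _; rewrite -(cE p q (level_cov R k i')) mulr_sumr.
  by apply: eq_bigr => l' _; rewrite mulrA.
rewrite (@eq_site_average _ _ _ _ (fun J => 4^-1 * ((1 * dev J i + 1 * dev J l) ^+ 2
  - (1 * dev J i + -1 * dev J l) ^+ 2))) => [|J _]; last by field.
rewrite site_averageZ site_averageB !var -sumrB mulr_sumr.
by apply: eq_bigr => k _; field.
Qed.

Lemma average_cond_mean : Ex cond_mean = mean_at_mean + Ex quadratic_part.
Proof.
rewrite (@eq_site_average _ _ _ _
  (fun J => mean_at_mean + linear_part J + quadratic_part J)) => [|J [sJ _]]; last exact: cond_mean_expand.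
rewrite !site_averageD site_average_cst; congr (_ + _).
rewrite -[RHS]addr0; congr (_ + _); rewrite /linear_part site_average_sum big1 // => i _.
by rewrite site_averageZ average_dev mulr0.
Qed.

End EnergyExpansion.

(** * The variance up to lower order terms *)

Section Estimates.
Variables (R : realType) (m : nat) (L : nat -> nat).
Implicit Types (J : nat -> nat).

Hypothesis L0 : L 0 = 0%N.
Hypothesis count_gt0 : (0 < site_count m L)%N.

Local Notation Ex := (site_average m L).
Local Notation e := (level_mean R m L).
Local Notation a := ((site_count m L)%:R : R).
Local Notation D := (dev R m L).
Local Notation s := (Num.sqrt a).

Let s2 : s ^+ 2 = a. Proof. by rewrite sqr_sqrtr. Qed.
Let a_ge1 : 1 <= a. Proof. by rewrite ler1n. Qed.
Let s_ge1 : 1 <= s. Proof. by rewrite -[leLHS]sqrtr1 ler_sqrt. Qed.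
Let s_gt0 : 0 < s. Proof. exact: lt_le_trans s_ge1. Qed.

Lemma sqr_sum_le (n : nat) (x : nat -> R) :
  (\sum_(1 <= i < n.+1) x i) ^+ 2 <= n%:R * \sum_(1 <= i < n.+1) x i ^+ 2.
Proof.
elim: n => [|n IH]; first by rewrite !big_geq // expr0n mul0r.
rewrite !(big_nat_recr n.+1) //= -[n.+1%:R]natr1.
set S := \sum_(1 <= i < n.+1) x i; set Q := \sum_(1 <= i < n.+1) x i ^+ 2; set y := x _.
have IH' : S ^+ 2 <= n%:R * Q by [].
have [n0'|n0] := eqVneq n 0%N.
  have -> : S = 0 by rewrite /S n0' big_geq.
  have -> : Q = 0 by rewrite /Q n0' big_geq.
  by rewrite n0' !add0r mul1r.
have n_gt0 : 0 < n%:R :> R by rewrite ltr0n lt0n.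
move: IH' n_gt0; move: (n%:R : R) => k IH' k0.
have : 0 <= (S - k * y) ^+ 2 by exact: sqr_ge0.
have -> : (S - k * y) ^+ 2 = S ^+ 2 - k * (2 * S * y) + k * (k * y ^+ 2) by ring.
move=> H.
have : k * (2 * S * y) <= k * (Q + k * y ^+ 2) by lra.
rewrite ler_pM2l // => H2.
by rewrite sqrrD -mulr_natl; lra.
Qed.

Lemma dev_outside J l : admissible m L J -> ~~ (1 <= l <= m)%N -> D J l = 0.
Proof.
move=> [sJ _] lm; have lm' : (l == 0%N) || (m < l)%N by lia.
rewrite /dev sJ //; case/orP: lm' => [/eqP->|ml]; first by rewrite level_mean0 subrr.
by rewrite level_mean_top // subrr.
Qed.

(** Each level is a sum of independent indicators, one for each site, so its
    deviation has the order of the square root of the number of sites. *)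
Lemma average_dev_sqr_le l : Ex (fun J => D J l ^+ 2) <= a.
Proof.
have [lm|lm] := boolP (1 <= l <= m)%N; last first.
  rewrite (@eq_site_average _ _ _ _ (fun=> 0)) => [|J aJ]; last by rewrite dev_outside // expr0n.
  by rewrite site_average_cst.
rewrite (eq_site_average (g := fun J => D J l * D J l)) => [|J _]; last by rewrite expr2.
rewrite average_dev2 // /site_count natr_sum; apply: ler_sum => k _.
rewrite -[leRHS]mulr1; apply: ler_wpM2l => //.
rewrite /level_cov minnn maxnn.
have -> : l%:R / k.+1%:R - l%:R * l%:R / k.+1%:R ^+ 2
  = l%:R / k.+1%:R - (l%:R / k.+1%:R) ^+ 2 :> R by rewrite expr_div_n expr2.
move: (l%:R / k.+1%:R) => x; have := sqr_ge0 (x - 1 / 2).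
by case: (l <= k)%N; rewrite ?mul1r ?mul0r // => *; lra.
Qed.

Lemma average_dev_fourth_le l : Ex (fun J => D J l ^+ 4) <= 3 * a ^+ 2.
Proof.
have [lm|lm] := boolP (1 <= l <= m)%N; last first.
  rewrite (@eq_site_average _ _ _ _ (fun=> 0)) => [|J aJ]; last by rewrite dev_outside // expr0n.
  by rewrite site_average_cst mulr_ge0 // sqr_ge0.
pose c i : R := (i == l)%:R.
rewrite (eq_site_average (g := fun J =>
  (lin m c J - walk_mean (site_step c) (site_labels L m)) ^+ 4)) => [|J _]; last first.
  by rewrite -sum_dev // sum_deltas.
rewrite (site_average_lin m L c
  (fun y => (y - walk_mean (site_step c) (site_labels L m)) ^+ 4)).
apply: le_trans (walk_fourth_moment (A := 1) _) _; last first.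
  by rewrite (@size_site_labels R) // expr1n mulr1.
move=> k r /mem_site_labels km _.
by rewrite (@step_dev_sites R m) // (sum_deltas (fun l => level_dev R l k r)) // norm_level_dev_le.
Qed.

Lemma average_norm_dev_le l : Ex (fun J => `|D J l|) <= s.
Proof.
(* The mean inequality |x| <= x^2 / (2 s) + s / 2. *)
apply: le_trans (_ : Ex (fun J => (2 * s)^-1 * D J l ^+ 2 + s / 2) <= _).
  apply: ler_site_average => J _; rewrite -(real_normK (num_real (D J l))).
  move: `|D J l| => x; rewrite -subr_ge0.
  have -> : (2 * s)^-1 * x ^+ 2 + s / 2 - x = (2 * s)^-1 * (x - s) ^+ 2.
    by field; rewrite gt_eqF.
  by rewrite mulr_ge0 ?sqr_ge0 // invr_ge0 mulr_ge0 // ltW.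
rewrite site_averageD site_averageZ site_average_cst.
apply: le_trans (_ : (2 * s)^-1 * s ^+ 2 + s / 2 <= _).
  by rewrite s2 lerD2r ler_wpM2l ?average_dev_sqr_le // invr_ge0 mulr_ge0 // ltW.
by rewrite le_eqVlt; apply/orP; left; apply/eqP; field; rewrite gt_eqF.
Qed.

Lemma label_le i : (1 <= i <= m)%N -> (L i)%:R <= a.
Proof.
by move=> im; rewrite ler_nat /site_count (@bigD1_nat _ _ _ 1 m.+1 i) // leq_addr.
Qed.

Lemma below_le i : (i <= m.+1)%N -> below R L i <= a.
Proof.
move=> im; rewrite /below -natr_sum ler_nat /site_count.
have [i0|i0] := posnP i; first by rewrite i0 big_geq.
by rewrite [X in (_ <= X)%N](big_cat_nat (n := i)) //= leq_addr.
Qed.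

Lemma below_ge0 i : 0 <= below R L i.
Proof. by rewrite /below sumr_ge0. Qed.

Lemma norm_gradient_le i : (1 <= i <= m)%N -> `|gradient R m L i| <= 4 * a.
Proof.
move=> im; have /andP[_ im'] := im.
have := level_mean_ge0 R m L0 i; have := level_mean_le R m L0 i.
have := level_mean_ge0 R m L0 i.-1; have := level_mean_le R m L0 i.-1.
have := level_mean_ge0 R m L0 i.+1; have := level_mean_le R m L0 i.+1.
have := below_le (leqW im'); have := below_ge0 i; have := label_le im.
have : 0 <= (L i)%:R :> R by [].
rewrite /gradient => *; rewrite ger0_norm; lra.
Qed.

(** The conditional variance is a cubic polynomial in the levels, hence its
    fluctuations are smaller than its size by the factor s, the square root of the
    number of sites. *)
Lemma cond_var_dist_le : Ex (fun J => `|cond_var R m L J - var_at_mean R m L|)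
  <= 2 * m%:R * s ^+ 5.
Proof.
apply: le_trans (_ : Ex (fun J => \sum_(1 <= i < m.+1)
    (a ^+ 2 * `|D J i| + a ^+ 2 * `|D J i.+1|)) <= _); last first.
  rewrite site_average_sum.
  apply: le_trans (_ : \sum_(1 <= i < m.+1) (s ^+ 5 + s ^+ 5) <= _).
    have a2 : 0 <= a ^+ 2 by exact: sqr_ge0.
    apply: ler_sum => i _; rewrite site_averageD !site_averageZ.
    have -> : s ^+ 5 = a ^+ 2 * s by have := s2; move: s => x <-; ring.
    by rewrite lerD // ler_wpM2l // average_norm_dev_le.
  by rewrite sumr_const_nat subn1 /= -mulr_natl; lra.
apply: ler_site_average => J aJ; rewrite /cond_var /var_at_mean -sumrB.
apply: le_trans (ler_norm_sum _ _ _) _; rewrite big_nat [leRHS]big_nat.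
apply: ler_sum => i im; rewrite /qbinom_var natrD.
have x1 : (J i)%:R <= a by rewrite ler_nat admissible_le.
have y1 : (J i.+1)%:R <= a by rewrite ler_nat admissible_le.
have := label_le im; have := level_mean_ge0 R m L0 i; have := level_mean_le R m L0 i.
have := level_mean_ge0 R m L0 i.+1; have := level_mean_le R m L0 i.+1.
have : 0 <= (L i)%:R :> R by [].
have : 0 <= (J i)%:R :> R by [].
have : 0 <= (J i.+1)%:R :> R by [].
rewrite /dev; move: (J i)%:R (J i.+1)%:R (L i)%:R (e i) (e i.+1) x1 y1 => x y l x' y' x1 y1.
move=> y0 x0 l0 y'1 y'0 x'1 x'0 l1.
have -> : x * (l + y - x) * (l + y + 1) / 12 - x' * (l + y' - x') * (l + y' + 1) / 12
  = (x - x') * ((l + y - x) * (l + y + 1) - x' * (l + y + 1)) / 12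
    + (y - y') * (x' * (l + y + 1) + x' * (l + y' - x')) / 12 by ring.
have A1 := a_ge1.
move: a A1 x1 y1 x'1 y'1 l1 => b b1 x1 y1 x'1 y'1 l1.
apply: le_trans (ler_normD _ _) _; apply: lerD.
  rewrite -mulrA normrM mulrC; apply: ler_wpM2r => //.
  have P0 : 0 <= l + y + 1 by lra.
  have P3 : l + y + 1 <= 3 * b by lra.
  have u1 : `|l + y - x - x'| <= 3 * b by rewrite ler_norml; apply/andP; split; lra.
  have -> : ((l + y - x) * (l + y + 1) - x' * (l + y + 1)) / 12
     = (l + y - x - x') * (l + y + 1) / 12 by ring.
  rewrite normrM normrM (ger0_norm P0) [`|12^-1|]ger0_norm //.
  have := ler_pM (normr_ge0 _) P0 u1 P3; have := sqr_ge0 b; lra.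
rewrite -mulrA normrM mulrC; apply: ler_wpM2r => //.
have P0 : 0 <= x' by [].
have u1 : `|l + y + 1 + (l + y' - x')| <= 5 * b by rewrite ler_norml; apply/andP; split; lra.
have -> : (x' * (l + y + 1) + x' * (l + y' - x')) / 12
  = (l + y + 1 + (l + y' - x')) * x' / 12 by ring.
rewrite normrM normrM (ger0_norm P0) [`|12^-1|]ger0_norm //.
have := ler_pM (normr_ge0 _) P0 u1 x'1; have := sqr_ge0 b; lra.
Qed.

Lemma average_norm_quadratic_le :
  Ex (fun J => `|quadratic_part R m L J|) <= 2 * m%:R * a.
Proof.
apply: le_trans (_ : Ex (fun J => \sum_(1 <= i < m.+1) (D J i ^+ 2 + D J i.+1 ^+ 2)) <= _).
  apply: ler_site_average => J _; apply: le_trans (ler_norm_sum _ _ _) _.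
  apply: ler_sum => i _; rewrite ler_norml.
  have := sqr_ge0 (D J i - D J i.+1); have := sqr_ge0 (D J i + D J i.+1).
  have := sqr_ge0 (D J i); have := sqr_ge0 (D J i.+1).
  by move=> *; apply/andP; split; lra.
rewrite site_average_sum; apply: le_trans (_ : \sum_(1 <= i < m.+1) (a + a) <= _).
  by apply: ler_sum => i _; rewrite site_averageD lerD // average_dev_sqr_le.
by rewrite sumr_const_nat subn1 /= -mulr_natl; lra.
Qed.

Lemma average_quadratic_sqr_le :
  Ex (fun J => quadratic_part R m L J ^+ 2) <= 6 * m%:R ^+ 2 * a ^+ 2.
Proof.
apply: le_trans (_ : Ex (fun J => m%:R * \sum_(1 <= i < m.+1)
    (D J i ^+ 4 + D J i.+1 ^+ 4)) <= _).
  apply: ler_site_average => J _; apply: le_trans (sqr_sum_le _ _) _.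
  apply: ler_wpM2l => //; apply: ler_sum => i _.
  move: (D J i) (D J i.+1) => x y.
  have := sqr_ge0 (x ^+ 2 - y ^+ 2); have := sqr_ge0 (x * (x - y)).
  have := sqr_ge0 (x ^+ 2); have := sqr_ge0 (y ^+ 2).
  by move=> *; lra.
rewrite site_averageZ site_average_sum.
apply: le_trans (_ : m%:R * \sum_(1 <= i < m.+1) (3 * a ^+ 2 + 3 * a ^+ 2) <= _).
  apply: ler_wpM2l => //; apply: ler_sum => i _.
  by rewrite site_averageD lerD // average_dev_fourth_le.
by rewrite sumr_const_nat subn1 /= -[_ *+ m]mulr_natl; lra.
Qed.

Definition linear_var : R := Ex (fun J => linear_part R m L J ^+ 2).

Lemma linear_var_le : linear_var <= 16 * m%:R ^+ 2 * s ^+ 6.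
Proof.
apply: le_trans (_ : Ex (fun J => m%:R * \sum_(1 <= i < m.+1)
    (16 * a ^+ 2) * D J i ^+ 2) <= _).
  apply: ler_site_average => J _; apply: le_trans (sqr_sum_le _ _) _.
  apply: ler_wpM2l => //; rewrite big_nat [leRHS]big_nat; apply: ler_sum => i im.
  rewrite exprMn ler_wpM2r ?sqr_ge0 // -(real_normK (num_real (gradient _ _ _ _))).
  rewrite (_ : 16 * a ^+ 2 = (4 * a) ^+ 2); last by ring.
  by rewrite lerXn2r ?nnegrE ?norm_gradient_le ?mulr_ge0.
rewrite site_averageZ site_average_sum.
apply: le_trans (_ : m%:R * \sum_(1 <= i < m.+1) (16 * a ^+ 2 * a) <= _).
  apply: ler_wpM2l => //; apply: ler_sum => i _.
  by rewrite site_averageZ ler_wpM2l ?average_dev_sqr_le // mulr_ge0 // sqr_ge0.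
rewrite sumr_const_nat subn1 /= -[_ *+ m]mulr_natl.
rewrite le_eqVlt; apply/orP; left; apply/eqP.
by have := s2; move: s => x <-; ring.
Qed.

Definition total_var : R := Ex (cond_var R m L)
  + Ex (fun J => (cond_mean R m L J - Ex (cond_mean R m L)) ^+ 2).

Lemma cond_mean_centered J : admissible m L J ->
  cond_mean R m L J - Ex (cond_mean R m L)
  = linear_part R m L J + (quadratic_part R m L J - Ex (quadratic_part R m L)).
Proof.
by move=> [sJ _]; rewrite cond_mean_expand // average_cond_mean //; ring.
Qed.

(** The variance of the mixture has size s^6.  Replacing the conditional variance
    by its value at the mean levels and dropping the quadratic part of the
    conditional mean, which has size s^2 against s^3 for the linear part, both
    cost at most a multiple of s^5. *)
Lemma total_var_estimate :
  `|total_var - (linear_var + var_at_mean R m L)| <= 30 * m%:R ^+ 2 * s ^+ 5.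
Proof.
set Q := Ex (quadratic_part R m L).
pose w J := quadratic_part R m L J - Q.
have w2 : Ex (fun J => w J ^+ 2) <= 6 * m%:R ^+ 2 * a ^+ 2.
  apply: le_trans average_quadratic_sqr_le.
  rewrite (eq_site_average (g := fun J => quadratic_part R m L J ^+ 2
    + ((- 2 * Q) * quadratic_part R m L J + Q ^+ 2))) => [|J _]; last by rewrite /w; ring.
  rewrite !site_averageD site_averageZ site_average_cst -/Q.
  by have := sqr_ge0 Q; lra.
have -> : total_var - (linear_var + var_at_mean R m L)
  = Ex (fun J => cond_var R m L J - var_at_mean R m L)
    + Ex (fun J => 2 * linear_part R m L J * w J + w J ^+ 2).
  rewrite site_averageB site_average_cst /total_var.
  rewrite (eq_site_average (f := fun J => (cond_mean R m L J - _) ^+ 2)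
    (g := fun J => linear_part R m L J ^+ 2
       + (2 * linear_part R m L J * w J + w J ^+ 2))) => [|J aJ]; last first.
    by rewrite cond_mean_centered // -/Q -/(w J); ring.
  by rewrite site_averageD /linear_var; ring.
have m_m2 : m%:R <= m%:R ^+ 2 :> R by rewrite -natrX ler_nat; case: (m) => // n; lia.
have s5 : 0 <= s ^+ 5 by rewrite exprn_ge0 // ltW.
apply: le_trans (ler_normD _ _) _.
have V := le_trans (norm_site_average m L _) cond_var_dist_le.
suff W : `|Ex (fun J => 2 * linear_part R m L J * w J + w J ^+ 2)| <= 28 * m%:R ^+ 2 * s ^+ 5.
  have := ler_wpM2r s5 m_m2; lra.
apply: le_trans (norm_site_average m L _) _.
(* The mean inequality with weight s balances the factors, of sizes s^3 and s^2. *)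
apply: le_trans (_ : Ex (fun J => s^-1 * linear_part R m L J ^+ 2 + (s + 1) * w J ^+ 2) <= _).
  apply: ler_site_average => J _; move: (linear_part R m L J) (w J) => x y.
  have H (z : R) : 2 * x * z <= s^-1 * x ^+ 2 + s * z ^+ 2.
    rewrite -subr_ge0 (_ : _ - _ = s^-1 * (x - s * z) ^+ 2).
      by rewrite mulr_ge0 ?sqr_ge0 // invr_ge0 ltW.
    by field; rewrite gt_eqF.
  have := H y; have := H (- y); rewrite sqrrN ler_norml; have := sqr_ge0 y.
  by move=> *; apply/andP; split; lra.
rewrite site_averageD !site_averageZ -/linear_var.
have H1 : s^-1 * linear_var <= 16 * m%:R ^+ 2 * s ^+ 5.
  rewrite mulrC ler_pdivrMr //; apply: le_trans linear_var_le _.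
  by rewrite le_eqVlt; apply/orP; left; apply/eqP; move: s => x; ring.
have H2 : (s + 1) * Ex (fun J => w J ^+ 2) <= (s + s) * (6 * m%:R ^+ 2 * a ^+ 2).
  apply: ler_pM => //; last by rewrite lerD2l.
  by apply: site_average_ge0 => J _; exact: sqr_ge0.
have H3 : (s + s) * (6 * m%:R ^+ 2 * a ^+ 2) = 12 * m%:R ^+ 2 * s ^+ 5.
  by have := s2; move: s => x <-; ring.
lra.
Qed.

End Estimates.

(** * The characteristic function up to lower order terms *)

Section CharEstimate.
Variables (R : realType) (m : nat) (L : nat -> nat).
Implicit Types (J : nat -> nat).
Local Open Scope complex_scope.

Hypothesis L0 : L 0 = 0%N.

Local Notation Ex := (site_average m L).
Local Notation a := ((site_count m L)%:R : R).
Local Notation s := (Num.sqrt a).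
Local Notation gauss x := ((expR (- x))%:C).

(** Characteristic function of the exponent given the levels, after centering. *)
Definition level_char (t : R) J : R[i] :=
  \prod_(1 <= i < m.+1) qbinom_char t (L i + J i.+1) (J i).

Lemma char_eval_term t J : admissible m L J ->
  char_eval t (supernomial_term R m L J)
  = (weight m L J)%:R * (cis (t * cond_mean R m L J) * level_char t J).
Proof.
move=> aJ; rewrite /supernomial_term char_evalM char_evalXn char_eval_prod.
have -> : t * cond_mean R m L J = t * (energy m L J)%:R
    + \sum_(1 <= i < m.+1) t * qbinom_mean R (L i + J i.+1) (J i).
  rewrite /cond_mean big_split /= mulrDr -[in RHS]mulr_sumr; congr (t * _ + _).
  by rewrite natr_sum; apply: eq_bigr => i _; rewrite natrM natrD natr_sum.
rewrite cisD cis_sum -mulrA mulrCA; congr (_ * _).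
rewrite /level_char /weight natr_prod -!big_split /= big_nat [RHS]big_nat.
apply: eq_bigr => i im; have [_ aJi] := aJ.
have C0 : 'C(L i + J i.+1, J i)%:R != 0 :> R[i] by rewrite pnatr_eq0 -lt0n bin_gt0 aJi.
rewrite /qbinom_char; set x := t * _.
have x1 : cis x * cis (- x) = 1 by rewrite -cisD subrr cis0.
transitivity (cis x * cis (- x) * char_eval t (qbinom R (L i + J i.+1) (J i))
  * ('C(L i + J i.+1, J i)%:R / 'C(L i + J i.+1, J i)%:R)); last by ring.
by rewrite x1 mul1r divff // mulr1.
Qed.

Lemma char_eval_specialization t (G : {poly R}) :
  G = box_sum m (site_count m L) (supernomial_term R m L) ->
  char_eval t G = (config_count m L)%:R
    * Ex (fun J => cis (t * cond_mean R m L J) * level_char t J).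
Proof.
move=> ->; rewrite /site_average mulVKf; last by rewrite pnatr_eq0 -lt0n config_count_gt0.
rewrite /box_sum char_eval_sum; apply: eq_bigr => j _.
set J := at1 _; have sJ : supported m J by exact: supported_at1.
have [aJ|aJ] := pselect (admissible m L J); first by rewrite char_eval_term // mulr_natl.
by rewrite supernomial_term_eq0 // weight_eq0 // mulr0n /char_eval rmorph0 horner0.
Qed.

Hypothesis count_gt0 : (0 < site_count m L)%N.

Let s2 : s ^+ 2 = a. Proof. by rewrite sqr_sqrtr. Qed.
Let s_gt0 : 0 < s. Proof. by rewrite sqrtr_gt0 ltr0n. Qed.

Lemma gauss_dist_le (x y : R) : 0 <= x -> 0 <= y ->
  normc (gauss x - gauss y) <= `|x - y|.
Proof. by move=> x0 y0; rewrite -rmorphB normc_real expRN_lipschitz. Qed.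

Lemma normc_gauss_le1 (x : R) : 0 <= x -> normc (gauss x) <= 1.
Proof. by move=> x0; rewrite normc_real ger0_norm ?expR_ge0 // expR_le1 oppr_le0. Qed.

Lemma cond_var_ge0 J : admissible m L J -> 0 <= cond_var R m L J.
Proof.
move=> [_ aJ]; rewrite /cond_var big_nat; apply: sumr_ge0 => i im.
rewrite /qbinom_var; have : (J i)%:R <= (L i + J i.+1)%:R :> R by rewrite ler_nat aJ.
move=> H; have : 0 <= (J i)%:R :> R by [].
move=> x0; apply: divr_ge0 => //; apply: mulr_ge0; last by rewrite addr_ge0.
by apply: mulr_ge0 => //; rewrite subr_ge0.
Qed.

Lemma var_at_mean_ge0 : 0 <= var_at_mean R m L.
Proof.
rewrite /var_at_mean big_nat; apply: sumr_ge0 => i im.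
have e0 l := level_mean_ge0 R m L0 l.
apply: divr_ge0 => //; apply: mulr_ge0; last by rewrite !addr_ge0.
apply: mulr_ge0 => //.
rewrite -!level_meanE // -[X in X + _ - _](site_average_cst m L) -site_averageD -site_averageB.
apply: site_average_ge0 => J [_ aJ].
by rewrite subr_ge0 -natrD ler_nat aJ.
Qed.

Lemma linear_var_ge0 : 0 <= linear_var R m L.
Proof. by apply: site_average_ge0 => J _; exact: sqr_ge0. Qed.

Lemma total_var_ge0 : 0 <= total_var R m L.
Proof.
apply: addr_ge0; first by apply: site_average_ge0 => J; exact: cond_var_ge0.
by apply: site_average_ge0 => J _; exact: sqr_ge0.
Qed.

Lemma linear_varE : linear_var R m L
  = \sum_(k <- site_labels L m) step_var (site_step (gradient R m L)) k.
Proof. by rewrite sum_site_labels // -variance_linear. Qed.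

Let half_var (t v : R) : 0 <= v -> 0 <= t ^+ 2 * v / 2.
Proof. by move=> v0; rewrite divr_ge0 // mulr_ge0 // sqr_ge0. Qed.

(** A product of Gaussian binomials, each of which is nearly Gaussian. *)
Lemma level_char_gaussian t J : admissible m L J ->
  normc (level_char t J - gauss (t ^+ 2 * cond_var R m L J / 2))
  <= m%:R * (3 * (2 * a) * ((`|t| * (2 * a)) ^+ 3 + 2 * (`|t| * (2 * a)) ^+ 4)
             * expR (t ^+ 2 * (2 * a) ^+ 3)).
Proof.
move=> aJ; have [_ bJ] := aJ.
have -> : gauss (t ^+ 2 * cond_var R m L J / 2) = \prod_(1 <= i < m.+1 | (1 <= i < m.+1)%N)
    gauss (t ^+ 2 * qbinom_var R (L i + J i.+1) (J i) / 2).
  rewrite /cond_var mulr_sumr mulr_suml -sumrN expR_sum -big_nat.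
  exact: (rmorph_prod (real_complex R)).
have qv0 i : (1 <= i < m.+1)%N -> 0 <= qbinom_var R (L i + J i.+1) (J i).
  move=> im; rewrite /qbinom_var.
  have : (J i)%:R <= (L i + J i.+1)%:R :> R by rewrite ler_nat bJ.
  move=> H; apply: divr_ge0 => //; apply: mulr_ge0; last by rewrite addr_ge0.
  by apply: mulr_ge0 => //; rewrite subr_ge0.
rewrite /level_char big_nat.
apply: le_trans (@normc_prod_dist R _ _ _ _ _ _ _) _.
- by move=> i im; apply: normc_qbinom_char_le; apply: bJ.
- by move=> i im; apply: normc_gauss_le1; apply: half_var; apply: qv0.
apply: le_trans (_ : \sum_(1 <= i < m.+1) (3 * (2 * a) * ((`|t| * (2 * a)) ^+ 3
  + 2 * (`|t| * (2 * a)) ^+ 4) * expR (t ^+ 2 * (2 * a) ^+ 3)) <= _); last first.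
  by rewrite sumr_const_nat subn1 /= [leRHS]mulr_natl.
rewrite [leRHS]big_nat; apply: ler_sum => i im.
apply: qbinom_char_gaussian; first exact: bJ.
rewrite natrD (_ : 2 * a = a + a); last by ring.
by rewrite lerD ?label_le // ler_nat admissible_le.
Qed.

(** The linear part of the conditional mean is a sum of independent bounded
    contributions, one for each site. *)
Lemma linear_part_gaussian t :
  normc (Ex (fun J => cis (t * linear_part R m L J))
         - gauss (t ^+ 2 * linear_var R m L / 2))
  <= a * ((`|t| * (4 * m%:R * a)) ^+ 3 + 2 * (`|t| * (4 * m%:R * a)) ^+ 4).
Proof.
set g := gradient R m L.
rewrite (eq_site_average (g := fun J => cis (t * (lin m g J
  - walk_mean (site_step g) (site_labels L m))))) => [|J _]; last by rewrite -sum_dev.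
rewrite (site_average_lin m L g
  (fun y => cis (t * (y - walk_mean (site_step g) (site_labels L m))))) linear_varE.
rewrite -{1}(size_site_labels R m L0).
apply: walk_char_gaussian => k r /mem_site_labels km _.
rewrite (@step_dev_sites R m) //; apply: le_trans (ler_norm_sum _ _ _) _.
apply: le_trans (_ : \sum_(1 <= l < m.+1) (4 * a) <= _); last first.
  by rewrite sumr_const_nat subn1 /= -mulr_natl; lra.
rewrite big_nat [leRHS]big_nat; apply: ler_sum => l lm; rewrite normrM -[leRHS]mulr1.
by apply: ler_pM => //; [exact: norm_gradient_le|exact: norm_level_dev_le].
Qed.

(** The five terms of the bound come from: replacing the Gaussian binomials by
    Gaussians, freezing the conditional variance at the mean, linearizing the
    conditional mean, the central limit theorem for the linear part, and the
    comparison of the variances. *)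
Lemma char_estimate t :
  normc (Ex (fun J => cis (t * (cond_mean R m L J - Ex (cond_mean R m L)))
                      * level_char t J)
         - gauss (t ^+ 2 * total_var R m L / 2))
  <= m%:R * (3 * (2 * a) * ((`|t| * (2 * a)) ^+ 3 + 2 * (`|t| * (2 * a)) ^+ 4)
             * expR (t ^+ 2 * (2 * a) ^+ 3))
     + t ^+ 2 * m%:R * s ^+ 5 + 8 * `|t| * m%:R * a
     + a * ((`|t| * (4 * m%:R * a)) ^+ 3 + 2 * (`|t| * (4 * m%:R * a)) ^+ 4)
     + 15 * t ^+ 2 * m%:R ^+ 2 * s ^+ 5.
Proof.
set M := Ex (cond_mean R m L); set Ve := var_at_mean R m L.
have Ve0 : 0 <= Ve := var_at_mean_ge0.
have lv0 := linear_var_ge0; have tv0 := total_var_ge0.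
pose c J := cis (t * (cond_mean R m L J - M)).
(* The intermediate quantities, one replacement at a time. *)
pose Z1 := Ex (fun J => c J * gauss (t ^+ 2 * cond_var R m L J / 2)).
pose Z2 := Ex (fun J => c J * gauss (t ^+ 2 * Ve / 2)).
pose Z3 := Ex (fun J => cis (t * linear_part R m L J)) * gauss (t ^+ 2 * Ve / 2).
pose Z4 := gauss (t ^+ 2 * linear_var R m L / 2) * gauss (t ^+ 2 * Ve / 2).
apply: le_trans (normc_distD _ Z4 _) _; apply: lerD; last first.
  rewrite /Z4 -rmorphM -expRD -opprD; apply: le_trans (gauss_dist_le _ _) _.
  - by rewrite addr_ge0 // half_var.
  - by rewrite half_var.
  have -> : t ^+ 2 * linear_var R m L / 2 + t ^+ 2 * Ve / 2 - t ^+ 2 * total_var R m L / 2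
    = - (t ^+ 2 / 2 * (total_var R m L - (linear_var R m L + Ve))) by field.
  rewrite normrN normrM ger0_norm; last by rewrite divr_ge0 ?sqr_ge0.
  have t20 : 0 <= t ^+ 2 / 2 by rewrite divr_ge0 ?sqr_ge0.
  have := ler_wpM2l t20 (total_var_estimate R L0 count_gt0); rewrite -/Ve; lra.
apply: le_trans (normc_distD _ Z3 _) _; apply: lerD; last first.
  rewrite /Z3 /Z4 -mulrBl normcM -[leRHS]mulr1; apply: ler_pM; rewrite ?normc_ge0 //.
    exact: linear_part_gaussian.
  by rewrite normc_gauss_le1 // half_var.
apply: le_trans (normc_distD _ Z2 _) _; apply: lerD; last first.
  rewrite /Z2 /Z3 site_averageZr -mulrBl normcM -[leRHS]mulr1.
  apply: ler_pM; rewrite ?normc_ge0 //; last by rewrite normc_gauss_le1 // half_var.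
  rewrite -site_averageB; apply: le_trans (normc_site_average _ _ _) _.
  set Q := quadratic_part R m L.
  apply: le_trans (_ : Ex (fun J => (2 * `|t|) * (`|Q J| + `|Ex Q|)) <= _).
    apply: ler_site_average => J aJ; apply: le_trans (cis_lipschitz _ _) _.
    rewrite cond_mean_centered // -mulrBr normrM mulrA; apply: ler_wpM2l; first by rewrite mulr_ge0.
    rewrite (_ : _ - _ = Q J - Ex Q); last by rewrite /Q; ring.
    exact: ler_normB.
  rewrite site_averageZ site_averageD site_average_cst.
  have H := average_norm_quadratic_le R L0 count_gt0.
  have H' : `|Ex Q| <= 2 * m%:R * a := le_trans (norm_site_average m L Q) H.
  have t0 : 0 <= 2 * `|t| by rewrite mulr_ge0.
  have := ler_wpM2l t0 (lerD H H'); lra.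
apply: le_trans (normc_distD _ Z1 _) _; apply: lerD.
  rewrite /Z1 -site_averageB; apply: le_trans (normc_site_average _ _ _) _.
  rewrite -[leRHS](site_average_cst m L); apply: ler_site_average => J aJ.
  by rewrite -mulrBr normcM normc_cis mul1r level_char_gaussian.
rewrite /Z1 /Z2 -site_averageB; apply: le_trans (normc_site_average _ _ _) _.
apply: le_trans (_ : Ex (fun J => t ^+ 2 / 2 * `|cond_var R m L J - Ve|) <= _).
  apply: ler_site_average => J aJ; rewrite -mulrBr normcM normc_cis mul1r.
  apply: le_trans (gauss_dist_le _ _) _; rewrite ?half_var ?cond_var_ge0 //.
  rewrite -mulrBl -mulrBr normrM normrM ger0_norm ?sqr_ge0 // [`|2^-1|]ger0_norm //.
  lra.
rewrite site_averageZ.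
have t20 : 0 <= t ^+ 2 / 2 by rewrite divr_ge0 ?sqr_ge0.
have := ler_wpM2l t20 (cond_var_dist_le R L0 count_gt0); rewrite -/Ve; lra.
Qed.

Definition char_const (tau : R) : R :=
  6 * m%:R * (8 * tau ^+ 3 + 32 * tau ^+ 4) * expR (8 * tau ^+ 2)
  + m%:R * tau ^+ 2 + 8 * m%:R * tau + 64 * m%:R ^+ 3 * tau ^+ 3
  + 512 * m%:R ^+ 4 * tau ^+ 4 + 15 * m%:R ^+ 2 * tau ^+ 2.

(** Every term of [char_estimate] is of order 1 / s once t is of order s^-3, the
    order of the inverse of the standard deviation. *)
Lemma char_estimate_scaled t tau : `|t| * s ^+ 3 <= tau ->
  normc (Ex (fun J => cis (t * (cond_mean R m L J - Ex (cond_mean R m L)))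
                      * level_char t J)
         - gauss (t ^+ 2 * total_var R m L / 2)) <= char_const tau / s.
Proof.
move=> tau_ge; apply: le_trans (char_estimate t) _.
rewrite -[t ^+ 2](real_normK (num_real t)) -s2.
have s1 : 1 <= s by rewrite -[leLHS]sqrtr1 ler_sqrt // ler1n.
have sqrt_s2 : Num.sqrt (s ^+ 2) = s by rewrite s2.
rewrite sqrt_s2; move: s1 s_gt0 tau_ge; move: s => x x1 x0 tau_ge.
set u := `|t| * x ^+ 3 in tau_ge.
have u0 : 0 <= u by rewrite mulr_ge0 // exprn_ge0 // ltW.
have tu : `|t| = u / x ^+ 3 by rewrite /u mulfK // expf_neq0 // gt_eqF.
rewrite tu.
have i0 : 0 <= x^-1 by rewrite invr_ge0 ltW.
have i1 : x^-1 <= 1 by rewrite invf_le1.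
have uk n : u ^+ n <= tau ^+ n by rewrite lerXn2r // nnegrE // (le_trans u0).
have uk0 n : 0 <= u ^+ n by rewrite exprn_ge0.
have tk0 n : 0 <= tau ^+ n by rewrite exprn_ge0 // (le_trans u0).
have m0 : 0 <= m%:R :> R by [].
have n0 n : 0 <= m%:R ^+ n :> R by rewrite exprn_ge0.
have x_neq0 : x != 0 by rewrite gt_eqF.
have -> : (u / x ^+ 3) ^+ 2 * (2 * x ^+ 2) ^+ 3 = 8 * u ^+ 2 by field.
have -> : m%:R * (3 * (2 * x ^+ 2) * ((u / x ^+ 3 * (2 * x ^+ 2)) ^+ 3
    + 2 * (u / x ^+ 3 * (2 * x ^+ 2)) ^+ 4) * expR (8 * u ^+ 2))
  = (6 * m%:R * (8 * u ^+ 3 + 32 * u ^+ 4 * x^-1) * expR (8 * u ^+ 2)) * x^-1 by field.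
have -> : (u / x ^+ 3) ^+ 2 * m%:R * x ^+ 5 = m%:R * u ^+ 2 * x^-1 by field.
have -> : 8 * (u / x ^+ 3) * m%:R * x ^+ 2 = 8 * m%:R * u * x^-1 by field.
have -> : x ^+ 2 * ((u / x ^+ 3 * (4 * m%:R * x ^+ 2)) ^+ 3
    + 2 * (u / x ^+ 3 * (4 * m%:R * x ^+ 2)) ^+ 4)
  = (64 * m%:R ^+ 3 * u ^+ 3 + 512 * m%:R ^+ 4 * u ^+ 4 * x^-1) * x^-1 by field.
have -> : 15 * (u / x ^+ 3) ^+ 2 * m%:R ^+ 2 * x ^+ 5 = 15 * m%:R ^+ 2 * u ^+ 2 * x^-1 by field.
rewrite -!mulrDl; apply: ler_wpM2r => //; rewrite /char_const -!addrA.
have u4 : u ^+ 4 * x^-1 <= tau ^+ 4.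
  by rewrite -[leRHS]mulr1 ler_pM.
apply: lerD.
  apply: ler_pM; rewrite ?expR_ge0 //.
  - apply: mulr_ge0; first by rewrite mulr_ge0.
    apply: addr_ge0; first exact: mulr_ge0.
    by rewrite -mulrA; apply: mulr_ge0 => //; exact: mulr_ge0.
  - apply: ler_wpM2l; first by rewrite mulr_ge0.
    by apply: lerD; [exact: ler_wpM2l|rewrite -mulrA; exact: ler_wpM2l].
  - by rewrite ler_expR; apply: ler_wpM2l.
apply: lerD; first exact: ler_wpM2l.
apply: lerD; first by apply: ler_wpM2l => //; rewrite mulr_ge0.
apply: lerD; first by apply: ler_wpM2l => //; rewrite mulr_ge0.
apply: lerD.
  by rewrite -mulrA; apply: ler_wpM2l u4; exact: (mulr_ge0 (ler0n R 512) (n0 4%N)).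
by apply: ler_wpM2l => //; rewrite mulr_ge0.
Qed.

End CharEstimate.

(** * Laws determined by their generating function *)

Section NatLaw.
Context (d : measure_display) (T : measurableType d) (R : realType).
Variables (P : probability T R) (X : {RV P >-> nat}).
Implicit Types (h : nat -> R) (N : nat).

Definition mass_at (i : nat) : R := fine (P (X @^-1` [set i])).

Lemma measurable_nat_comp h : measurable_fun [set: T] (fun w => h (X w)).
Proof. by apply: (measurableT_comp (f := h)) => //; move=> _ B _. Qed.

Let measurable_at i : measurable (X @^-1` [set i]).
Proof. by rewrite -[X in measurable X]setTI; exact: (measurable_funPT X). Qed.

Let mass_atE i : P (X @^-1` [set i]) = (mass_at i)%:E.
Proof. by rewrite /mass_at fineK // fin_num_measure. Qed.

Lemma expectation_step h N :
  'E_P[fun w => (\sum_(i < N) h i * \1_(X @^-1` [set (i : nat)]) w)%R]%E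
  = (\sum_(i < N) h i * mass_at i)%:E.
Proof.
have intI i : P.-integrable [set: T] (fun w => (h i * \1_(X @^-1` [set i]) w)%:E).
  apply: measurable_bounded_integrable => //.
  - by rewrite fin_num_fun_lty //; exact: fin_num_measure.
  - by apply: measurable_funM => //; exact: measurable_indic.
  exists `|h i|; split; first exact: num_real.
  move=> x hx w _ /=; apply: le_trans (ltW hx); rewrite normrM indicE.
  by case: (_ \in _); rewrite ?normr1 ?normr0 ?mulr1 ?mulr0.
rewrite unlock; under eq_integral do rewrite -sumEFin.
rewrite integral_sum // -sumEFin; apply: eq_bigr => i _.
under eq_integral do rewrite EFinM.
have ind : P.-integrable [set: T] (EFin \o (\1_(X @^-1` [set (i : nat)]) : T -> R)).
  apply: measurable_bounded_integrable => //.
  - by rewrite fin_num_fun_lty //; exact: fin_num_measure.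
  exists 1; split; first exact: num_real.
  move=> x hx w _ /=; apply: le_trans (ltW hx); rewrite indicE.
  by case: (_ \in _); rewrite ?normr1 ?normr0.
rewrite integralZl //.
by rewrite integral_indic // setIT EFinM; congr (_ * _)%E; exact: mass_atE.
Qed.

Lemma step_sumE h N w :
  \sum_(i < N) h i * \1_(X @^-1` [set (i : nat)]) w = if (X w < N)%N then h (X w) else 0.
Proof.
have E i : \1_(X @^-1` [set i]) w = (X w == i)%:R :> R.
  rewrite indicE (_ : (w \in _) = (X w == i)) //.
  by apply/idP/eqP; rewrite inE.
case: ifP => XN.
  rewrite (bigD1 (Ordinal XN)) //= E eqxx mulr1 big1 ?addr0 // => i /negbTE iX.
  by rewrite E eq_sym -[X in _ == X]/(val (Ordinal XN)) val_eqE iX mulr0.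
rewrite big1 // => i _; rewrite E (_ : X w == i = false) ?mulr0 //.
by apply/eqP => Xi; move: XN; rewrite Xi ltn_ord.
Qed.

Lemma sum_mass_lt N : P [set w | (X w < N)%N] = (\sum_(i < N) mass_at i)%:E.
Proof.
have mA : measurable [set w | (X w < N)%N].
  rewrite (_ : [set w | _] = X @^-1` [set k | (k < N)%N]) //.
  by rewrite -[X in measurable X]setTI; exact: (measurable_funPT X).
rewrite -expectation_indic //.
have -> : \sum_(i < N) mass_at i = \sum_(i < N) 1 * mass_at i.
  by apply: eq_bigr => i _; rewrite mul1r.
rewrite -(expectation_step (fun=> 1)); congr ('E_P[_])%E.
apply/funext => w; apply: etrans (esym (step_sumE (fun=> 1) N w)).
rewrite indicE; case: ifP => XN; first by rewrite mem_set.
by rewrite memNset //= XN.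
Qed.

(** Almost surely X < N, so that h (X) agrees almost everywhere with a step
    function. *)
Lemma expectation_nat h N : \sum_(i < N) mass_at i = 1 ->
  'E_P[fun w => h (X w)]%E = (\sum_(i < N) h i * mass_at i)%:E.
Proof.
move=> S1; rewrite -expectation_step unlock; apply: ae_eq_integral => //.
- by apply/measurable_EFinP; exact: measurable_nat_comp.
- apply/measurable_EFinP.
  rewrite (_ : (fun w => _) = (fun w => if (X w < N)%N then h (X w) else 0)).
    exact: (measurable_nat_comp (fun k => if (k < N)%N then h k else 0)).
  by apply/funext => w; rewrite step_sumE.
exists (~` [set w | (X w < N)%N]); split.
- apply: measurableC; rewrite (_ : [set w | _] = X @^-1` [set k | (k < N)%N]) //.
  by rewrite -[X in measurable X]setTI; exact: (measurable_funPT X).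
- apply: etrans (probability_setC P _) _; last by rewrite sum_mass_lt S1 subee.
  rewrite (_ : [set w | _] = X @^-1` [set k | (k < N)%N]) //.
  by rewrite -[X in measurable X]setTI; exact: (measurable_funPT X).
move=> w /= H XN; apply: H => _; congr EFin; rewrite step_sumE; by rewrite XN.
Qed.

(** The coefficients are recovered one at a time: once those below n are known,
    dividing by q^n and letting q tend to 0 isolates the n-th one. *)
Lemma mass_of_pgf (G : {poly R}) : 0 < G.[1] ->
  has_pgf X (fun q => G.[q] / G.[1]) -> forall n, mass_at n = G`_n / G.[1].
Proof.
move=> G1 pgf; pose b i := G`_i / G.[1].
have squeeze N (q : R) : 0 <= q <= 1 ->
    `|G.[q] / G.[1] - \sum_(i < N) q ^+ i * mass_at i| <= q ^+ N.
  move=> q01; have /andP[q0 q1] := q01.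
  have mq : measurable_fun [set: T] (fun w => q ^+ X w) := measurable_nat_comp (fun k => q ^+ k).
  have mlow : measurable_fun [set: T]
      (fun w => \sum_(i < N) q ^+ i * \1_(X @^-1` [set (i : nat)]) w).
    rewrite (_ : (fun w => _) = (fun w => if (X w < N)%N then q ^+ X w else 0)).
      exact: (measurable_nat_comp (fun k => if (k < N)%N then q ^+ k else 0)).
    by apply/funext => w; rewrite (step_sumE (fun k => q ^+ k)).
  have low : \sum_(i < N) q ^+ i * mass_at i <= G.[q] / G.[1].
    rewrite -lee_fin -(pgf q q01) -(expectation_step (fun i => q ^+ i)).
    apply: expectation_le => //.
    - by move=> w; rewrite (step_sumE (fun k => q ^+ k)); case: ifP => // _; rewrite exprn_ge0.
    - by move=> w; rewrite exprn_ge0.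
    - apply: aeW => w; rewrite (step_sumE (fun k => q ^+ k)); case: ifP => // _.
      by rewrite exprn_ge0.
  have up : G.[q] / G.[1] <= \sum_(i < N) q ^+ i * mass_at i + q ^+ N.
    pose S w := \sum_(i < N) q ^+ i * \1_(X @^-1` [set (i : nat)]) w.
    have S0 w : 0 <= S w.
      by rewrite /S (step_sumE (fun k => q ^+ k)); case: ifP => // _; rewrite exprn_ge0.
    have ES : 'E_P[fun w => (S w + q ^+ N)%R]%E
        = (\sum_(i < N) q ^+ i * mass_at i + q ^+ N)%:E.
      rewrite unlock; under eq_integral do rewrite EFinD.
      rewrite ge0_integralD //.
      - rewrite EFinD -(expectation_step (fun i => q ^+ i)) unlock.
        by congr (_ + _)%E; rewrite integral_cst //= probability_setT mule1.
      - by move=> w _; rewrite lee_fin.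
      - exact/measurable_EFinP.
      - by move=> w _; rewrite lee_fin exprn_ge0.
    rewrite -lee_fin -(pgf q q01) -ES; apply: expectation_le => //.
    - by apply: measurable_funD.
    - by move=> w; rewrite exprn_ge0.
    - by move=> w; rewrite addr_ge0 ?exprn_ge0.
    - apply: aeW => w; rewrite /S (step_sumE (fun k => q ^+ k)).
      case: ifP => XN; first by rewrite lerDl exprn_ge0.
      rewrite add0r; move: XN => /negbT; rewrite -leqNgt => XN.
      by rewrite -(subnKC XN) exprD ler_piMr ?exprn_ge0 // exprn_ile1.
  by rewrite ler_norml; apply/andP; split; lra.
pose B := \sum_(i < size G) `|b i|.
have B0 : 0 <= B by rewrite sumr_ge0.
elim/ltn_ind => n IH; apply/eqP; rewrite -subr_eq0 -normr_le0 leNgt; apply/negP => D0.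
set D := `|mass_at n - _| in D0.
have key (q : R) : 0 < q <= 1 -> D <= q * (1 + B).
  move=> /andP[q0 q1].
  have qn : 0 < q ^+ n by rewrite exprn_gt0.
  have Gq : G.[q] / G.[1] = \sum_(i < n) b i * q ^+ i + b n * q ^+ n
      + \sum_(i < size G) (if (n < i)%N then b i * q ^+ i else 0).
    have lead : G.[q] / G.[1] = \sum_(0 <= i < n.+1 + size G) b i * q ^+ i.
      rewrite (horner_coef_wide q (n := n.+1 + size G)) ?leq_addl // big_mkord mulr_suml.
      by apply: eq_bigr => i _; rewrite /b mulrAC.
    rewrite lead (big_cat_nat (n := n.+1)) ?leq_addr //= big_mkord big_ord_recr /=.
    congr (_ + _); rewrite -(big_mkord xpredT (fun i => if (n < i)%N then b i * q ^+ i else 0)).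
    have [sn|sn] := leqP (size G) n.+1.
      rewrite [RHS]big_nat [RHS]big1 => [|i /andP[_ si]]; last by rewrite ltnNge -ltnS (leq_trans si).
      rewrite big_nat big1 // => i /andP[ni _].
      by rewrite /b nth_default ?mul0r // (leq_trans sn).
    rewrite [RHS](big_cat_nat (n := n.+1)) //=; last exact: ltnW.
    rewrite [X in _ = X + _]big_nat [X in _ = X + _]big1 => [|i /andP[_ ni]]; last by rewrite ltnNge -ltnS ni.
    rewrite add0r (big_cat_nat (n := size G)) ?leq_addl //=; last exact: ltnW.
    rewrite [X in _ + X = _]big_nat [X in _ + X = _]big1 ?addr0 => [|i /andP[si _]]; last first.
      by rewrite /b nth_default ?mul0r.
    by rewrite big_nat [RHS]big_nat; apply: eq_bigr => i /andP[-> _].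
  have tail : `|\sum_(i < size G) (if (n < i)%N then b i * q ^+ i else 0)| <= q ^+ n.+1 * B.
    apply: le_trans (ler_norm_sum _ _ _) _; rewrite mulr_sumr; apply: ler_sum => i _.
    case: ifP => ni; last by rewrite normr0 mulr_ge0 ?exprn_ge0 // ltW.
    rewrite normrM mulrC ler_wpM2r // ger0_norm; last by rewrite exprn_ge0 // ltW.
    by apply: ler_wiXn2l => //; exact: ltW.
  have := squeeze n.+1 q; rewrite q1 ltW // => /(_ isT); rewrite big_ord_recr /= Gq.
  have -> : \sum_(i < n) q ^+ i * mass_at i = \sum_(i < n) b i * q ^+ i.
    by apply: eq_bigr => i _; rewrite IH // mulrC.
  set S := \sum_(i < n) _; set U := \sum_(i < size G) _ in tail *.
  have -> : S + b n * q ^+ n + U - (S + q ^+ n * mass_at n)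
    = U - q ^+ n * (mass_at n - b n) by ring.
  move=> H.
  have : `|q ^+ n * (mass_at n - b n)| <= q ^+ n.+1 + q ^+ n.+1 * B.
    have -> : q ^+ n * (mass_at n - b n) = U - (U - q ^+ n * (mass_at n - b n)) by ring.
    by apply: le_trans (ler_normB _ _) _; rewrite addrC lerD.
  rewrite normrM (gtr0_norm qn) -/D exprS.
  have -> : q * q ^+ n + q * q ^+ n * B = q ^+ n * (q * (1 + B)) by ring.
  by rewrite ler_pM2l.
(* A q in (0, 1] at which [key] reads D <= D / 2; if it exceeds 1, take q = 1. *)
have [D1|D1] := leP (D / (2 * (1 + B))) 1.
  have := key (D / (2 * (1 + B))); rewrite D1 divr_gt0 ?mulr_gt0 ?ltr_pwDl // => /(_ isT).
  have -> : D / (2 * (1 + B)) * (1 + B) = D / 2 by field; rewrite gt_eqF // ltr_pwDl.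
  lra.
have := key 1; rewrite ltr01 lexx mul1r => /(_ isT).
move: D1; rewrite ltr_pdivlMr ?mulr_gt0 ?ltr_pwDl // mul1r; lra.
Qed.

End NatLaw.

(** * The characteristic function of the normal law *)

Section NormalChar.
Variable R : realType.
Implicit Types (x t al : R).

Local Notation lam := (@lebesgue_measure R).
Local Notation ph := (normal_pdf (0 : R) 1).
Local Notation c0 := (normal_peak (1 : R)).

Let phE x : ph x = c0 * expR (- (x ^+ 2 / 2)).
Proof.
by rewrite normal_pdfE ?oner_eq0 // /normal_fun subr0 expr1n mulNr.
Qed.

Let c0_gt0 : 0 < c0. Proof. by rewrite normal_peak_gt0 // oner_eq0. Qed.

(** A multiple of a Gaussian density of larger variance, which dominates both the
    density and x times the density: one integrable bound for all dominations
    below. *)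
Let env x : R := c0 * expR (- (x ^+ 2 / 4)).

Let env_ge0 x : 0 <= env x.
Proof. by rewrite mulr_ge0 ?expR_ge0 // ltW. Qed.

Let integrable_env : lam.-integrable setT (EFin \o env).
Proof.
have s2 : Num.sqrt 2 != 0 :> R by rewrite gt_eqF // sqrtr_gt0.
have E : env = fun x => (c0 / normal_peak (Num.sqrt 2)) * normal_pdf 0 (Num.sqrt 2) x.
  apply/funext => x; rewrite normal_pdfE // /normal_fun subr0 sqr_sqrtr // /env.
  rewrite mulrA divfK ?gt_eqF ?normal_peak_gt0 //; congr (_ * expR _).
  by rewrite mulNr -mulr_natr; congr (- (_ / _)); ring.
rewrite E (_ : EFin \o _ = (fun x => (c0 / normal_peak (Num.sqrt 2))%:E
  * (normal_pdf 0 (Num.sqrt 2) x)%:E)%E); last by apply/funext => x; rewrite /= EFinM.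
by apply: integrableZl => //; exact: integrable_normal_pdf.
Qed.

Let ph_le_env x : ph x <= env x.
Proof.
rewrite phE /env ler_pM2l // ler_expR lerN2; have := sqr_ge0 x; lra.
Qed.

Let xph_le_env x : `|x| * ph x <= env x.
Proof.
rewrite phE /env mulrCA ler_pM2l //.
have -> : expR (- (x ^+ 2 / 4)) = expR (x ^+ 2 / 4) * expR (- (x ^+ 2 / 2)).
  by rewrite -expRD; congr expR; field.
rewrite ler_wpM2r ?expR_ge0 //; apply: le_trans (expR_ge1Dx _).
have := sqr_ge0 (`|x| / 2 - 1); rewrite -(real_normK (num_real x)); lra.
Qed.

Let integrable_dom (h : R -> R) K : measurable_fun setT h ->
  (forall x, `|h x| <= K * env x) -> lam.-integrable setT (EFin \o h).
Proof.
move=> mh hK.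
have K_int : lam.-integrable setT (fun x => (K%:E * (env x)%:E)%E) by exact: integrableZl.
apply: le_integrable K_int => //; first exact/measurable_EFinP.
move=> x _ /=; rewrite lee_fin; apply: le_trans (hK x) _.
exact: ler_norm.
Qed.

Let env_cvg0 : env n.+1%:R @[n --> \oo] --> 0.
Proof.
apply: (@squeeze_cvgr _ _ _ _ (cst 0) (fun n => (4 * c0) * harmonic n)).
- apply: nearW => n; rewrite env_ge0 /= /env /harmonic /=.
  rewrite (_ : 4 * c0 / n.+1%:R = c0 * (4 / n.+1%:R)); last by ring.
  rewrite ler_pM2l //.
  have n0 : 0 < n.+1%:R :> R by [].
  have n1 : 1 <= n.+1%:R :> R by rewrite ler1n.
  rewrite ler_pdivlMr // expRN mulrC ler_pdivrMr ?expR_gt0 //.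
  have := expR_ge1Dx (n.+1%:R ^+ 2 / 4 : R); nra.
- exact: cvg_cst.
rewrite -[X in _ --> X](mulr0 (4 * c0)); apply: cvgM; first exact: cvg_cst.
exact: cvg_harmonic.
Qed.

(** The fundamental theorem of calculus on [-n, n], and dominated convergence as n
    tends to infinity. *)
Let integral_derivative (F h : R -> R) K :
  (forall x, is_derive x 1 F (h x)) -> continuous h ->
  lam.-integrable setT (EFin \o h) -> (forall x, `|F x| <= K * env x) ->
  (\int[lam]_x h x)%R = 0.
Proof.
move=> Fh ch ih FK.
have K0 : 0 <= K.
  rewrite -(pmulr_lge0 _ (_ : 0 < env 0)); first exact: le_trans (FK 0).
  by rewrite mulr_gt0 ?expR_gt0.
have cF : continuous F.
  move=> x; apply: differentiable_continuous; apply/derivable1_diffP.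
  by have [] := Fh x.
pose I n : set R := `[(- n.+1%:R), n.+1%:R]%classic.
have FTC n : (\int[lam]_(x in I n) (h x)%:E = (F n.+1%:R - F (- n.+1%:R))%:E)%E.
  rewrite EFinB; apply: continuous_FTC2.
  - by rewrite gtrN.
  - exact: continuous_subspaceT.
  - split; first by move=> x _; have [] := Fh x.
      by apply: cvg_at_right_filter; exact: cF.
    by apply: cvg_at_left_filter; exact: cF.
  - by move=> x _; rewrite derive1E; have [_ ->] := Fh x.
have mI n : measurable (I n) by exact: measurable_itv.
have cvgI : (\int[lam]_(x in I n) (h x)%:E)%E @[n --> \oo] --> (\int[lam]_x (h x)%:E)%E.
  have -> : (fun n => \int[lam]_(x in I n) (h x)%:E)%E
      = (fun n => \int[lam]_x ((h x)%:E * (\1_(I n) x)%:E))%E.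
    apply/funext => n; rewrite [LHS]integral_mkcond; apply: eq_integral => x _.
    by rewrite patchE indicE; case: (x \in I n); rewrite ?mule1 ?mule0.
  have mh : measurable_fun setT (EFin \o h) by have /integrableP[] := ih.
  have mhI n : measurable_fun setT (fun x => ((h x)%:E * (\1_(I n) x)%:E)%E).
    by apply: emeasurable_funM => //; exact/measurable_EFinP/measurable_indic.
  have ptw : {ae lam, forall x, setT x ->
      ((h x)%:E * (\1_(I n) x)%:E)%E @[n --> \oo] --> (EFin \o h) x}.
    apply: aeW => x _; apply: cvg_near_cst.
    exists (Num.truncn `|x|).+1 => // n /= xn.
    rewrite indicE mem_set ?mule1 // /I /= in_itv /= -ler_norml.
    by rewrite (le_trans (ltW (truncnS_gt `|x|))) // ler_nat (leq_trans xn).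
  have dom : {ae lam, forall x n, setT x ->
      (`|(h x)%:E * (\1_(I n) x)%:E| <= (abse \o (EFin \o h)) x)%E}.
    apply: aeW => x n _; rewrite abseM -[leRHS]mule1 lee_pmul //=.
    by rewrite indicE; case: (_ \in _); rewrite /= ?normr1 ?normr0 lee_fin.
  have DC := @dominated_convergence _ _ R lam setT measurableT
    (fun n x => ((h x)%:E * (\1_(I n) x)%:E)%E) (EFin \o h) (abse \o (EFin \o h)).
  by have [_ _] := DC mhI mh ptw (integrable_abse ih) dom.
have cvgF : (F n.+1%:R - F (- n.+1%:R))%:E @[n --> \oo] --> (0 : R)%:E.
  apply: cvg_EFin; first exact: nearW.
  apply: norm_cvg0.
  apply: (@squeeze_cvgr _ _ _ _ (cst 0) (fun n => (2 * K) * env n.+1%:R)).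
  - apply: nearW => n; rewrite normr_ge0 /=; apply: le_trans (ler_normB _ _) _.
    have := FK n.+1%:R; have := FK (- n.+1%:R); rewrite /env sqrrN; lra.
  - exact: cvg_cst.
  rewrite -[X in _ --> X](mulr0 (2 * K)); apply: cvgM; first exact: cvg_cst.
  exact: env_cvg0.
have E : (fun n => \int[lam]_(x in I n) (h x)%:E)%E
    = (fun n => (F n.+1%:R - F (- n.+1%:R))%:E) by apply/funext => n; exact: FTC.
rewrite E in cvgI.
by rewrite /Rintegral (cvg_unique _ cvgI cvgF).
Qed.

Definition normal_char t al : R := (\int[lam]_x (cos (t * x + al) * ph x))%R.

Let cphase t al : continuous (fun x => t * x + al).
Proof.
move=> x; apply: cvgD; last exact: cvg_cst.
by apply: cvgM; [exact: cvg_cst|exact: cvg_id].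
Qed.

Let ccos t al : continuous (fun x => cos (t * x + al)).
Proof.
move=> x; apply: (continuous_comp (f := fun x => t * x + al)); first exact: cphase.
exact: continuous_cos.
Qed.

Let csin t al : continuous (fun x => sin (t * x + al)).
Proof.
move=> x; apply: (continuous_comp (f := fun x => t * x + al)); first exact: cphase.
exact: continuous_sin.
Qed.

Let cph : continuous ph.
Proof. by apply: continuous_normal_pdf; rewrite oner_eq0. Qed.

Let ph_ge0 x : 0 <= ph x. Proof. exact: normal_pdf_ge0. Qed.

Let integrable_cos t al : lam.-integrable setT (EFin \o (fun x => cos (t * x + al) * ph x)).
Proof.
apply: (@integrable_dom _ 1).
  apply: continuous_measurable_fun => x; apply: cvgM; [exact: ccos|exact: cph].
move=> x; rewrite normrM mul1r (ger0_norm (ph_ge0 _)); apply: le_trans (ph_le_env x).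
by rewrite ler_piMl // cos_max.
Qed.

Let continuous_xsin t al : continuous (fun x => x * sin (t * x + al) * ph x).
Proof.
move=> x; apply: cvgM; last exact: cph.
by apply: cvgM; [exact: cvg_id|exact: csin].
Qed.

Let integrable_xsin t al :
  lam.-integrable setT (EFin \o (fun x => x * sin (t * x + al) * ph x)).
Proof.
apply: (@integrable_dom _ 1); first exact: continuous_measurable_fun.
move=> x; rewrite normrM mul1r (ger0_norm (ph_ge0 _)); apply: le_trans (xph_le_env x).
by rewrite ler_wpM2r // normrM ler_piMr // sin_max.
Qed.

Let is_derive_ph x : is_derive x 1 ph (- x * ph x).
Proof.
have -> : ph = fun x => c0 * expR (- (x ^+ 2 / 2)) by apply/funext => y; exact: phE.
by apply: is_derive_eq; rewrite /GRing.scale /=; field.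
Qed.

(** Integration by parts, since x times the density is minus its derivative. *)
Let by_parts t al : (\int[lam]_x (x * sin (t * x + al) * ph x))%R = t * normal_char t al.
Proof.
have := @integral_derivative (fun x => sin (t * x + al) * ph x)
  (fun x => t * (cos (t * x + al) * ph x) - x * sin (t * x + al) * ph x) 1.
rewrite RintegralB //; last first.
  rewrite (_ : EFin \o _ = (fun x => t%:E * (cos (t * x + al) * ph x)%:E)%E).
    by apply: integrableZl => //; exact: integrable_cos.
  by apply/funext => x; rewrite /= EFinM.
rewrite RintegralZl //.
rewrite -/(normal_char t al) => H; apply/eqP; rewrite eq_sym -subr_eq0; apply/eqP; apply: H.
- move=> x; have D := is_derive_ph x.
  by apply: is_derive_eq; rewrite /GRing.scale /=; ring.
- move=> x; apply: cvgB; last exact: continuous_xsin.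
  apply: cvgM; first exact: cvg_cst.
  by apply: cvgM; [exact: ccos|exact: cph].
- rewrite (_ : EFin \o _ = (fun x => (t * (cos (t * x + al) * ph x))%:E
     - (x * sin (t * x + al) * ph x)%:E)%E); last by [].
  apply: integrableB => //; last exact: integrable_xsin.
  rewrite (_ : (fun x => _) = (fun x => t%:E * (cos (t * x + al) * ph x)%:E)%E).
    by apply: integrableZl => //; exact: integrable_cos.
  by apply/funext => x; rewrite EFinM.
- move=> x; rewrite normrM mul1r (ger0_norm (ph_ge0 _)); apply: le_trans (ph_le_env x).
  by rewrite ler_piMl // sin_max.
Qed.

(** Differentiation under the integral sign followed by [by_parts] gives the
    differential equation F' = - t F for the characteristic function. *)
Let is_derive_char t al : is_derive t 1 (normal_char ^~ al) (- t * normal_char t al).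
Proof.
pose f (s x : R) := cos (s * x + al) * ph x.
have df (s x : R) : is_derive s (1 : R) (f ^~ x) (- (x * sin (s * x + al) * ph x)).
  by apply: is_derive_eq; rewrite /GRing.scale /=; ring.
have It : (`](t - 1), (t + 1)[%classic : set R) t by rewrite /= in_itv /=; apply/andP; split; lra.
have d1 s x : partial1of2 f s x = - (x * sin (s * x + al) * ph x).
  by rewrite partial1of2E; have [_ ->] := df s x.
have H := @derivable_under_integral R _ _ lam f setT measurableT t (t - 1) (t + 1) It
  _ _ env env_ge0 integrable_env.
have H' := @differentiation_under_integral R _ _ lam f setT measurableT t (t - 1) (t + 1) It
  _ _ env env_ge0 integrable_env.
have intf s : (`](t - 1), (t + 1)[%classic : set R) s -> lam.-integrable setT (EFin \o f s).
  by move=> _; exact: integrable_cos.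
have derf s x : (`](t - 1), (t + 1)[%classic : set R) s -> setT x -> derivable (f ^~ x) s 1.
  by move=> _ _; have [] := df s x.
have ub s x : (`](t - 1), (t + 1)[%classic : set R) s -> setT x -> `|partial1of2 f s x| <= env x.
  move=> _ _; rewrite d1 normrN normrM (ger0_norm (ph_ge0 _)); apply: le_trans (xph_le_env x).
  by rewrite ler_wpM2r // normrM ler_piMr // sin_max.
apply: DeriveDef; first exact: H.
rewrite -derive1E; apply: etrans (H' intf derf ub) _.
have -> : (\int[lam]_x (partial1of2 f ^~ x) t)%R
    = (\int[lam]_x (-1 * (x * sin (t * x + al) * ph x)))%R.
  by apply: eq_Rintegral => x _; rewrite d1 mulN1r.
rewrite RintegralZl //.
by rewrite by_parts; ring.
Qed.

(** The solution of F' = - t F with F 0 = cos al. *)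
Lemma normal_charE t al : normal_char t al = expR (- (t ^+ 2 / 2)) * cos al.
Proof.
pose B s := normal_char s al * expR (s ^+ 2 / 2).
have dB (s : R) : is_derive s (1 : R) B 0.
  have D := is_derive_char s al.
  by apply: is_derive_eq; rewrite /GRing.scale /=; field.
have E : B t = B 0 by apply: is_derive_0_is_cst.
have B0 : B 0 = cos al.
  rewrite /B expr0n /= mul0r expR0 mulr1 /normal_char.
  have -> : (\int[lam]_x (cos (0 * x + al) * ph x))%R = (\int[lam]_x (cos al * ph x))%R.
    by apply: eq_Rintegral => x _; rewrite mul0r add0r.
  rewrite RintegralZl //; last exact: integrable_normal_pdf.
  by rewrite /Rintegral integral_normal_pdf mulr1.
by rewrite -B0 -E /B mulrCA -expRD addNr expR0 mulr1.
Qed.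

(** The Radon-Nikodym derivative of the normal law is almost everywhere its
    density. *)
Lemma integral_normal_prob (f : R -> R) : measurable_fun setT f ->
  (exists M, forall x, `|f x| <= M) ->
  (\int[normal_prob 0 1]_x f x)%R = (\int[lam]_x (f x * ph x))%R.
Proof.
move=> mf [M fM].
have mEf : measurable_fun setT (EFin \o f) by exact/measurable_EFinP.
have intf : (normal_prob (0 : R) 1).-integrable setT (EFin \o f).
  apply: measurable_bounded_integrable => //.
    by rewrite fin_num_fun_lty //; exact: fin_num_measure.
  exists M; split; first exact: num_real.
  by move=> y My x _; exact: le_trans (fM x) (ltW My).
have dom := normal_prob_dominates (0 : R) 1.
congr fine; rewrite -(Radon_Nikodym_change_of_variables dom) //=.
have mph : measurable_fun setT (EFin \o ph).
  by apply/measurable_EFinP; exact: measurable_normal_pdf.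
apply: ae_eq_integral => //.
- exact: emeasurable_funM.
- by apply/measurable_EFinP; apply: measurable_funM => //; exact: measurable_normal_pdf.
have RN : ae_eq lam setT
    (Radon_Nikodym (charge_of_finite_measure (normal_prob (0 : R) 1)) lam) (EFin \o ph).
  apply: integral_ae_eq => //.
  - by apply: Radon_Nikodym_integrable; exact: dom.
  - by move=> E _ mE; rewrite -Radon_Nikodym_integral.
apply: filterS RN => x /= H xT; by rewrite (H xT) EFinM.
Qed.

End NormalChar.

(** * Convergence in distribution from characteristic functions *)

Section AbsPolynomials.
Variable R : realType.
Implicit Types (y : R) (n : nat).

(** The iteration p := p + (y^2 - p^2) / 2 increases to |y| on [-1, 1]. *)
Fixpoint abs_poly n : {poly R} :=
  if n is n'.+1 then
    abs_poly n' + 2^-1 *: ('X ^+ 2 - abs_poly n' ^+ 2)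
  else 0.

Lemma abs_polyS n y :
  (abs_poly n.+1).[y] = (abs_poly n).[y] + (y ^+ 2 - (abs_poly n).[y] ^+ 2) / 2.
Proof. by rewrite /= hornerD hornerZ hornerD hornerN !horner_exp hornerX mulrC. Qed.

(** The error |y| - p is multiplied by 1 - (|y| + p) / 2 at each iteration, hence
    it is at most |y| / (1 + n |y| / 2), which is at most 2 / n uniformly in y. *)
Lemma abs_poly_bound n y : `|y| <= 1 ->
  0 <= (abs_poly n).[y] <= `|y| /\
  (`|y| - (abs_poly n).[y]) * (1 + n%:R * `|y| / 2) <= `|y|.
Proof.
move=> y1; have y0 := normr_ge0 y; elim: n => [|n [/andP[p0 py] H]].
  by rewrite /= horner0 lexx y0 subr0 mul0r mul0r addr0 mulr1.
rewrite abs_polyS -(real_normK (num_real y)) -[n.+1%:R]natr1.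
move: y1 y0 p0 py H; set x := `|y|; move: (abs_poly n).[y] => p x1 x0 p0 px H.
have E : x - (p + (x ^+ 2 - p ^+ 2) / 2) = (x - p) * (1 - (x + p) / 2) by field.
have N0 : 0 <= n%:R :> R by [].
have d0 : 0 <= x - p by rewrite subr_ge0.
have q0 : 0 <= 1 - (x + p) / 2 by lra.
have q1 : 1 - (x + p) / 2 <= 1 - x / 2 by lra.
split.
  have := mulr_ge0 d0 (addr_ge0 x0 p0) => dp0.
  apply/andP; split; first by lra.
  by rewrite -subr_ge0 E mulr_ge0.
rewrite E.
apply: le_trans (_ : (x - p) * (1 - x / 2) * (1 + (n%:R + 1) * x / 2) <= _).
  apply: ler_wpM2r; first by rewrite addr_ge0 // divr_ge0 // mulr_ge0 // addr_ge0.
  exact: ler_wpM2l.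
apply: le_trans H; rewrite -mulrA; apply: ler_wpM2l => //.
have := mulr_ge0 (mulr_ge0 N0 x0) x0; have := mulr_ge0 x0 x0; nra.
Qed.

Lemma abs_poly_approx (e : R) : 0 < e ->
  exists p : {poly R}, forall y, `|y| <= 1 -> `|p.[y] - `|y| | <= e.
Proof.
move=> e0; exists (abs_poly (Num.truncn (2 / e)).+1) => y y1.
have [/andP[p0 py] H] := abs_poly_bound (Num.truncn (2 / e)).+1 y1.
have := truncnS_gt (2 / e); move: (Num.truncn (2 / e)).+1 p0 py H => N p0 py H eN.
rewrite distrC ger0_norm ?subr_ge0 //.
move: y1 (normr_ge0 y) py H; set x := `|y|; move: (abs_poly N).[y] p0 => p p0 x1 x0 px H.
have [x_eq0|x_neq0] := eqVneq x 0; first by lra.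
have x_gt0 : 0 < x by rewrite lt_def x_neq0.
have N1 : 2 < N%:R * e by rewrite -ltr_pdivrMr.
rewrite leNgt; apply/negP => ed.
have N0 : 0 < N%:R :> R by apply: lt_trans eN; rewrite divr_gt0.
have : (x - p) * (N%:R * x / 2) <= x.
  by apply: le_trans H; apply: ler_wpM2l; [rewrite subr_ge0|rewrite lerDr].
have -> : (x - p) * (N%:R * x / 2) = x * ((x - p) * N%:R / 2) by ring.
rewrite -[leRHS]mulr1 ler_pM2l //.
have : N%:R * e <= N%:R * (x - p) by rewrite ler_pM2l // ltW.
lra.
Qed.

(** The continuous piecewise linear function that is 1 up to u, 0 from v on, and
    affine between them, written with absolute values so that it inherits their
    polynomial approximation. *)
Definition ramp (u v y : R) : R := (`|y - v| - `|y - u|) / (2 * (v - u)) + 2^-1.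

Lemma ramp_bound u v y : u < v -> 0 <= ramp u v y <= 1.
Proof.
move=> uv; rewrite /ramp; have d0 : 0 < 2 * (v - u) by rewrite mulr_gt0 // subr_gt0.
have H : `| `|y - v| - `|y - u| | <= v - u.
  apply: le_trans (ler_dist_dist _ _) _; rewrite (_ : y - v - (y - u) = - (v - u)); last by ring.
  by rewrite normrN ger0_norm // subr_ge0 ltW.
move: H; rewrite ler_norml => /andP[H1 H2].
have -> : 2^-1 = (v - u) / (2 * (v - u)) by field; rewrite gt_eqF // subr_gt0.
rewrite -mulrDl ler_pdivrMr // mul1r; apply/andP; split; last by lra.
by apply: divr_ge0; [lra|exact: ltW].
Qed.

Lemma ramp_left u v y : u < v -> y <= u -> ramp u v y = 1.
Proof.
move=> uv yu; rewrite /ramp !ler0_norm ?subr_le0 ?(le_trans yu) // ?ltW //.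
by field; rewrite gt_eqF // subr_gt0.
Qed.

Lemma ramp_right u v y : u < v -> v <= y -> ramp u v y = 0.
Proof.
move=> uv vy; rewrite /ramp !ger0_norm ?subr_ge0 // ?(le_trans _ vy) // ?ltW //.
by field; rewrite gt_eqF // subr_gt0.
Qed.

Lemma ramp_approx u v (e : R) : `|u| <= 1 -> `|v| <= 1 -> u < v -> 0 < e ->
  exists p : {poly R}, forall y, `|y| <= 1 -> `|p.[y] - ramp u v y| <= e.
Proof.
move=> u1 v1 uv e0; have d0 : 0 < v - u by rewrite subr_gt0.
have [p pP] := @abs_poly_approx (e * (v - u) / 2) (divr_gt0 (mulr_gt0 e0 d0) (ltr0n _ 2)).
pose sh c := p \Po (2^-1 *: ('X - c%:P)).
exists ((v - u)^-1 *: (sh v - sh u) + (2^-1)%:P) => y y1.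
have shP c : `|c| <= 1 -> `|(sh c).[y] - `|y - c| / 2| <= e * (v - u) / 2.
  move=> c1; rewrite /sh horner_comp hornerZ hornerD hornerN hornerC hornerX.
  have -> : `|y - c| / 2 = `|2^-1 * (y - c)| by rewrite normrM mulrC [`|2^-1|]ger0_norm.
  apply: pP; rewrite normrM [`|2^-1|]ger0_norm //; have := ler_normB y c; lra.
have := shP v v1; have := shP u u1.
rewrite hornerD hornerZ hornerD hornerN hornerC.
move: (sh v).[y] (sh u).[y] => a b Hb Ha.
have -> : (v - u)^-1 * (a - b) + 2^-1 - ramp u v y
   = (v - u)^-1 * ((a - `|y - v| / 2) - (b - `|y - u| / 2)).
  by rewrite /ramp; field; rewrite gt_eqF.
rewrite normrM ger0_norm; last by rewrite invr_ge0 ltW.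
rewrite mulrC ler_pdivrMr //.
apply: le_trans (ler_normB _ _) _; lra.
Qed.

End AbsPolynomials.

Section BoundedExpectation.
Context (d : measure_display) (T : measurableType d) (R : realType).
Variable P : probability T R.
Implicit Types (f g : T -> R) (A : set T).

Definition mean f : R := (\int[P]_w f w)%R.
Definition prob A : R := fine (P A).

Definition bounded_measurable f :=
  measurable_fun setT f /\ exists M, forall w, `|f w| <= M.

Lemma bm_integrable f : bounded_measurable f -> P.-integrable setT (EFin \o f).
Proof.
move=> [mf [M fM]]; apply: measurable_bounded_integrable => //.
  by rewrite fin_num_fun_lty //; exact: fin_num_measure.
exists M; split; first exact: num_real.
by move=> y My x _; exact: le_trans (fM x) (ltW My).
Qed.

Lemma bmD f g : bounded_measurable f -> bounded_measurable g ->
  bounded_measurable (fun w => f w + g w).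
Proof.
move=> [mf [M fM]] [mg [M' gM]]; split; first exact: measurable_funD.
by exists (M + M') => w; apply: le_trans (ler_normD _ _) (lerD _ _).
Qed.

Lemma bm_indic A : measurable A -> bounded_measurable (\1_A : T -> R).
Proof.
move=> mA; split; first exact: measurable_indic.
by exists 1 => w; rewrite indicE; case: (_ \in _); rewrite ?normr1 ?normr0.
Qed.

Lemma bm_cst (c : R) : bounded_measurable (fun=> c).
Proof. by split; [exact: measurable_cst|exists `|c|]. Qed.

Lemma meanD f g : bounded_measurable f -> bounded_measurable g ->
  mean (fun w => f w + g w) = mean f + mean g.
Proof. by move=> bf bg; apply: RintegralD => //; exact: bm_integrable. Qed.

Lemma meanZ c f : bounded_measurable f -> mean (fun w => c * f w) = c * mean f.
Proof. by move=> bf; apply: RintegralZl => //; exact: bm_integrable. Qed.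

Lemma mean_cst (c : R) : mean (fun=> c) = c.
Proof. by rewrite /mean Rintegral_cst //= probability_setT mulr1. Qed.

Lemma mean_indic A : measurable A -> mean (\1_A : T -> R) = prob A.
Proof. by move=> mA; rewrite /mean /Rintegral integral_indic // setIT. Qed.

Lemma le_mean f g : bounded_measurable f -> bounded_measurable g ->
  (forall w, f w <= g w) -> mean f <= mean g.
Proof. by move=> bf bg fg; apply: le_Rintegral => //; exact: bm_integrable. Qed.

Lemma mean_dist_le f g (e : R) : bounded_measurable f -> bounded_measurable g ->
  (forall w, `|f w - g w| <= e) -> `|mean f - mean g| <= e.
Proof.
move=> bf bg fg.
have H1 : mean f <= mean g + e.
  rewrite -[X in _ + X]mean_cst -meanD //; last exact: bm_cst.
  apply: le_mean => //; first by apply: bmD => //; exact: bm_cst.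
  by move=> w; have := fg w; rewrite ler_norml; lra.
have H2 : mean g <= mean f + e.
  rewrite -[X in _ + X]mean_cst -meanD //; last exact: bm_cst.
  apply: le_mean => //; first by apply: bmD => //; exact: bm_cst.
  by move=> w; have := fg w; rewrite ler_norml; lra.
by rewrite ler_norml; apply/andP; split; lra.
Qed.

Variable Z : T -> R.
Hypothesis mZ : measurable_fun setT Z.

Lemma measurable_le x : measurable [set w | Z w <= x].
Proof.
rewrite -[X in measurable X]setTI; have := mZ measurableT (measurable_itv `]-oo, x]).
by congr measurable; congr (_ `&` _); apply/seteqP; split => w /=; rewrite in_itv.
Qed.

Lemma measurable_normr_ge x : measurable [set w | x <= `|Z w|].
Proof.
have mN : measurable_fun setT (fun w => `|Z w|) by exact: measurableT_comp.
rewrite -[X in measurable X]setTI; have := mN measurableT _ (measurable_itv `[x, +oo[).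
by congr measurable; congr (_ `&` _); apply/seteqP; split => w /=; rewrite in_itv /= andbT.
Qed.

Lemma bm_comp (h : R -> R) : measurable_fun setT h -> (exists M, forall x, `|h x| <= M) ->
  bounded_measurable (fun w => h (Z w)).
Proof. by move=> mh [M hM]; split; [exact: measurableT_comp|exists M]. Qed.

(** A half-line is sandwiched between ramps in sin (eta y), up to the event
    where |y| is at least K; eta is such that sin (eta y) increases on
    [-K, K]. *)
Lemma ramp_sandwich (K x1 x2 : R) : 0 < K -> x1 < x2 -> `|x1| <= K -> `|x2| <= K ->
  let eta := pi / (2 * K) in
  let r w := ramp (sin (eta * x1)) (sin (eta * x2)) (sin (eta * Z w)) in
  [/\ sin (eta * x1) < sin (eta * x2),
      bounded_measurable r,
      prob [set w | Z w <= x1] - prob [set w | K <= `|Z w|] <= mean r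
    & mean r <= prob [set w | Z w <= x2] + prob [set w | K <= `|Z w|]].
Proof.
move=> K0 x12 x1K x2K eta r.
have eta0 : 0 < eta by rewrite divr_gt0 ?pi_gt0 // mulr_gt0.
have etaK : eta * K = pi / 2 by rewrite /eta; field; rewrite gt_eqF.
have inI z : `|z| <= K -> eta * z \in `[(- (pi / 2)), (pi / 2)].
  rewrite ler_norml in_itv /= => /andP[z1 z2].
  by rewrite -etaK -mulrN !ler_pM2l // z1.
have mono z z' : `|z| <= K -> `|z'| <= K -> (sin (eta * z) < sin (eta * z')) = (z < z').
  by move=> zK z'K; rewrite ltr_sin ?inI // ltr_pM2l.
have lt12 : sin (eta * x1) < sin (eta * x2) by rewrite mono.
have br : bounded_measurable r.
  apply: (@bm_comp (fun z => ramp (sin (eta * x1)) (sin (eta * x2)) (sin (eta * z)))).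
    apply: continuous_measurable_fun => z.
    have cs : {for z, continuous (fun z => sin (eta * z))}.
      apply: (continuous_comp (f := fun z => eta * z)); last exact: continuous_sin.
      by apply: cvgM; [exact: cvg_cst|exact: cvg_id].
    apply: cvgD; last exact: cvg_cst.
    apply: cvgM; last exact: cvg_cst.
    by apply: cvgB; apply: cvg_norm; apply: cvgB => //; exact: cvg_cst.
  exists 1 => z; have /andP[r0 r1] := ramp_bound (sin (eta * z)) lt12.
  by rewrite ger0_norm.
have mA1 := measurable_le x1; have mA2 := measurable_le x2.
have mN := measurable_normr_ge K.
have r01 w : 0 <= r w <= 1 by exact: ramp_bound.
split => //.
- rewrite lerBlDr -!mean_indic // -meanD //; last exact: bm_indic.
  apply: le_mean; [exact: bm_indic|by apply: bmD => //; exact: bm_indic|].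
  move=> w; rewrite !indicE; have /andP[r0 r1] := r01 w.
  case: (boolP (w \in [set w | Z w <= x1])) => [|_]; last first.
    by rewrite addr_ge0 //; case: (_ \in _).
  rewrite inE /= => Zx; case: (boolP (w \in [set w | K <= `|Z w|])) => [_|]; first by rewrite lerDr.
  rewrite notin_setE /= => /negP; rewrite -ltNge => ZK.
  by rewrite /r ramp_left // ?addr0 // leNgt mono -?leNgt // ltW.
- rewrite -!mean_indic // -meanD; [|exact: bm_indic..].
  apply: le_mean => //; first by apply: bmD; exact: bm_indic.
  move=> w; rewrite !indicE; have /andP[r0 r1] := r01 w.
  case: (boolP (w \in [set w | Z w <= x2])) => [_|].
    by apply: le_trans r1 _; rewrite lerDl; case: (_ \in _).
  rewrite notin_setE /= => /negP; rewrite -ltNge => Zx.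
  case: (boolP (w \in [set w | K <= `|Z w|])) => [_|]; first by rewrite add0r.
  rewrite notin_setE /= => /negP; rewrite -ltNge => ZK.
  by rewrite /r ramp_right // ?addr0 // leNgt mono -?leNgt // ltW.
Qed.

Lemma prob_tight (e : R) : 0 < e ->
  exists2 K, 0 < K & forall K', K <= K' -> prob [set w | K' <= `|Z w|] <= e.
Proof.
move=> e0; pose F n := [set w | n%:R <= `|Z w|].
have mF n : measurable (F n) := measurable_normr_ge _.
have cap0 : \bigcap_n F n = set0.
  apply/seteqP; split => // w /(_ (Num.truncn `|Z w|).+1 I).
  by rewrite /F /= leNgt truncnS_gt.
have cvF : P (F n) @[n --> \oo] --> P (\bigcap_n F n).
  apply: nonincreasing_cvg_mu => //.
  - by rewrite -ge0_fin_numE // fin_num_measure.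
  - exact: bigcap_measurable.
  - move=> n n' nn'; apply/subsetPset => w /=; apply: le_trans.
    by rewrite ler_nat.
rewrite cap0 measure0 in cvF.
have /fine_cvgP[_ /cvgrPdist_le/(_ e e0)[N _ HN]] := cvF.
exists N.+1%:R => // K' NK'.
have := HN N (leqnn N); rewrite /= sub0r normrN => H.
apply: le_trans (le_trans (ler_norm _) H).
have mK' := measurable_normr_ge K'.
rewrite fine_le ?fin_num_measure // le_measure ?inE //.
by move=> w /=; apply: le_trans; apply: le_trans NK'; rewrite ler_nat.
Qed.

End BoundedExpectation.

Section Levy.
Context (R : realType) (d : nat -> measure_display) (T : forall n, measurableType (d n)).
Variables (P : forall n, probability (T n) R) (Y : forall n, T n -> R).
Variable mu : probability (measurableTypeR R) R.
Arguments Y : clear implicits.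
Hypothesis mY : forall n, measurable_fun setT (Y n).
Hypothesis cvg_char : forall t al : R,
  mean (P n) (fun w => cos (t * Y n w + al)) @[n --> \oo]
    --> mean mu (fun x : measurableTypeR R => cos (t * x + al)).
Hypothesis tightY : forall e : R, 0 < e -> exists2 K, 0 < K &
  \forall n \near \oo, prob (P n) [set w | K <= `|Y n w|] <= e.

Let good (f : R -> R) : Prop := [/\ measurable_fun setT f, exists M, forall x, `|f x| <= M &
  mean (P n) (fun w => f (Y n w)) @[n --> \oo] --> mean mu (f : measurableTypeR R -> R)].

Let goodD (f g : R -> R) : good f -> good g -> good (fun x => f x + g x).
Proof.
move=> [mf [M fM] cf] [mg [M' gM] cg].
have bmu := @bm_comp _ (measurableTypeR R) R idfun (@measurable_id _ _ setT).
split; first exact: measurable_funD.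
  by exists (M + M') => w; apply: le_trans (ler_normD _ _) (lerD _ _).
rewrite (meanD mu (bmu f mf (ex_intro _ M fM)) (bmu g mg (ex_intro _ M' gM))).
rewrite (_ : (fun n => _) = (fun n => mean (P n) (fun w => f (Y n w))
  + mean (P n) (fun w => g (Y n w)))); first exact: cvgD.
by apply/funext => n; apply: meanD; apply: bm_comp => //; [exists M|exists M'].
Qed.

Let goodZ c (f : R -> R) : good f -> good (fun x => c * f x).
Proof.
move=> [mf [M fM] cf].
have bmu := @bm_comp _ (measurableTypeR R) R idfun (@measurable_id _ _ setT).
split; first exact: measurable_funM.
  by exists (`|c| * M) => w; rewrite normrM ler_wpM2l.
rewrite (meanZ mu c (bmu f mf (ex_intro _ M fM))).
rewrite (_ : (fun n => _) = (fun n => c * mean (P n) (fun w => f (Y n w)))).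
  by apply: cvgM => //; exact: cvg_cst.
by apply/funext => n; apply: meanZ; apply: bm_comp => //; exists M.
Qed.

Let continuous_phase (t al : R) : continuous (fun x : R => t * x + al).
Proof.
move=> x; apply: cvgD; last exact: cvg_cst.
by apply: cvgM; [exact: cvg_cst|exact: cvg_id].
Qed.

Let good_cos t al : good (fun x => cos (t * x + al)).
Proof.
split; [|by exists 1 => x; exact: cos_max|exact: cvg_char].
apply: continuous_measurable_fun => x.
apply: (continuous_comp (f := fun x => t * x + al)); first exact: continuous_phase.
exact: continuous_cos.
Qed.

(** Multiplying a cosine by sin (eta x) gives again a combination of cosines, so
    every polynomial in sin (eta x) is reached. *)
Let good_cos_poly eta (q : {poly R}) : forall t al,
  good (fun x => cos (t * x + al) * q.[sin (eta * x)]).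
Proof.
elim/poly_ind: q => [|q c IH] t al.
  rewrite (_ : (fun x => _) = (fun x => 0 * cos (t * x + al))); first exact: goodZ.
  by apply/funext => x; rewrite horner0 mulr0 mul0r.
rewrite (_ : (fun x => _) = (fun x =>
   (2^-1 * (cos ((t + eta) * x + (al - pi / 2)) * q.[sin (eta * x)])
   + - 2^-1 * (cos ((t - eta) * x + (al - pi / 2)) * q.[sin (eta * x)]))
   + c * cos (t * x + al))).
  by apply: goodD; [apply: goodD; apply: goodZ; exact: IH|apply: goodZ; exact: good_cos].
apply/funext => x; rewrite hornerMXaddC.
have -> : (t + eta) * x + (al - pi / 2) = (t * x + al + eta * x) - pi / 2 by ring.
have -> : (t - eta) * x + (al - pi / 2) = (t * x + al - eta * x) - pi / 2 by ring.
by rewrite !cosBpihalf sinD sinB; field.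
Qed.

Let good_poly eta (q : {poly R}) : good (fun x => q.[sin (eta * x)]).
Proof.
rewrite (_ : (fun x => _) = (fun x => cos (0 * x + 0) * q.[sin (eta * x)])).
  exact: good_cos_poly.
by apply/funext => x; rewrite mul0r addr0 cos0 mul1r.
Qed.

(** A ramp in sin (eta x) is uniformly close to a polynomial in sin (eta x), for
    which the means converge. *)
Let ramp_close (K x1 x2 e : R) : 0 < K -> x1 < x2 -> `|x1| <= K -> `|x2| <= K -> 0 < e ->
  let eta := pi / (2 * K) in
  let r x := ramp (sin (eta * x1)) (sin (eta * x2)) (sin (eta * x)) in
  \forall n \near \oo, `|mean (P n) (fun w => r (Y n w))
    - mean mu (r : measurableTypeR R -> R)| <= 3 * e.
Proof.
move=> K0 x12 x1K x2K e0 eta r.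
have [lt12 bmu _ _] := ramp_sandwich mu (@measurable_id _ _ setT) K0 x12 x1K x2K.
have [q qP] := ramp_approx (sin_max (eta * x1)) (sin_max (eta * x2)) lt12 e0.
have [mq bq /cvgrPdist_le/(_ e e0) cq] := good_poly eta q.
near=> n.
have [_ bn _ _] := ramp_sandwich (P n) (@mY n) K0 x12 x1K x2K.
have bqn : bounded_measurable (fun w => q.[sin (eta * Y n w)]).
  exact: (bm_comp (@mY n) mq bq).
have bqmu : bounded_measurable (fun x : measurableTypeR R => q.[sin (eta * x)]).
  exact: (@bm_comp _ (measurableTypeR R) R idfun (@measurable_id _ _ setT) _ mq bq).
have H1 : `|mean (P n) (fun w => q.[sin (eta * Y n w)]) - mean (P n) (fun w => r (Y n w))| <= e.
  by apply: mean_dist_le => // w; apply: qP; exact: sin_max.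
have H2 : `|mean mu (fun x : measurableTypeR R => q.[sin (eta * x)])
   - mean mu (r : measurableTypeR R -> R)| <= e.
  by apply: mean_dist_le => // w; apply: qP; exact: sin_max.
have H3 : `|mean mu (fun x : measurableTypeR R => q.[sin (eta * x)])
   - mean (P n) (fun w => q.[sin (eta * Y n w)])| <= e by near: n; exact: cq.
move: H1 H2 H3; rewrite !ler_norml => /andP[? ?] /andP[? ?] /andP[? ?].
by apply/andP; split; lra.
Unshelve. all: by end_near. Qed.

(** Convergence of characteristic functions and tightness imply convergence in
    distribution: distribution functions are squeezed between means of ramps in
    sin (eta x), and these are uniform limits of trigonometric polynomials. *)
Lemma cvg_in_distribution_of_char : cvg_in_distribution P Y mu.
Proof.
move=> x0 cont.
pose F x := prob mu [set` `]-oo, x]].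
have FE x : prob mu [set y : measurableTypeR R | y <= x] = F x.
  by rewrite /F; congr (fine (mu _)); apply/seteqP; split => y /=; rewrite in_itv.
have Ffin x : mu [set` `]-oo, x]] = (F x)%:E by rewrite fineK // fin_num_measure.
rewrite Ffin; apply/fine_cvgP; split.
  by apply: nearW => n; rewrite fin_num_measure //; exact: (measurable_le (@mY n)).
apply/cvgrPdist_le => e e0.
have e8 : 0 < e / 8 by rewrite divr_gt0.
have [dl dl0 Hdl] : exists2 dl, 0 < dl &
    `|F (x0 + dl) - F x0| <= e / 8 /\ `|F (x0 - dl) - F x0| <= e / 8.
  move/cvgrPdist_le: cont => /(_ _ e8)/nbhs_ballP[dl /= dl0 H].
  exists (dl / 2); first by rewrite divr_gt0.
  have d2 : `|dl / 2| < dl by rewrite gtr0_norm ?divr_gt0 //; lra.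
  split; rewrite distrC; apply: H; rewrite /ball /= opprD ?opprK addNKr ?normrN //.
have [K1 K10 HK1] := prob_tight mu (@measurable_id _ (measurableTypeR R) setT) e8.
have [K2 K20 HK2] := tightY e8.
(* K is beyond both tails and beyond x0 - dl and x0 + dl, so that the sine is
   increasing up to these points. *)
pose K := Num.max (Num.max K1 K2) (`|x0| + dl).
have K1K : K1 <= K by rewrite /K !le_max lexx.
have K2K : K2 <= K by rewrite /K !le_max lexx orbT.
have K0 : 0 < K := lt_le_trans K10 K1K.
have xK : `|x0| + dl <= K by rewrite /K le_max lexx orbT.
have x0K : `|x0| <= K by apply: le_trans xK; rewrite lerDl ltW.
have xpK : `|x0 + dl| <= K.
  by apply: le_trans xK; apply: le_trans (ler_normD _ _) _; rewrite (gtr0_norm dl0).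
have xmK : `|x0 - dl| <= K.
  by apply: le_trans xK; apply: le_trans (ler_normB _ _) _; rewrite (gtr0_norm dl0).
have lt1 : x0 < x0 + dl by rewrite ltrDl.
have lt2 : x0 - dl < x0 by rewrite ltrBlDr ltrDl.
have [_ _ _ up2] := ramp_sandwich mu (@measurable_id _ (measurableTypeR R) setT) K0 lt1 x0K xpK.
have [_ _ lo2 _] := ramp_sandwich mu (@measurable_id _ (measurableTypeR R) setT) K0 lt2 xmK x0K.
have tmu := HK1 K K1K.
rewrite !FE in up2 lo2.
have R1 := ramp_close K0 lt1 x0K xpK e8.
have R2 := ramp_close K0 lt2 xmK x0K e8.
pose eta := pi / (2 * K).
pose r1 x := ramp (sin (eta * x0)) (sin (eta * (x0 + dl))) (sin (eta * x)).
pose r2 x := ramp (sin (eta * (x0 - dl))) (sin (eta * x0)) (sin (eta * x)).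
near=> n.
have [_ _ lo1 _] := ramp_sandwich (P n) (@mY n) K0 lt1 x0K xpK.
have [_ _ _ up1] := ramp_sandwich (P n) (@mY n) K0 lt2 xmK x0K.
have c1 : `|mean (P n) (fun w => r1 (Y n w)) - mean mu (r1 : measurableTypeR R -> R)|
  <= 3 * (e / 8) by near: n; exact: R1.
have c2 : `|mean (P n) (fun w => r2 (Y n w)) - mean mu (r2 : measurableTypeR R -> R)|
  <= 3 * (e / 8) by near: n; exact: R2.
have tn : prob (P n) [set w | K <= `|Y n w|] <= e / 8.
  apply: (@le_trans _ _ (prob (P n) [set w | K2 <= `|Y n w|])); last by near: n.
  have mN k := measurable_normr_ge (@mY n) k.
  by rewrite fine_le ?fin_num_measure // le_measure ?inE // => w /=; exact: le_trans.
move: Hdl => [H1 H2].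
change (`|F x0 - prob (P n) [set w | Y n w <= x0]| <= e).
move: lo1 up1 lo2 up2; rewrite -/eta.
rewrite -[mean (P n) (fun w => ramp _ (sin (eta * (x0 + dl))) _)]/(mean (P n) (fun w => r1 (Y n w))).
rewrite -[mean (P n) (fun w => ramp _ (sin (eta * x0)) _)]/(mean (P n) (fun w => r2 (Y n w))).
rewrite -[mean mu (fun w => ramp _ (sin (eta * (x0 + dl))) _)]/(mean mu (r1 : measurableTypeR R -> R)).
rewrite -[mean mu (fun w => ramp _ (sin (eta * x0)) _)]/(mean mu (r2 : measurableTypeR R -> R)).
move: c1 c2 H1 H2 tmu tn; rewrite !ler_norml.
move: (mean _ _) (mean _ _) (mean _ _) (mean _ _) (prob _ _) (prob _ _) (prob _ _) => m1 m1' m2 m2' p1 p2 p3.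
move: (F _) (F _) (F _) => f1 f2 f3.
by move=> /andP[? ?] /andP[? ?] /andP[? ?] /andP[? ?] *; apply/andP; split; lra.
Unshelve. all: by end_near. Qed.

End Levy.

(** * Laws with a polynomial generating function *)

Section PolynomialLaw.
Context (d : measure_display) (T : measurableType d) (R : realType).
Variables (P : probability T R) (X : {RV P >-> nat}) (G : {poly R}).
Implicit Types (h : nat -> R).

Lemma measurable_standardize : measurable_fun [set: T] (standardize P (realRV X)).
Proof.
exact: (measurable_nat_comp X
  (fun i => (i%:R - fine 'E_P[realRV X]) / Num.sqrt (fine 'V_P[realRV X]))).
Qed.

Hypothesis G1 : 0 < G.[1].
Hypothesis X_pgf : has_pgf X (fun q => G.[q] / G.[1]).

Let G1_neq0 : G.[1] != 0. Proof. by rewrite gt_eqF. Qed.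

Lemma expectation_coef h :
  'E_P[fun w => h (X w)]%E = ((\sum_(i < size G) h i * G`_i) / G.[1])%:E.
Proof.
rewrite (@expectation_nat _ _ _ P X h (size G)).
  by rewrite mulr_suml; congr EFin; apply: eq_bigr => i _; rewrite (mass_of_pgf G1) // mulrA.
rewrite (eq_bigr (fun i : 'I_(size G) => G`_i / G.[1])) => [|i _]; last by rewrite (mass_of_pgf G1).
rewrite -mulr_suml; apply: (canLR (mulfK G1_neq0)); rewrite mul1r horner_coef.
by apply: eq_bigr => i _; rewrite expr1n mulr1.
Qed.

Lemma mean_coef h :
  mean P (fun w => h (X w)) = (\sum_(i < size G) h i * G`_i) / G.[1].
Proof. by have := expectation_coef h; rewrite unlock /mean /Rintegral => ->. Qed.

Lemma deriv_at1 (p : {poly R}) : p^`().[1] = \sum_(i < size p) i%:R * p`_i.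
Proof.
rewrite -[in LHS](coefK p) poly_def raddf_sum horner_sum; apply: eq_bigr => i _.
by rewrite /= derivZ derivXn hornerZ hornerMn hornerXn expr1n mulrC.
Qed.

Lemma deriv2_at1 (p : {poly R}) :
  p^`().[1] + p^`()^`().[1] = \sum_(i < size p) i%:R ^+ 2 * p`_i.
Proof.
have -> : p^`()^`().[1] = \sum_(i < size p) p`_i * (i.-1%:R * i%:R).
  have -> : p^`()^`() = \sum_(i < size p) p`_i *: ('X^i)^`()^`().
    have -> : p^`()^`() = (\sum_(i < size p) p`_i *: 'X^i)^`()^`() by rewrite -poly_def coefK.
    rewrite (raddf_sum deriv) (raddf_sum deriv).
    by apply: eq_bigr => i _; rewrite /= !derivZ.
  rewrite horner_sum; apply: eq_bigr => i _.
  by rewrite hornerZ derivXn derivMn derivXn !hornerMn hornerXn expr1n -mulr_natr.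
rewrite deriv_at1 -big_split; apply: eq_bigr => i _ /=.
case: (i : nat) => [|n] /=; first by rewrite expr0n /= !mul0r !mulr0 addr0.
by rewrite -natr1; ring.
Qed.

Variables (w mu v : R).
Hypothesis moments : poly_moments G w mu v.

Let w_neq0 : w != 0. Proof. by have [<- _ _] := moments. Qed.
Let sum_coef : \sum_(i < size G) G`_i = w.
Proof.
have [<- _ _] := moments; rewrite horner_coef; apply: eq_bigr => i _.
by rewrite expr1n mulr1.
Qed.

Lemma expectation_law : ('E_P[realRV X] = mu%:E)%E.
Proof.
rewrite (expectation_coef (fun i => i%:R)) -deriv_at1; congr EFin.
by have [-> -> _] := moments; rewrite mulrC mulKf.
Qed.

Lemma centered_second_moment :
  (\sum_(i < size G) (i%:R - mu) ^+ 2 * G`_i) / G.[1] = v.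
Proof.
have [E0 E1 E2] := moments; rewrite deriv2_at1 in E2; rewrite deriv_at1 in E1.
rewrite (eq_bigr (fun i : 'I_(size G) => i%:R ^+ 2 * G`_i + ((- 2 * mu) * (i%:R * G`_i)
  + mu ^+ 2 * G`_i))) => [|i _]; last by ring.
rewrite !big_split /= -!mulr_sumr E1 E2 sum_coef E0; field; exact: w_neq0.
Qed.

Lemma variance_law : ('V_P[realRV X] = v%:E)%E.
Proof.
rewrite -centered_second_moment -(expectation_coef (fun i => (i%:R - mu) ^+ 2)).
rewrite /variance unlock expectation_law /=; congr ('E_P[_])%E.

Qed.

Local Notation W := (standardize P (realRV X)).

Lemma standardizeE : W = fun x => ((X x)%:R - mu) / Num.sqrt v.
Proof. by rewrite /standardize expectation_law variance_law. Qed.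

(** The characteristic function of the standardized variable, read off from
    the values of G on the unit circle. *)
Lemma mean_cos_standardize theta al :
  let t := theta / Num.sqrt v in
  mean P (fun x => cos (theta * W x + al))
  = complex.Re (cis al * (cis (- (t * mu)) * (char_eval t G / w%:C%C))).
Proof.
move=> t; rewrite standardizeE.
rewrite (mean_coef (fun i => cos (theta * ((i%:R - mu) / Num.sqrt v) + al))).
have [-> _ _] := moments.
rewrite char_evalE mulrA -cisD mulrA mulr_sumr mulr_suml mulr_suml.
rewrite (raddf_sum (@complex.Re R)); apply: eq_bigr => i _.
have -> : (w%:C%C)^-1 = (w^-1)%:C%C by rewrite fmorphV.
have -> : theta * ((i%:R - mu) / Num.sqrt v) + al = al - t * mu + t * i%:R by rewrite /t; ring.
rewrite [cis _ * _]mulrCA -cisD; move: (_ + _) => x.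
by rewrite /cis /=; ring.
Qed.

(** The inequality of Chebyshev; it provides tightness uniformly in N. *)
Lemma prob_standardize_ge K : 0 < v -> 0 < K ->
  prob P [set x | K <= `|W x|] <= K ^- 2.
Proof.
move=> v0 K0; have K20 : 0 < K ^+ 2 by rewrite exprn_gt0.
have sv : Num.sqrt v ^+ 2 = v by rewrite sqr_sqrtr // ltW.
have -> : K ^- 2 = K ^- 2 * mean P (fun x => W x ^+ 2).
  rewrite standardizeE (mean_coef (fun i => ((i%:R - mu) / Num.sqrt v) ^+ 2)).
  rewrite (eq_bigr (fun i : 'I_(size G) => v^-1 * ((i%:R - mu) ^+ 2 * G`_i))) => [|i _]; last first.
    by rewrite expr_div_n sv; ring.
  by rewrite -mulr_sumr -mulrA centered_second_moment mulVf ?gt_eqF // mulr1.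
have mA := measurable_normr_ge measurable_standardize K.
rewrite -mean_indic // standardizeE /mean.
have E : \1_[set x | K <= `|((X x)%:R - mu) / Num.sqrt v|] =
   (fun x : T => (K <= `|((X x)%:R - mu) / Num.sqrt v|)%R%:R : R).
  apply/funext => x; rewrite indicE; congr (_ %:R).
  by congr (nat_of_bool _); apply/idP/idP; rewrite inE.
rewrite E -!/(mean P _).
rewrite (mean_coef (fun i => (K <= `|(i%:R - mu) / Num.sqrt v|)%R%:R)).
rewrite (mean_coef (fun i => ((i%:R - mu) / Num.sqrt v) ^+ 2)).
have G0 i : 0 <= G`_i.
  have := mass_of_pgf G1 X_pgf i => H.
  have : 0 <= mass_at X i by rewrite /mass_at fine_ge0.
  by rewrite H pmulr_lge0 ?invr_gt0.
rewrite mulrA; apply: ler_wpM2r; first by rewrite invr_ge0 ltW.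
rewrite mulr_sumr; apply: ler_sum => i _; rewrite mulrA; apply: ler_wpM2r => //.
move: (_ / _) => y; case: (leP K `|y|) => Ky /=; last by rewrite mulr_ge0 ?sqr_ge0 // invr_ge0 ltW.
rewrite mulrC ler_pdivlMr // mul1r -(real_normK (num_real y)).
by rewrite lerXn2r ?nnegrE // ltW.
Qed.

End PolynomialLaw.

(** * The mean *)

Section MeanFormula.
Variables (R : realType) (m : nat) (L : nat -> nat).
Hypothesis L0 : L 0 = 0%N.

Local Notation Ex := (site_average m L).
Local Notation e := (level_mean R m L).
Local Notation S i := (\sum_(i <= k < m.+1) (L k)%:R / k.+1%:R : R).

(** Abel summation: with the tails S as unknowns instead of the labels, the
    quadratic terms of the formula for the mean agree one by one. *)
Lemma label_of_tails i : (1 <= i <= m)%N -> (L i)%:R = i.+1%:R * (S i - S i.+1) :> R.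
Proof.
move=> /andP[_ im]; by rewrite [S i]big_ltn // addrK mulrC divfK.
Qed.

Lemma mean_at_meanE : mean_at_mean R m L =
  \sum_(1 <= i < m.+1) ((i%:R / 2 + i%:R ^+ 2) * S i ^+ 2 + i%:R * S i * below R L i).
Proof.
rewrite /mean_at_mean big_nat [RHS]big_nat; apply: eq_bigr => i im.
rewrite label_of_tails // /level_mean; move: (S i) (S i.+1) (below R L i) => x y z.
by rewrite -natr1; field.
Qed.

Lemma sum_level_cov (c : R) n : \sum_(1 <= i < n.+1)
    ((i%:R / c - i%:R * i%:R / c ^+ 2) + (i%:R / c - i%:R * i.+1%:R / c ^+ 2))
  = n%:R * (n%:R + 1) / c
    - (n%:R * (n%:R + 1) * (2 * n%:R + 1) / 3 + n%:R * (n%:R + 1) / 2) / c ^+ 2.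
Proof.
elim: n => [|n IH]; first by rewrite big_geq // !mul0r addr0 !mul0r subr0.
rewrite big_nat_recr //= IH -[n.+2%:R]natr1 -![n.+1%:R]natr1.
by move: (n%:R : R) (c ^+ 2)^-1 c^-1 => x u v; field.
Qed.

(** For i = m both sides vanish: level m + 1 is identically 0, and no site of label
    at most m reaches it. *)
Lemma average_neighbours i : (1 <= i <= m)%N ->
  Ex (fun J => dev R m L J i * dev R m L J i.+1)
  = \sum_(1 <= k < m.+1) (L k)%:R * level_cov R k i i.+1.
Proof.
move=> im; have [im'|mi] := leqP i.+1 m; first by rewrite average_dev2.
rewrite big_nat big1 => [|k km]; last first.
  rewrite /level_cov (maxn_idPr _) // (_ : (i < k)%N = false) ?mul0r ?mulr0 //.
  by lia.
rewrite (eq_site_average (g := fun=> 0)) ?site_average_cst // => J [sJ _].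
by rewrite [X in _ * X]dev_top ?mulr0.
Qed.

Lemma average_quadratic_part : Ex (quadratic_part R m L) =
  \sum_(1 <= k < m.+1) (4 * k%:R * (k%:R + 2) - 6 * k%:R) / (24 * (k%:R + 1)) * (L k)%:R.
Proof.
rewrite site_average_sum big_nat.
rewrite (eq_bigr (fun i => \sum_(1 <= k < m.+1)
   (L k)%:R * (level_cov R k i i + level_cov R k i i.+1) / 2)); last first.
  move=> i im; rewrite site_averageZr site_averageD average_neighbours //.
  rewrite (eq_site_average (g := fun J => dev R m L J i * dev R m L J i)) => [|J _]; last by rewrite expr2.
  rewrite average_dev2 // -big_split mulr_suml.
  by apply: eq_bigr => k _; rewrite /= -mulrDr.
rewrite -big_nat exchange_big /= big_nat [RHS]big_nat; apply: eq_bigr => k /andP[k1 km].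
rewrite -mulr_suml -mulr_sumr.
rewrite (big_cat_nat (n := k.+1)) //=.
rewrite [X in _ + X]big_nat [X in _ + X]big1 ?addr0; last first.
  move=> i /andP[ki _]; rewrite /level_cov maxnn (_ : (i <= k)%N = false); last by lia.
  by rewrite (maxn_idPr _) // (_ : (i < k)%N = false) ?mul0r ?addr0 //; lia.
have k0 : k%:R + 1 != 0 :> R by rewrite natr1 pnatr_eq0.
rewrite big_nat (eq_bigr (fun i => (i%:R / k.+1%:R - i%:R * i%:R / k.+1%:R ^+ 2)
   + (i%:R / k.+1%:R - i%:R * i.+1%:R / k.+1%:R ^+ 2))).
  rewrite -big_nat sum_level_cov -natr1; field; exact: k0.
move=> i /andP[i1 ik]; rewrite /level_cov maxnn minnn (_ : (i <= k)%N = true) ?mul1r //.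
congr (_ + _); rewrite (maxn_idPr _) // (minn_idPl _) //.
case: (ltnP i k) => [_|ki]; first by rewrite mul1r.
have -> : i = k by lia.
by rewrite mul0r -natr1; field.
Qed.

Lemma average_cond_meanE : Ex (cond_mean R m L) =
  \sum_(1 <= i < m.+1)
    ((i%:R / 2 + i%:R ^+ 2) * S i ^+ 2 + i%:R * S i * (\sum_(1 <= k < i) (L k)%:R)
     + (4 * i%:R * (i%:R + 2) - 6 * i%:R) / (24 * (i%:R + 1)) * (L i)%:R).
Proof.
by rewrite average_cond_mean // mean_at_meanE average_quadratic_part -big_split.
Qed.

End MeanFormula.

(** * The limit of the variance *)

Section VarianceLimit.
Variables (R : realType) (m : nat) (L : nat -> 'I_m -> nat) (a : 'rV[R]_m).
Hypothesis L_cvg : forall i : 'I_m, (L N i)%:R / N%:R @[N --> \oo] --> a 0 i.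

Local Notation L' N := (at1 (L N)).
Local Notation A := (at1 (a 0)).
Local Notation b := (bcoef a).
Local Notation S i := (\sum_(i <= k < m.+1) A k / k.+1%:R).

Let cvg_ext (f g : nat -> R) (l : R) : (forall N, (0 < N)%N -> f N = g N) ->
  f N @[N --> \oo] --> l -> g N @[N --> \oo] --> l.
Proof.
move=> fg; apply: cvg_trans; apply: near_eq_cvg; near=> N; apply: fg.
by near: N; exact: nbhs_infty_gt.
Unshelve. all: by end_near. Qed.

Let cvg_nat_sum (p q : nat) (f : nat -> nat -> R) (l : nat -> R) :
  (forall i, (p <= i < q)%N -> f i N @[N --> \oo] --> l i) ->
  \sum_(p <= i < q) f i N @[N --> \oo] --> \sum_(p <= i < q) l i.
Proof.
elim: q => [|q IH] fl.
  by rewrite big_geq //; under eq_fun do rewrite big_geq //; exact: cvg_cst.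
have [qp|pq] := ltnP q p.
  by rewrite big_geq //; under eq_fun do rewrite big_geq //; exact: cvg_cst.
rewrite big_nat_recr //=; under eq_fun do rewrite big_nat_recr //=.
apply: cvgD; last by apply: fl; rewrite pq leqnn.
by apply: IH => i /andP[pi iq]; apply: fl; rewrite pi ltnW.
Qed.

Lemma cvg_label k : (L' N k)%:R / N%:R @[N --> \oo] --> A k.
Proof.
case: k => [|k] /=; first by under eq_fun do rewrite mul0r; exact: cvg_cst.
by case: insubP => [i _ _|_] /=; [exact: L_cvg|under eq_fun do rewrite mul0r; exact: cvg_cst].
Qed.

Lemma cvg_invn : (N%:R : R)^-1 @[N --> \oo] --> (0 : R).
Proof.
rewrite -(cvg_shiftn 1); under eq_fun do rewrite addn1; exact: cvg_harmonic.
Qed.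

Lemma cvg_level_mean l : level_mean R m (L' N) l / N%:R @[N --> \oo] --> b l.
Proof.
rewrite /level_mean /bcoef; under eq_fun do rewrite -mulrA mulr_suml.
apply: cvgM; first exact: cvg_cst.
apply: cvg_nat_sum => k _; under eq_fun do rewrite mulrAC.
by apply: cvgM; [exact: cvg_label|exact: cvg_cst].
Qed.

Lemma cvg_below i : below R (L' N) i / N%:R @[N --> \oo] --> \sum_(1 <= l < i) A l.
Proof.
by rewrite /below; under eq_fun do rewrite mulr_suml; apply: cvg_nat_sum => k _; exact: cvg_label.
Qed.

Lemma cvg_site_count :
  (site_count m (L' N))%:R / N%:R @[N --> \oo] --> \sum_(1 <= k < m.+1) A k.
Proof.
rewrite /site_count; under eq_fun do rewrite natr_sum mulr_suml.
by apply: cvg_nat_sum => k _; exact: cvg_label.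
Qed.

(** Half of the vector f, extended to all indices. *)
Let fhalf i : R :=
  (A i + b i.+1 + b i.-1 + 2 * b i + 2 * \sum_(1 <= l < i) A l) / 2.

Lemma cvg_gradient i : gradient R m (L' N) i / N%:R @[N --> \oo] --> fhalf i.
Proof.
have -> : (fun N => gradient R m (L' N) i / N%:R) = fun N =>
    level_mean R m (L' N) i / N%:R
    + (level_mean R m (L' N) i.+1 / N%:R + level_mean R m (L' N) i.-1 / N%:R) / 2
    + below R (L' N) i / N%:R + (L' N i)%:R / N%:R / 2.
  by apply/funext => N; rewrite /gradient; ring.
have -> : fhalf i = b i + (b i.+1 + b i.-1) / 2 + \sum_(1 <= l < i) A l + A i / 2.
  by rewrite /fhalf; field.
have e0 := @cvg_level_mean i; have e1 := @cvg_level_mean i.+1; have e2 := @cvg_level_mean i.-1.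
apply: cvgD; last by apply: cvgM; [exact: cvg_label|exact: cvg_cst].
apply: cvgD; last exact: cvg_below.
by apply: cvgD => //; apply: cvgM; [exact: cvgD|exact: cvg_cst].
Qed.

Lemma bcoefE i : b i = i%:R * S i. Proof. by []. Qed.

Let label_tails i : (1 <= i <= m)%N -> A i = i.+1%:R * (S i - S i.+1).
Proof. by move=> /andP[_ im]; rewrite [S i]big_ltn // addrK mulrC divfK. Qed.

(** Since a_i + b_(i+1) = (i + 1) S_i and b_i = i S_i, the first factor is S_i and
    each term is a positive multiple of S_i^3. *)
Lemma vconstE : vconst a = 12^-1 * \sum_(1 <= i < m.+1) i%:R * i.+1%:R * S i ^+ 3.
Proof.
rewrite /vconst; congr (_ * _); rewrite big_nat [RHS]big_nat; apply: eq_bigr => i im.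
rewrite label_tails // !bcoefE; move: (S i) (S i.+1) => x y.
by rewrite -natr1; ring.
Qed.

Lemma cvg_var_at_mean : var_at_mean R m (L' N) / N%:R ^+ 3 @[N --> \oo] --> vconst a.
Proof.
rewrite /vconst mulr_sumr.
apply: (cvg_ext (f := fun N => \sum_(1 <= i < m.+1) (12^-1 *
  (((L' N i)%:R / N%:R + level_mean R m (L' N) i.+1 / N%:R - level_mean R m (L' N) i / N%:R)
  * (level_mean R m (L' N) i / N%:R)
  * ((L' N i)%:R / N%:R + level_mean R m (L' N) i.+1 / N%:R + N%:R^-1))))).
  move=> N N0; rewrite /var_at_mean mulr_suml; apply: eq_bigr => i _.
  by field; rewrite pnatr_eq0 -lt0n.
apply: cvg_nat_sum => i _; apply: cvgM; first exact: cvg_cst.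
have ci := @cvg_label i; have e1 := @cvg_level_mean i.+1; have e0 := @cvg_level_mean i.
apply: cvgM; first by apply: cvgM => //; apply: cvgB => //; exact: cvgD.
rewrite -[X in _ --> X]addr0; apply: cvgD; [exact: cvgD|exact: cvg_invn].
Qed.

Lemma sum_from (M : nat) (F : nat -> R) : (1 <= M)%N ->
  \sum_(M <= k < m.+1) F k = \sum_(1 <= k < m.+1) (M <= k)%N%:R * F k.
Proof.
move=> M1; rewrite (big_nat_widenl _ 1) //= big_mkcond; apply: eq_bigr => k _.
by case: (M <= k)%N; rewrite ?mul1r ?mul0r.
Qed.

(** Sigma is the limiting covariance matrix of the levels divided by the square
    root of N. *)
Lemma SigmaE (i j : 'I_m) :
  Sigma a i j = \sum_(1 <= k < m.+1) A k * level_cov R k i.+1 j.+1.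
Proof.
rewrite mxE /= !(@sum_from (maxn i.+1 j.+1)) ?leq_max // !mulr_sumr -sumrB; apply: eq_bigr => k _.
by rewrite /level_cov; ring.
Qed.

Lemma quadratic_formE : 4^-1 * (fvec a *m Sigma a *m (fvec a)^T) 0 0
  = \sum_(1 <= k < m.+1) A k * \sum_(1 <= i < m.+1) \sum_(1 <= l < m.+1)
      fhalf i * fhalf l * level_cov R k i l.
Proof.
have F (i : 'I_m) : fvec a 0 i = 2 * fhalf i.+1 by rewrite mxE /fhalf; field.
rewrite mxE mulr_sumr.
under eq_bigr do rewrite mxE [_^T _ _]mxE mulr_suml mulr_sumr.
have E (G : nat -> nat -> R) : \sum_(1 <= i < m.+1) \sum_(1 <= l < m.+1) G i l
   = \sum_(l < m) \sum_(i < m) G i.+1 l.+1.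
  rewrite exchange_big /= big_add1 big_mkord; apply: eq_bigr => l _.
  by rewrite big_add1 big_mkord.
under [RHS]eq_bigr do rewrite E mulr_sumr.
rewrite [RHS]exchange_big; apply: eq_bigr => l _.
under [RHS]eq_bigr do rewrite mulr_sumr.
rewrite [RHS]exchange_big; apply: eq_bigr => i _ /=.
rewrite SigmaE !F mulr_sumr mulr_suml mulr_sumr; apply: eq_bigr => k _.
by field.
Qed.

Lemma cvg_linear_var : linear_var R m (L' N) / N%:R ^+ 3 @[N --> \oo]
  --> 4^-1 * (fvec a *m Sigma a *m (fvec a)^T) 0 0.
Proof.
rewrite quadratic_formE.
apply: (cvg_ext (f := fun N => \sum_(1 <= k < m.+1) ((L' N k)%:R / N%:R) *
  \sum_(1 <= i < m.+1) \sum_(1 <= l < m.+1) (gradient R m (L' N) i / N%:R)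
     * (gradient R m (L' N) l / N%:R) * level_cov R k i l)).
  move=> N N0; rewrite /linear_var /linear_part variance_linear // mulr_suml.
  rewrite big_nat [RHS]big_nat; apply: eq_bigr => k /andP[_ km].
  rewrite (@step_var_sites R m k) // mulr_sumr [RHS]mulrAC mulr_sumr.
  apply: eq_bigr => i _; rewrite !mulr_sumr; apply: eq_bigr => l _.
  by field; rewrite pnatr_eq0 -lt0n.
apply: cvg_nat_sum => k _; apply: cvgM; first exact: cvg_label.
apply: cvg_nat_sum => i _; apply: cvg_nat_sum => l _.
by apply: cvgM; [apply: cvgM; exact: cvg_gradient|exact: cvg_cst].
Qed.

Lemma labels_limit_ge0 k : 0 <= A k.
Proof. by apply: cvgr_to_ge (@cvg_label k) _; apply: nearW => N; rewrite divr_ge0. Qed.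

Hypothesis a_neq0 : a != 0.

Lemma exists_label_limit : exists2 k, (1 <= k <= m)%N & 0 < A k.
Proof.
have [i ai] : exists i, a 0 i != 0.
  apply/existsP; apply: contraR a_neq0 => /existsPn H.
  by apply/eqP/rowP => i; rewrite mxE; apply/eqP; rewrite -[_ == _]negbK H.
exists i.+1; first by rewrite /= ltn_ord.
have := labels_limit_ge0 i.+1; rewrite le_eqVlt => /orP[|//].
by rewrite eq_sym (at1_ord (a 0)) (negbTE ai).
Qed.

Lemma sites_limit_gt0 : 0 < \sum_(1 <= k < m.+1) A k.
Proof.
have [k km Ak] := exists_label_limit.
rewrite (@bigD1_nat _ _ _ 1 m.+1 k) // ltr_pwDl //.
by apply: sumr_ge0 => i _; exact: labels_limit_ge0.
Qed.

(** The quadratic form is nonnegative as a limit of variances, and in vconst the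
    tail S_k is positive when a_k is. *)
Lemma variance_limit_gt0 : 0 < variance_limit a.
Proof.
have S0 i : 0 <= S i.
  by apply: sumr_ge0 => k _; rewrite divr_ge0 // labels_limit_ge0.
have [k /andP[k1 km] Ak] := exists_label_limit.
rewrite /variance_limit; apply: ltr_pwDr; last first.
  apply: cvgr_to_ge (@cvg_linear_var) _; apply: nearW => N.
  by rewrite divr_ge0 ?exprn_ge0 // linear_var_ge0.
rewrite vconstE mulr_gt0 // (@bigD1_nat _ _ _ 1 m.+1 k) ?k1 //.
apply: ltr_pwDl; last by apply: sumr_ge0 => i _; rewrite !mulr_ge0 ?exprn_ge0.
apply: mulr_gt0; first by rewrite mulr_gt0 // ltr0n.
by rewrite exprn_gt0 // big_ltn // ltr_pwDl ?divr_gt0.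
Qed.

Lemma site_count_eventually : \forall N \near \oo, (0 < N)%N /\ (0 < site_count m (L' N))%N.
Proof.
near=> N; split; first by near: N; exact: nbhs_infty_gt.
have : 0 < (site_count m (L' N))%:R / N%:R :> R.
  by near: N; exact: (cvgr_gt _ (@cvg_site_count) _ sites_limit_gt0).
by rewrite lt0n; apply: contraTneq => ->; rewrite mul0r ltxx.
Unshelve. all: by end_near. Qed.

Local Notation s N := (Num.sqrt ((site_count m (L' N))%:R : R)).

Lemma cvg_sqrt_site_count : s N / N%:R @[N --> \oo] --> (0 : R).
Proof.
apply: (cvg_ext (f := fun N => Num.sqrt ((site_count m (L' N))%:R / N%:R * N%:R^-1))).
  move=> N N0; rewrite -mulrA sqrtrM // -expr2 sqrtr_sqr ger0_norm ?invr_ge0 ?exprn_ge0 ?sqrtr_ge0 ?ler0n //.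
rewrite -[X in _ --> X](sqrtr0 R) -(mulr0 (\sum_(1 <= k < m.+1) A k)).
apply: continuous_cvg; first exact: sqrt_continuous.
by apply: cvgM; [exact: cvg_site_count|exact: cvg_invn].
Qed.

Lemma cvg_inv_sqrt_site_count : (s N)^-1 @[N --> \oo] --> (0 : R).
Proof.
apply: (cvg_ext (f := fun N => Num.sqrt (((site_count m (L' N))%:R / N%:R)^-1 * N%:R^-1))).
  move=> N N0; rewrite invf_div mulrAC mulfV ?mul1r ?sqrtrV // pnatr_eq0 -lt0n //.
rewrite -[X in _ --> X](sqrtr0 R) -(mulr0 (\sum_(1 <= k < m.+1) A k)^-1).
apply: continuous_cvg; first exact: sqrt_continuous.
apply: cvgM; last exact: cvg_invn.
by apply: cvgV; [rewrite gt_eqF // sites_limit_gt0|exact: cvg_site_count].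
Qed.

(** The error in [total_var_estimate] has order s^5, and s^5 / N^3 tends to 0. *)
Lemma cvg_total_var :
  total_var R m (L' N) / N%:R ^+ 3 @[N --> \oo] --> variance_limit a.
Proof.
pose lead N : R := (linear_var R m (L' N) + var_at_mean R m (L' N)) / N%:R ^+ 3.
have cl : lead N @[N --> \oo] --> variance_limit a.
  rewrite /lead; under eq_fun do rewrite mulrDl.
  by apply: cvgD; [exact: cvg_linear_var|exact: cvg_var_at_mean].
pose err N : R := 30 * m%:R ^+ 2 * (((site_count m (L' N))%:R / N%:R) ^+ 2 * (s N / N%:R)).
have ce : err N @[N --> \oo] --> (0 : R).
  rewrite -(mulr0 (30 * m%:R ^+ 2)) -[X in _ * X](mulr0 ((\sum_(1 <= k < m.+1) A k) ^+ 2)).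
  apply: cvgM; first exact: cvg_cst.
  apply: cvgM; last exact: cvg_sqrt_site_count.
  by under eq_fun do rewrite expr2; rewrite expr2; apply: cvgM; exact: cvg_site_count.
have cd : total_var R m (L' N) / N%:R ^+ 3 - lead N @[N --> \oo] --> (0 : R).
  apply: norm_cvg0; apply: (@squeeze_cvgr _ _ _ _ (cst 0) err) => //; last exact: cvg_cst.
  have H := site_count_eventually; near=> N.
  have [N0 c0] : (0 < N)%N /\ (0 < site_count m (L' N))%N by near: N.
  rewrite normr_ge0 /= /lead -mulrBl normrM [X in _ * X]ger0_norm; last by rewrite invr_ge0 exprn_ge0.
  have est := total_var_estimate R (erefl : L' N 0 = 0%N) c0.
  apply: le_trans (ler_wpM2r _ est) _; first by rewrite invr_ge0 exprn_ge0.
  have s2 : s N ^+ 2 = (site_count m (L' N))%:R by rewrite sqr_sqrtr.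
  rewrite /err -s2 sqrtr_sqr (ger0_norm (sqrtr_ge0 _)) le_eqVlt; apply/orP; left; apply/eqP.
  by field; rewrite pnatr_eq0 -lt0n.
have -> : (fun N => total_var R m (L' N) / N%:R ^+ 3)
    = fun N => lead N + (total_var R m (L' N) / N%:R ^+ 3 - lead N).
  by apply/funext => N; rewrite addrC subrK.
by rewrite -[X in _ --> X]addr0; exact: cvgD.
Unshelve. all: by end_near. Qed.

(** The standard deviation has order s^3: a fixed argument theta of the
    standardized variable corresponds to t = theta / sigma with |t| s^3 bounded,
    as [char_estimate_scaled] requires. *)
Lemma cvg_scale : s N ^+ 3 / Num.sqrt (total_var R m (L' N)) @[N --> \oo]
  --> Num.sqrt ((\sum_(1 <= k < m.+1) A k) ^+ 3 / variance_limit a).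
Proof.
apply: (cvg_ext (f := fun N => Num.sqrt (((site_count m (L' N))%:R / N%:R) ^+ 3
    / (total_var R m (L' N) / N%:R ^+ 3)))).
  move=> N N0; have N3 : N%:R ^+ 3 != 0 :> R by rewrite expf_neq0 // pnatr_eq0 -lt0n.
  rewrite expr_div_n invf_div mulrA divfK //.
  rewrite sqrtrM ?exprn_ge0 // sqrtrV ?total_var_ge0 //; congr (_ / _).
  rewrite -[X in X ^+ 3](sqr_sqrtr (ler0n R _)) -exprM mulnC exprM sqrtr_sqr ger0_norm ?invr_ge0 ?exprn_ge0 ?sqrtr_ge0 ?ler0n //.
apply: continuous_cvg; first exact: sqrt_continuous.
apply: cvgM; last by apply: cvgV; [rewrite gt_eqF // variance_limit_gt0|exact: cvg_total_var].
have cs := @cvg_site_count.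
under eq_fun do rewrite !exprS expr0 mulr1; rewrite !exprS expr0 mulr1.
by apply: cvgM => //; exact: cvgM.
Qed.

End VarianceLimit.

(** * Asymptotic normality *)

Section FusionLaw.
Context (d : measure_display) (T : measurableType d) (R : realType).
Variables (P : probability T R) (X : {RV P >-> nat}) (m : nat) (L : 'I_m -> nat).

Local Notation G := (basic_specialization R L).
Local Notation L' := (at1 L).
Local Notation Ex := (site_average m L').
Local Notation s := (Num.sqrt ((site_count m L')%:R : R)).
Local Notation v := (total_var R m L').
Local Notation W := (standardize P (realRV X)).

Hypothesis X_pgf : has_pgf X (fun q => G.[q] / G.[1]).

Let G_box : G = box_sum m (site_count m L') (supernomial_term R m L').
Proof. exact: basic_specialization_box. Qed.

Let moments := poly_moments_specialization G_box.

Let G1_gt0 : 0 < G.[1].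
Proof. by have [-> _ _] := moments; rewrite ltr0n config_count_gt0. Qed.

Lemma expectation_fusion : ('E_P[realRV X] = (mean_formula R L)%:E)%E.
Proof.
by rewrite (expectation_law G1_gt0 X_pgf moments) average_cond_meanE.
Qed.

Lemma variance_fusion : ('V_P[realRV X] = v%:E)%E.
Proof. exact: (variance_law G1_gt0 X_pgf moments). Qed.

Lemma prob_fusion_ge K : 0 < v -> 0 < K -> prob P [set x | K <= `|W x|] <= K ^- 2.
Proof. exact: (prob_standardize_ge G1_gt0 X_pgf moments). Qed.

(** The law of X is a mixture over the levels, so its characteristic function is
    the average estimated in [char_estimate_scaled], taken at
    t = theta / sqrt v. *)
Lemma mean_cos_fusion theta al tau : (0 < site_count m L')%N -> 0 < v ->
  `|theta| * (s ^+ 3 / Num.sqrt v) <= tau ->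
  `|mean P (fun x => cos (theta * W x + al)) - expR (- (theta ^+ 2 / 2)) * cos al|
  <= char_const m tau / s.
Proof.
move=> c0 v0 tau_ge.
have sv0 : 0 < Num.sqrt v by rewrite sqrtr_gt0.
rewrite (mean_cos_standardize G1_gt0 X_pgf moments) /=.
set t := theta / Num.sqrt v.
have w0 : (config_count m L')%:R != 0 :> R[i] by rewrite pnatr_eq0 -lt0n config_count_gt0.
rewrite (char_eval_specialization t G_box) rmorph_nat [_%:R * site_average _ _ _]mulrC mulfK //.
rewrite -site_averageZ.
rewrite (eq_site_average (g := fun J => cis (t * (cond_mean R m L' J - Ex (cond_mean R m L')))
  * level_char m L' t J)) => [|J _]; last first.
  by rewrite mulrA -cisD; congr (cis _ * _); ring.
have tau_t : `|t| * s ^+ 3 <= tau.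
  by apply: le_trans tau_ge; rewrite normrM normfV (gtr0_norm sv0) mulrAC -mulrA.
apply: le_trans (char_estimate_scaled (erefl : L' 0 = 0%N) c0 tau_t).
set Z := site_average _ _ _.
have -> : t ^+ 2 * v / 2 = theta ^+ 2 / 2.
  by rewrite /t expr_div_n sqr_sqrtr ?ltW // divfK ?gt_eqF.
set g := expR _.
have -> : g * cos al = complex.Re (cis al * g%:C%C) by rewrite /cis /=; ring.
rewrite -raddfB -mulrBr; apply: le_trans (norm_Re_le _) _.
by rewrite normcM normc_cis mul1r.
Qed.

End FusionLaw.

Lemma mean_cos_normal (R : realType) (t al : R) :
  mean (normal_prob 0 1 : probability (measurableTypeR R) R)
    (fun x : measurableTypeR R => cos (t * x + al)) = expR (- (t ^+ 2 / 2)) * cos al.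
Proof.
rewrite -normal_charE; apply: integral_normal_prob; last by exists 1 => x; exact: cos_max.
apply: continuous_measurable_fun => x.
apply: (continuous_comp (f := fun x => t * x + al)); last exact: continuous_cos.
by apply: cvgD; [apply: cvgM; [exact: cvg_cst|exact: cvg_id]|exact: cvg_cst].
Qed.

Theorem theorem3p1 (R : realType) (m : nat) (m_ge1 : (1 <= m)%N)
    (L : nat -> 'I_m -> nat) (a : 'rV[R]_m)
    (L_cvg : forall i : 'I_m, (L N i)%:R / N%:R @[N --> \oo] --> a 0 i)
    (a_neq0 : a != 0)
    (d : nat -> measure_display) (T : forall N, measurableType (d N))
    (P : forall N, probability (T N) R) (X : forall N, {RV (P N) >-> nat})
    (X_pgf : forall N, (1 <= N)%N ->
      has_pgf (X N) (fun q => (basic_specialization R (L N)).[q]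
                              / (basic_specialization R (L N)).[1])) :
  [/\ cvg_in_distribution P (fun N => standardize (P N) (realRV (X N)))
        (normal_prob 0 1),
      forall N, (1 <= N)%N -> ('E_(P N)[realRV (X N)] = (mean_formula R (L N))%:E)%E
    & ((N%:R ^- 3)%:E * 'V_(P N)[realRV (X N)])%E @[N --> \oo]
        --> (variance_limit a)%:E].
Proof.
pose s N : R := Num.sqrt (site_count m (at1 (L N)))%:R.
pose v N := total_var R m (at1 (L N)).
have large : \forall N \near \oo,
    [/\ (0 < N)%N, (0 < site_count m (at1 (L N)))%N & 0 < v N].
  have H := site_count_eventually L_cvg a_neq0.
  near=> N.
  have [N0 c0] : (0 < N)%N /\ (0 < site_count m (at1 (L N)))%N by near: N.
  split=> //.
  have : 0 < v N / N%:R ^+ 3.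
    by near: N; exact: (cvgr_gt _ (cvg_total_var L_cvg a_neq0) _ (variance_limit_gt0 L_cvg a_neq0)).
  by rewrite pmulr_lgt0 // invr_gt0 exprn_gt0 // ltr0n.
split.
- apply: cvg_in_distribution_of_char.
  + by move=> N; exact: measurable_standardize.
  + move=> t al; rewrite mean_cos_normal.
    (* Any bound above the limit of |t| s^3 / sigma. *)
    pose tau := `|t| * Num.sqrt ((\sum_(1 <= k < m.+1) at1 (a 0) k) ^+ 3 / variance_limit a) + 1.
    have bounded : \forall N \near \oo, `|t| * (s N ^+ 3 / Num.sqrt (v N)) <= tau.
      apply: (cvgr_le (`|t| * Num.sqrt ((\sum_(1 <= k < m.+1) at1 (a 0) k) ^+ 3 / variance_limit a))).
        by apply: cvgM; [exact: cvg_cst|exact: cvg_scale].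
      by rewrite ltrDl.
    apply/cvgrPdist_le => e e0.
    have small : \forall N \near \oo, char_const m tau / s N <= e.
      apply: (cvgr_le 0) => //; rewrite -[X in _ --> X](mulr0 (char_const m tau)).
      by apply: cvgM; [exact: cvg_cst|exact: cvg_inv_sqrt_site_count].
    near=> N.
    have [N0 c0 v0] : [/\ (0 < N)%N, (0 < site_count m (at1 (L N)))%N & 0 < v N] by near: N.
    rewrite distrC; apply: le_trans (mean_cos_fusion (X_pgf N N0) al c0 v0 _) _.
      by near: N; exact: bounded.
    by near: N.
  + move=> e e0; exists (Num.sqrt e)^-1; first by rewrite invr_gt0 sqrtr_gt0.
    near=> N.
    have [N0 c0 v0] : [/\ (0 < N)%N, (0 < site_count m (at1 (L N)))%N & 0 < v N] by near: N.
    apply: le_trans (prob_fusion_ge (X_pgf N N0) v0 _) _; first by rewrite invr_gt0 sqrtr_gt0.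
    by rewrite exprVn invrK sqr_sqrtr // ltW.
- by move=> N N0; exact: expectation_fusion (X_pgf N N0).
apply/fine_cvgP; split.
  near=> N; have [N0 _ _] : [/\ (0 < N)%N, (0 < site_count m (at1 (L N)))%N & 0 < v N] by near: N.
  by rewrite (variance_fusion (X_pgf N N0)).
apply: cvg_trans (cvg_total_var L_cvg a_neq0).
apply: near_eq_cvg; near=> N.
have [N0 _ _] : [/\ (0 < N)%N, (0 < site_count m (at1 (L N)))%N & 0 < v N] by near: N.
by rewrite /= (variance_fusion (X_pgf N N0)) /= mulrC.
Unshelve. all: by end_near. Qed.
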